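(* Let $g,h:\mathbb{R}\to\mathbb{R}$ be locally Lipschitz continuous functions satisfying condition $(C_0)$ and at least one of the four conditions $(h_-)$, $(h_+)$, $(g_-)$, $(g_+)$ described in the context. Let $a$, $T$, $T_1$ and $a_{\lambda,\mu}$ be as in the context, and consider the system $$x'=h(y),\qquad y'=-a_{\lambda,\mu}(t)\,g(x).$$ Let $m\ge2$ be a fixed integer. Then, for each positive integer $k$, there exists $\Lambda_k>0$ such that for each $\lambda>\Lambda_k$ there exists $\mu^*=\mu^*(\lambda)$ such that for each $\mu>\mu^*$ the following holds: there exist two families of pairwise disjoint nonempty compact sets $S^{(1)}_1,\dots,S^{(1)}_{2k}$ contained in the closed first quadrant minus the origin and $S^{(2)}_1,\dots,S^{(2)}_{2k}$ contained in the closed third quadrant minus the origin, such that for every two-sided sequence $(\xi_n)_{n\in\mathbb{Z}}$ with $\xi_n\in\{1,\dots,2k\}$ for all $n$ and having minimal period $m$, the system has at least two periodic solutions $u_1,u_2$ of minimal period $mT$, not belonging to the same periodicity class, with $u_i(nT)\in S^{(i)}_{\xi_n}$ for all $n\in\mathbb{Z}$ and $i=1,2$.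
   Context: Condition $(C_0)$: $h(0)=0$ and $h(y)y>0$ for all $y\neq0$; $g(0)=0$ and $g(x)x>0$ for all $x\neq0$; $h_0:=\liminf_{|y|\to0} h(y)/y>0$ and $g_0:=\liminf_{|x|\to0} g(x)/x>0$. Conditions: $(h_-)$: $h$ is bounded on $\mathbb{R}^-$; $(h_+)$: $h$ is bounded on $\mathbb{R}^+$; $(g_-)$: $g$ is bounded on $\mathbb{R}^-$; $(g_+)$: $g$ is bounded on $\mathbb{R}^+$. The function $a:\mathbb{R}\to\mathbb{R}$ is continuous, $T$-periodic and sign-changing, and there is $T_1\in\,]0,T[$ such that $a\succ0$ on $[0,T_1]$ and $a\prec0$ on $[T_1,T]$, where $a\succ0$ on an interval $I$ means $a(t)\ge0$ for a.e. $t\in I$ and $a>0$ on a subset of $I$ of positive measure, and $a\prec0$ means $-a\succ0$. For $\lambda,\mu>0$, $a_{\lambda,\mu}(t):=\lambda a^+(t)-\mu a^-(t)$, where $a^+=(a+|a|)/2$ and $a^-=a^+-a$. Two $mT$-periodic solutions belong to the same periodicity class if one is obtained from the other by a time shift $t\mapsto t-iT$ with $i\in\{1,\dots,m-1\}$. Global continuability of solutions is not assumed. *)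

(* Defs.v *)
From HB Require Import structures.
From mathcomp Require Import all_boot all_order all_algebra.
From mathcomp Require Import all_classical all_reals all_analysis.
Set Implicit Arguments. Unset Strict Implicit. Unset Printing Implicit Defensive.
Import Order.TTheory GRing.Theory Num.Theory.
Import numFieldNormedType.Exports.
Local Open Scope classical_set_scope.
Local Open Scope ring_scope.

Section Defs.
Variable R : realType.

Definition locally_lipschitz (f : R -> R) : Prop :=
  forall x0 : R, exists delta : R, exists L : R, 0 < delta /\
    forall y z : R, `|y - x0| < delta -> `|z - x0| < delta ->
      `|f y - f z| <= L * `|y - z|.

Definition liminf_ratio_at0_pos (f : R -> R) : Prop :=
  exists c : R, exists delta : R, 0 < c /\ 0 < delta /\
    forall s : R, s != 0 -> `|s| < delta -> c <= f s / s.

Definition cond_C0 (g h : R -> R) : Prop :=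
  h 0 = 0 /\ (forall y : R, y != 0 -> 0 < h y * y) /\
  g 0 = 0 /\ (forall x : R, x != 0 -> 0 < g x * x) /\
  liminf_ratio_at0_pos h /\ liminf_ratio_at0_pos g.

Definition bounded_neg (f : R -> R) : Prop :=
  exists M : R, forall s : R, s <= 0 -> `|f s| <= M.
Definition bounded_pos (f : R -> R) : Prop :=
  exists M : R, forall s : R, 0 <= s -> `|f s| <= M.

Definition succ0_on (a : R -> R) (lo hi : R) : Prop :=
  {ae (@lebesgue_measure R), forall t : R, (lo <= t <= hi)%R -> (0 <= a t)%R} /\
  (0 < (@lebesgue_measure R) [set t : R | (lo <= t <= hi)%R /\ (0 < a t)%R])%E.

Definition prec0_on (a : R -> R) (lo hi : R) : Prop :=
  succ0_on (fun t => - a t) lo hi.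

Definition periodic_fun (T : Type) (f : R -> T) (p : R) : Prop :=
  forall t : R, f (t + p) = f t.

Definition sign_changing (a : R -> R) : Prop :=
  (exists t : R, 0 < a t) /\ (exists t : R, a t < 0).

Definition pos_part (a : R -> R) (t : R) : R := (a t + `|a t|) / 2.
Definition neg_part (a : R -> R) (t : R) : R := pos_part a t - a t.

Definition a_lm (a : R -> R) (lam mu : R) (t : R) : R :=
  lam * pos_part a t - mu * neg_part a t.

Definition is_solution (g h : R -> R) (a : R -> R) (lam mu : R)
  (u : R -> R * R) : Prop :=
  forall t : R,
    is_derive t 1 (fun s => (u s).1) (h (u t).2) /\
    is_derive t 1 (fun s => (u s).2) (- (a_lm a lam mu t * g (u t).1)).

Definition minimal_period (u : R -> R * R) (p : R) : Prop :=
  0 < p /\ periodic_fun u p /\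
  forall q : R, 0 < q -> q < p -> ~ periodic_fun u q.

(* same periodicity class (reflexive closure of the paper's relation:
   u2 is u1 shifted by i T, 0 <= i <= m-1) *)
Definition same_class (T : R) (m : nat) (u1 u2 : R -> R * R) : Prop :=
  exists i : nat, (i < m)%N /\ forall t : R, u2 t = u1 (t - i%:R * T).

Definition first_quadrant_punct : set (R * R) :=
  [set p | 0 <= p.1 /\ 0 <= p.2 /\ p != (0, 0)].
Definition third_quadrant_punct : set (R * R) :=
  [set p | p.1 <= 0 /\ p.2 <= 0 /\ p != (0, 0)].

End Defs.

Definition seq_minimal_period (xi : int -> nat) (m : nat) : Prop :=
  (0 < m)%N /\ (forall n : int, xi (n + m%:Z)%R = xi n) /\
  forall p : nat, (0 < p)%N -> (p < m)%N -> ~ (forall n : int, xi (n + p%:Z)%R = xi n).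

(* Main.v *)
(* In the coordinates x = e^s cos th, y = e^s sin th (with th in R) the system truncated to a large
   ball is globally Lipschitz. On [0, T1], where a >= 0, the flow turns clockwise. Starting from the
   first quadrant with s = sm very small, lam large forces more than k + 1 turns; with s = sp very
   large fewer than 5/4 turns are made, because one of the nonlinearities is bounded on a half-line.
   Hence along any path from s = sm to s = sp the angle at time T1 sweeps 2k quadrants that are
   copies of the second or fourth one; these label the sets S_j. On [T1, T], where a <= 0, the flow
   is of saddle type: a solution that is in the second or fourth quadrant at time T1 ends, for mu large,
   close to the origin if at time T it is on the boundary of the first quadrant, and far away if it is
   on that boundary already at time T1. So each of the 2k crossings is
   stretched across all values sm <= s <= sp in the first quadrant. Collapsing everything that misses
   the first quadrant to a value s < sm or s > sp gives total maps Psi_j of the plane for which a fixed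
   point of Psi_(xi_(m-1)) o ... o Psi_(xi_0), provided by the planar Poincare-Miranda theorem, is a
   genuine mT-periodic orbit with itinerary xi. Any period of a nontrivial solution is a period of the
   weight, hence a multiple of T, so that the minimal period is read off the itinerary. The third
   quadrant is reduced to the first by the reflection (x, y) -> (-x, -y). *)
Require Import Defs.
From HB Require Import structures.
From mathcomp Require Import all_boot all_order all_algebra.
From mathcomp Require Import all_classical all_reals all_analysis.
From mathcomp Require Import ring lra zify.
Import Order.TTheory GRing.Theory Num.Theory.
Import numFieldNormedType.Exports.
Local Open Scope classical_set_scope.
Local Open Scope ring_scope.

(** Solutions of the given system may blow up, so the work is done with nonlinearities frozen
    outside [-B, B], and the orbits found are shown afterwards never to leave that box. This avoids
    circularity only because of the order in which the constants are fixed. On [0, T1] the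
    coefficient does not involve mu, and the bounds [sp] and [Bf] obtained there depend on g and h
    only through quantities that truncation does not increase; they come before B. Then B fixes the
    Lipschitz constant K, and K fixes the drift of s, hence [sm], [sim] and [sip]; mu comes last.
    Therefore no size estimate on [T1, T] may involve mu: Gronwall is useless there, and
    monotonicity of x and y takes its place. The variable s makes the origin unreachable, so
    uniqueness and dependence on initial data hold on a full plane, and the lifted angle counts
    turns without any winding number. *)

(** * A planar Poincare-Miranda theorem *)

(* Label a grid vertex by 0 if [A], by 1 if [~~ A && B] and by 2 otherwise; [mixed p q] says that the
   edge pq joins a 1 to a 2. The number of mixed edges of a cell is odd only if all three labels occur. *)
Definition mixed (A B : nat * nat -> bool) (p q : nat * nat) : bool :=
  [&& ~~ A p, ~~ A q & B p (+) B q].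

Lemma mixed_column (A B : nat * nat -> bool) (i n : nat) :
  (forall j, ~~ A (i, j)) ->
  \big[addb/false]_(0 <= j < n) mixed A B (i, j) (i, j.+1)
  = B (i, 0%N) (+) B (i, n).
Proof.
move=> nA; elim: n => [|n IH]; first by rewrite big_nil addbb.
rewrite big_nat_recr //= IH /mixed !nA /=.
by case: (B (i, 0%N)) (B (i, n)) (B (i, n.+1)) => [] [] [].
Qed.

(** The inner horizontal edges of the strip belong to two cells each and cancel modulo 2. *)
Lemma mixed_strip (A B : nat * nat -> bool) (i n : nat) :
  (forall j, (j < n)%N ->
     mixed A B (i, j) (i, j.+1) (+) mixed A B (i.+1, j) (i.+1, j.+1)
     = mixed A B (i, j) (i.+1, j) (+) mixed A B (i, j.+1) (i.+1, j.+1)) ->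
  \big[addb/false]_(0 <= j < n) mixed A B (i, j) (i, j.+1)
  (+) \big[addb/false]_(0 <= j < n) mixed A B (i.+1, j) (i.+1, j.+1)
  = mixed A B (i, 0%N) (i.+1, 0%N) (+) mixed A B (i, n) (i.+1, n).
Proof.
elim: n => [|n IH] sq; first by rewrite !big_nil !addbb.
rewrite !big_nat_recr //= addbACA IH; last by move=> j jn; apply: sq; lia.
by rewrite sq // -addbA addKb.
Qed.

(** If no cell carried all three labels, the number of mixed edges would have the same parity in
    every column, since the bottom and top edges are never mixed. But it is 0 on the left, where [A]
    holds, and odd on the right, where the label passes from 1 to 2. *)
Lemma grid_cell (A B : nat * nat -> bool) (n : nat) :
  (forall j, A (0%N, j)) -> (forall j, ~~ A (n, j)) ->
  (forall i, B (i, 0%N)) -> (forall i, ~~ B (i, n)) ->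
  exists i j, [/\ (i < n)%N, (j < n)%N &
   let c := [:: (i, j); (i, j.+1); (i.+1, j); (i.+1, j.+1)] in
   [&& has A c, has (fun p => ~~ A p) c, has B c & has (fun p => ~~ B p) c]].
Proof.
move=> Al Ar Bb Bt; apply: contrapT => none.
have sq i j : (i < n)%N -> (j < n)%N ->
     mixed A B (i, j) (i, j.+1) (+) mixed A B (i.+1, j) (i.+1, j.+1)
     = mixed A B (i, j) (i.+1, j) (+) mixed A B (i, j.+1) (i.+1, j.+1).
  move=> ilt jlt; apply: contrapT => odd_sq; apply: none; exists i, j; split => //.
  move: odd_sq; rewrite /= /mixed.
  by case: (A (i, j)) (B (i, j)) (A (i, j.+1)) (B (i, j.+1)) (A (i.+1, j))
   (B (i.+1, j)) (A (i.+1, j.+1)) (B (i.+1, j.+1)) => [] [] [] [] [] [] [] [].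
have col i : (i <= n)%N ->
    \big[addb/false]_(0 <= j < n) mixed A B (i, j) (i, j.+1) = false.
  elim: i => [|i IH] ile.
    by rewrite big1 // => j _; rewrite /mixed Al.
  have := mixed_strip A B i n (fun j => sq i j ile).
  rewrite (IH (ltnW ile)) /= => ->.
  by rewrite /mixed !Bb !(negbTE (Bt _)) /= !andbF.
by have := col n (leqnn n); rewrite mixed_column // Bb (negbTE (Bt _)).
Qed.

Lemma poincare_miranda {R : realType} (f1 f2 : R * R -> R) (a b c d : R) :
  continuous f1 -> continuous f2 -> a < b -> c < d ->
  (forall y, f1 (a, y) < 0) -> (forall y, 0 < f1 (b, y)) ->
  (forall x, f2 (x, c) < 0) -> (forall x, 0 < f2 (x, d)) ->
  exists p : R * R, [/\ a <= p.1 <= b, c <= p.2 <= d, f1 p = 0 & f2 p = 0].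
Proof.
move=> cf1 cf2 ab cd fl fr fb ft.
pose P (n : nat) (v : nat * nat) : R * R :=
  (a + (b - a) * (v.1%:R / n.+1%:R), c + (d - c) * (v.2%:R / n.+1%:R)).
have n0 (n : nat) : (0 : R) < n.+1%:R by rewrite ltr0n.
have P0 n j : (P n (0%N, j)).1 = a by rewrite /P /= mul0r mulr0 addr0.
have P1 n j : (P n (n.+1, j)).1 = b.
  by rewrite /P /= divff ?gt_eqF // mulr1; ring.
have Q0 n i : (P n (i, 0%N)).2 = c by rewrite /P /= mul0r mulr0 addr0.
have Q1 n i : (P n (i, n.+1)).2 = d.
  by rewrite /P /= divff ?gt_eqF // mulr1; ring.
(* [C n] is the lower left vertex of a cell of the n-th grid on which both functions change sign; a
   cluster point of these vertices will be the common zero. *)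
have /choice[C HC] (n : nat) : exists v : nat * nat, [/\ (v.1 < n.+1)%N, (v.2 < n.+1)%N &
    let e := [:: v; (v.1, v.2.+1); (v.1.+1, v.2); (v.1.+1, v.2.+1)] in
    [/\ exists2 w, w \in e & f1 (P n w) < 0, exists2 w, w \in e & 0 <= f1 (P n w),
      exists2 w, w \in e & f2 (P n w) < 0 & exists2 w, w \in e & 0 <= f2 (P n w)]].
  have [] := @grid_cell (fun v => f1 (P n v) < 0) (fun v => f2 (P n v) < 0) n.+1.
  - by move=> j; rewrite (surjective_pairing (P n _)) P0.
  - by move=> j; rewrite (surjective_pairing (P n _)) P1 -leNgt ltW.
  - by move=> j; rewrite (surjective_pairing (P n _)) Q0.
  - by move=> j; rewrite (surjective_pairing (P n _)) Q1 -leNgt ltW.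
  move=> i [j [ilt jlt]] /and4P[/hasP[w1 i1 h1] /hasP[w2 i2 h2] /hasP[w3 i3 h3] /hasP[w4 i4 h4]].
  exists (i, j); split => //; split; [exists w1|exists w2|exists w3|exists w4] => //;
    by rewrite leNgt.
pose K := `[a, b]%classic `*` `[c, d]%classic.
have cK : compact K by apply: compact_setX; exact: segment_compact.
have inI (n i : nat) : (i <= n.+1)%N -> 0 <= (i%:R / n.+1%:R : R) <= 1.
  by move=> ile; rewrite divr_ge0 ?ler0n //= ler_pdivrMr // mul1r ler_nat.
have convex (u v t : R) : u <= v -> 0 <= t <= 1 -> u <= u + (v - u) * t <= v.
  by move=> uv /andP[t0 t1]; apply/andP; split; nra.
have KP : \forall n \near \oo, K (P n (C n)).
  near=> n; case: (HC n) => lt1 lt2 _; split; rewrite /= in_itv /=.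
    by apply: convex (inI n _ (ltnW lt1)); apply: ltW.
  by apply: convex (inI n _ (ltnW lt2)); apply: ltW.
have [p [Kp clp]] := cK ((fun n => P n (C n)) @ \oo) _ KP.
(* Every neighbourhood of [p] contains all vertices of one of the chosen cells: clustering supplies
   its lower left vertex, and both mesh sizes are at most M / n.+1. *)
have cell U : nbhs p U -> exists n, forall w,
    w \in [:: C n; ((C n).1, (C n).2.+1); ((C n).1.+1, (C n).2); ((C n).1.+1, (C n).2.+1)] ->
    U (P n w).
  move=> /nbhs_ballP[e /= e0 eU].
  have e20 : 0 < e / 2 by lra.
  pose M := (b - a) + (d - c).
  have M0 : 0 < M by rewrite /M; lra.
  have mesh : \forall n \near \oo, M / n.+1%:R < e / 2.
    apply: filterS (nbhs_infty_gtr (M / (e / 2))) => n nM.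
    rewrite ltr_pdivrMr // mulrC -ltr_pdivrMr //.
    by apply: lt_trans nM _; rewrite ltr_nat.
  have [q [[n [nM ->]] Bq]] : (fun q => exists n, M / n.+1%:R < e / 2 /\ q = P n (C n))
      `&` ball p (e / 2) !=set0.
    apply: clp; last exact: nbhsx_ballx.
    by apply: filterS mesh => n nM; exists n.
  exists n => w wC; apply: eU.
  have B1 : `|p.1 - (P n (C n)).1| < e / 2 by case: Bq.
  have B2 : `|p.2 - (P n (C n)).2| < e / 2 by case: Bq.
  have near_vertex (t : R) (i j : nat) : 0 < t -> t <= M ->
      (j = i) \/ (j = i.+1) -> `|t * (i%:R / n.+1%:R) - t * (j%:R / n.+1%:R)| < e / 2.
    move=> t0 tM [->|->]; first by rewrite subrr normr0.
    rewrite -mulrBr -mulrBl -natr1 opprD addrA subrr sub0r mulN1r mulrN normrN.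
    rewrite gtr0_norm ?divr_gt0 //.
    by apply: le_lt_trans nM; rewrite ler_pM2r // invr_gt0.
  have [w1 w2] : (w.1 = (C n).1 \/ w.1 = (C n).1.+1) /\
                 (w.2 = (C n).2 \/ w.2 = (C n).2.+1).
    by move: wC; rewrite !inE => /or4P[] /eqP ->; split; by [left|right].
  have V1 := near_vertex (b - a) _ _ _ _ w1.
  have V2 := near_vertex (d - c) _ _ _ _ w2.
  split.
    suff : `|p.1 - (P n w).1| < e by [].
    have := ler_distD (P n (C n)).1 p.1 (P n w).1.
    have : `|(P n (C n)).1 - (P n w).1| < e / 2.
      by rewrite /P /= opprD addrACA subrr add0r; apply: V1; rewrite /M; lra.
    by move=> *; lra.
  suff : `|p.2 - (P n w).2| < e by [].
  have := ler_distD (P n (C n)).2 p.2 (P n w).2.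
  have : `|(P n (C n)).2 - (P n w).2| < e / 2.
    by rewrite /P /= opprD addrACA subrr add0r; apply: V2; rewrite /M; lra.
  by move=> *; lra.
have zero (f : R * R -> R) : continuous f ->
    (forall n, let e := [:: C n; ((C n).1, (C n).2.+1); ((C n).1.+1, (C n).2); ((C n).1.+1, (C n).2.+1)] in
     (exists2 w, w \in e & f (P n w) < 0) /\ (exists2 w, w \in e & 0 <= f (P n w))) ->
    f p = 0.
  move=> cf Hf; apply/eqP; rewrite eq_le !leNgt; apply/andP; split; apply/negP => fp.
    have [n Hn] := cell [set q | 0 < f q] (cf p _ (open_nbhs_nbhs (conj (@open_gt R 0) fp))).
    have [[w /Hn /= wC fw] _] := Hf n.
    by move: fw; rewrite ltNge ltW.
  have [n Hn] := cell [set q | f q < 0] (cf p _ (open_nbhs_nbhs (conj (@open_lt R 0) fp))).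
  have [_ [w /Hn /= wC fw]] := Hf n.
  by move: fw; rewrite leNgt wC.
case: Kp => /= Kp1 Kp2; exists p; split.
- by move: Kp1; rewrite in_itv.
- by move: Kp2; rewrite in_itv.
- by apply: zero => // n; have [_ _ []] := HC n.
- by apply: zero => // n; have [_ _ []] := HC n.
Unshelve. all: by end_near. Qed.

(** * Calculus and planar differential equations *)

Lemma is_derive_continuous {R : realType} (f : R -> R) (x l : R) :
  is_derive x 1 f l -> {for x, continuous f}.
Proof.
by move=> [df _]; apply: differentiable_continuous; apply/derivable1_diffP.
Qed.

Lemma mean_value {R : realType} (f df : R -> R) (a b : R) : a <= b ->
  (forall t, a <= t <= b -> is_derive t 1 f (df t)) ->
  exists2 c, a <= c <= b & f b - f a = df c * (b - a).
Proof.
move=> ab fd.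
have [||c] := @MVT_segment R f df a b ab.
- by move=> x; rewrite in_itv /= => /andP[ax xb]; apply: fd; rewrite !ltW.
- apply: derivable_within_continuous => x; rewrite in_itv /= => xab.
  by have [] := fd x xab.
- by rewrite in_itv /=; exists c.
Qed.

Lemma derive_ge0_le {R : realType} (f df : R -> R) (a b : R) : a <= b ->
  (forall t, a <= t <= b -> is_derive t 1 f (df t)) ->
  (forall t, a <= t <= b -> 0 <= df t) -> f a <= f b.
Proof.
move=> ab fd df0; have [c cab fE] := mean_value _ _ _ _ ab fd.
by rewrite -subr_ge0 fE mulr_ge0 ?df0 // subr_ge0.
Qed.

Lemma derive_le0_ge {R : realType} (f df : R -> R) (a b : R) : a <= b ->
  (forall t, a <= t <= b -> is_derive t 1 f (df t)) ->
  (forall t, a <= t <= b -> df t <= 0) -> f b <= f a.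
Proof.
move=> ab fd df0; have [c cab fE] := mean_value _ _ _ _ ab fd.
by rewrite -subr_le0 fE mulr_le0_ge0 ?df0 // subr_ge0.
Qed.

Lemma derive_ge_growth {R : realType} (f df : R -> R) (m a b : R) : a <= b ->
  (forall t, a <= t <= b -> is_derive t 1 f (df t)) ->
  (forall t, a <= t <= b -> m <= df t) -> f a + m * (b - a) <= f b.
Proof.
move=> ab fd df0; have [c cab fE] := mean_value _ _ _ _ ab fd.
by rewrite -lerBrDl fE ler_wpM2r ?df0 // subr_ge0.
Qed.

Lemma derive_le_growth {R : realType} (f df : R -> R) (m a b : R) : a <= b ->
  (forall t, a <= t <= b -> is_derive t 1 f (df t)) ->
  (forall t, a <= t <= b -> df t <= m) -> f b <= f a + m * (b - a).
Proof.
move=> ab fd df0; have [c cab fE] := mean_value _ _ _ _ ab fd.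
by rewrite -lerBlDl fE ler_wpM2r ?df0 // subr_ge0.
Qed.

Lemma derive_eq0_cst {R : realType} (f : R -> R) (a b : R) : a <= b ->
  (forall t, a <= t <= b -> is_derive t 1 f 0) -> f a = f b.
Proof.
move=> ab fd; have [c _] := mean_value f (fun=> 0) _ _ ab fd.
by rewrite mul0r => /eqP; rewrite subr_eq0 => /eqP.
Qed.

Lemma ivt {R : realType} (f : R -> R) (a b v : R) : a <= b -> continuous f ->
  (f a <= v <= f b) \/ (f b <= v <= f a) -> exists2 c, a <= c <= b & f c = v.
Proof.
move=> ab cf H; have [||c] := @IVT R f a b v ab.
- exact: continuous_subspaceT.
- have [fab|fba] := leP (f a) (f b); case: H => /andP[h1 h2]; apply/andP; lra.
- by rewrite in_itv /=; exists c.
Qed.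

Lemma primitive_on_ray {R : realType} (f : R -> R) (a : R) : continuous f ->
  exists F : R -> R, forall x, a < x -> is_derive x 1 F (f x).
Proof.
move=> cf; exists (fun x => \int[lebesgue_measure]_(t in [set` Interval (BLeft a) (BRight x)]) f t).
move=> x ax; have [||||] := @continuous_FTC1 R f (BLeft a) x (x + 1).
- by rewrite ltrDl.
- apply: continuous_compact_integrable; first exact: segment_compact.
  exact: continuous_subspaceT.
- by [].
- exact: cf.
- move=> dF F'; apply: (DeriveDef dF); by rewrite -derive1E.
Qed.

Lemma primitive_exists {R : realType} (f : R -> R) (t0 v : R) : continuous f ->
  exists F : R -> R, F t0 = v /\ forall x : R, is_derive x 1 F (f x).
Proof.
move=> cf.
(* Primitives are at hand on rays only. Those on larger and larger rays, normalised to vanish at t0,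
   agree on overlaps; [N x] below picks one whose ray contains x. *)
have /choice[G HG] (n : nat) : exists F : R -> R,
    F t0 = 0 /\ forall x : R, t0 - n.+1%:R < x -> is_derive x 1 F (f x).
  have [F dF] := primitive_on_ray f (t0 - n.+1%:R) cf.
  exists (fun x => F x - F t0); split=> [|x /dF dFx]; first by rewrite subrr.
  by rewrite -[f x]subr0; apply: is_deriveB.
have Gt0 n : t0 - n.+1%:R < t0 by rewrite ltrBlDr ltrDl ltr0n.
have GE n m x : t0 - n.+1%:R < x -> t0 - m.+1%:R < x -> G n x = G m x.
  move=> nx mx; pose D := fun y => G n y - G m y.
  have dD y : t0 - n.+1%:R < y -> t0 - m.+1%:R < y -> is_derive y 1 D 0.
    by move=> ny my; rewrite -[0](subrr (f y)); apply: is_deriveB; apply HG.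
  have D0 : D t0 = 0 by rewrite /D !(proj1 (HG _)) subrr.
  apply/eqP; rewrite -subr_eq0; apply/eqP; rewrite -[RHS]D0.
  have [xt|xt] := leP x t0.
    by apply: (derive_eq0_cst D) => // t /andP[xlt _]; apply: dD; apply: lt_le_trans xlt.
  apply/esym; apply: (derive_eq0_cst D); first exact: ltW.
  by move=> t /andP[xlt _]; apply: dD; apply: lt_le_trans (Gt0 _) xlt.
pose N x := Num.truncn `|x - t0|.
have Nx x : t0 - (N x).+1%:R < x.
  have /andP[_] := truncn_itv (normr_ge0 (x - t0)).
  rewrite -/(N x) distrC => h; have := ler_norm (t0 - x); lra.
exists (fun x => v + G (N x) x); split; first by rewrite (proj1 (HG _)) addr0.
move=> x; rewrite -[f x]add0r; apply: is_deriveD.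
apply: (@near_eq_is_derive _ _ _ (G (N x))); last by apply HG.
near=> y; apply: GE => //; near: y.
by apply: open_nbhs_nbhs; split; [exact: open_gt|exact: Nx].
Unshelve. all: by end_near. Qed.

Lemma is_derive_add {R : realType} (f g : R -> R) (t a b : R) :
  is_derive t 1 f a -> is_derive t 1 g b -> is_derive t 1 (fun s => f s + g s) (a + b).
Proof. exact: is_deriveD. Qed.

Lemma is_derive_sub {R : realType} (f g : R -> R) (t a b : R) :
  is_derive t 1 f a -> is_derive t 1 g b -> is_derive t 1 (fun s => f s - g s) (a - b).
Proof. exact: is_deriveB. Qed.

Lemma is_derive_opp {R : realType} (f : R -> R) (t a : R) :
  is_derive t 1 f a -> is_derive t 1 (fun s => - f s) (- a).
Proof. exact: is_deriveN. Qed.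

Lemma is_derive_mul {R : realType} (f g : R -> R) (t a b : R) :
  is_derive t 1 f a -> is_derive t 1 g b ->
  is_derive t 1 (fun s => f s * g s) (a * g t + f t * b).
Proof.
by move=> df dg; apply: is_derive_eq (is_deriveM df dg) _; rewrite /GRing.scale /=; ring.
Qed.

Lemma is_derive_const {R : realType} (c t : R) : is_derive t 1 (fun=> c) 0.
Proof. exact: is_derive_cst. Qed.

Lemma is_derive_scale {R : realType} (c : R) (f : R -> R) (t a : R) :
  is_derive t 1 f a -> is_derive t 1 (fun s => c * f s) (c * a).
Proof.
move=> df; apply: is_derive_eq (is_derive_mul _ _ _ _ _ (is_derive_const c t) df) _.
by rewrite mul0r add0r.
Qed.

Lemma is_derive_compose {R : realType} (f g : R -> R) (t a b : R) :
  is_derive (g t) 1 f a -> is_derive t 1 g b -> is_derive t 1 (fun s => f (g s)) (a * b).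
Proof. exact: is_derive1_comp. Qed.

Lemma is_derive_expl {R : realType} (c t : R) :
  is_derive t 1 (fun s => expR (c * s)) (c * expR (c * t)).
Proof.
rewrite mulrC; apply: (is_derive_compose expR (fun s => c * s)) (is_derive_expR _) _.
by apply: is_derive_eq (is_derive_scale c id t 1 _) _; rewrite mulr1.
Qed.

Lemma gronwall {R : realType} (E dE : R -> R) (c t0 : R) :
  (forall t : R, is_derive t 1 E (dE t)) -> (forall t, `|dE t| <= c * E t) ->
  forall t, E t <= E t0 * expR (c * `|t - t0|).
Proof.
move=> dEE bnd t; have [tt0|t0t] := leP t0 t.
  have : E t * expR (- c * t) <= E t0 * expR (- c * t0).
    apply: (derive_le0_ge (fun s => E s * expR (- c * s))
              (fun s => dE s * expR (- c * s) + E s * (- c * expR (- c * s)))) => // s _.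
      by apply: is_derive_mul => //; exact: is_derive_expl.
    have := ler_norm (dE s); have := bnd s; have := expR_gt0 (- c * s); nra.
  rewrite ger0_norm ?subr_ge0 // -(ler_pM2r (expR_gt0 (c * t))) -!mulrA -!expRD.
  by rewrite !mulNr addNr expR0 mulr1 mulrBr addrC.
have : E t * expR (c * t) <= E t0 * expR (c * t0).
  apply: (derive_ge0_le (fun s => E s * expR (c * s))
            (fun s => dE s * expR (c * s) + E s * (c * expR (c * s)))) => [|s _|s _].
  - exact: ltW.
  - by apply: is_derive_mul => //; exact: is_derive_expl.
  have := ler_norm (- dE s); rewrite normrN; have := bnd s.
  have := expR_gt0 (c * s); nra.
rewrite ltr0_norm ?subr_lt0 // -(ler_pM2r (expR_gt0 (- c * t))) -!mulrA -!expRD.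
by rewrite !mulNr addrN expR0 mulr1 opprB mulrBr.
Qed.

(** Integrating the weight exp(c |t - t0|) gains a factor 1 / c on the whole line. This makes the
    Picard iteration contract globally, without cutting time into short steps. *)
Lemma exp_weight_ub {R : realType} (w dw : R -> R) (C c t0 : R) : 0 < c -> 0 <= C ->
  w t0 <= 0 -> (forall t : R, is_derive t 1 w (dw t)) ->
  (forall t, `|dw t| <= C * expR (c * `|t - t0|)) ->
  forall t, w t <= C / c * expR (c * `|t - t0|).
Proof.
move=> c0 C0 w0 dww bnd t.
have Cc : 0 <= C / c by rewrite divr_ge0 // ltW.
have dexp (k s : R) : is_derive s 1 (fun s => C / c * expR (k * (s - t0)) - w s)
    (C / c * k * expR (k * (s - t0)) - dw s).
  apply: is_derive_sub => //; rewrite -mulrA; apply: is_derive_scale.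
  rewrite mulrC; apply: (is_derive_compose expR (fun s => k * (s - t0))) => //.
  rewrite -[X in is_derive _ _ _ X]mulr1; apply: is_derive_scale.
  by rewrite -[X in is_derive _ _ _ X]subr0; apply: is_derive_sub (is_derive_const _ _).
have at0 (k : R) : 0 <= C / c * expR (k * (t0 - t0)) - w t0.
  by rewrite subrr mulr0 expR0 mulr1; lra.
rewrite -subr_ge0; have [tt0|t0t] := leP t0 t.
  have -> : `|t - t0| = t - t0 by rewrite ger0_norm // subr_ge0.
  apply: le_trans (at0 c) _.
  apply: (derive_ge0_le (fun s => C / c * expR (c * (s - t0)) - w s) _ _ _ tt0 (fun s _ => dexp c s)).
  move=> s /andP[ts _]; rewrite divfK ?gt_eqF // subr_ge0.
  have := bnd s; have -> : `|s - t0| = s - t0 by rewrite ger0_norm // subr_ge0.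
  exact: le_trans (ler_norm _).
have -> : `|t - t0| = - (t - t0) by rewrite ltr0_norm // subr_lt0.
apply: le_trans (at0 (- c)) _; rewrite mulrN -mulNr.
apply: (derive_le0_ge (fun s => C / c * expR (- c * (s - t0)) - w s) _ _ _ (ltW t0t) (fun s _ => dexp (- c) s)).
move=> s /andP[_ st]; rewrite mulrN divfK ?gt_eqF //.
have := bnd s; have -> : `|s - t0| = - (s - t0) by rewrite ler0_norm // subr_le0.
rewrite mulrN -mulNr.
have := ler_norm (- dw s); rewrite normrN; lra.
Qed.

Lemma exp_weight_norm {R : realType} (w dw : R -> R) (C c t0 : R) : 0 < c -> 0 <= C ->
  w t0 = 0 -> (forall t : R, is_derive t 1 w (dw t)) ->
  (forall t, `|dw t| <= C * expR (c * `|t - t0|)) ->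
  forall t, `|w t| <= C / c * expR (c * `|t - t0|).
Proof.
move=> c0 C0 w0 dww bnd t; rewrite ler_norml lerNl; apply/andP; split.
  apply: (exp_weight_ub (fun s => - w s) (fun s => - dw s)) => //.
  - by rewrite w0 oppr0.
  - by move=> s; rewrite normrN.
by apply: (exp_weight_ub w dw) => //; rewrite w0.
Qed.

Lemma le0_geometric {R : realType} (A k : R) : (forall n : nat, A <= k / 2 ^+ n) -> A <= 0.
Proof.
move=> H; rewrite leNgt; apply/negP => A0.
set n := Num.truncn (k / A).
have := H n.+1; have := truncnS_gt (k / A); rewrite -/n ltr_pdivrMr // => h1.
rewrite ler_pdivlMr ?exprn_gt0 // => h2.
have : (n.+1%:R : R) <= 2 ^+ n.+1 by rewrite -natrX ler_nat; apply/ltnW/ltn_expl.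
nra.
Qed.

Lemma geometric_cvg {R : realType} (x : nat -> R) (k : R) :
  (forall n, `|x n.+1 - x n| <= k / 2 ^+ n) ->
  exists l, forall n, `|x n - l| <= 2 * k / 2 ^+ n.
Proof.
move=> H.
have k0 n : 0 <= k / 2 ^+ n by apply: le_trans (H n).
(* The intervals [a n, b n] are nested, so the supremum of their left ends serves as the limit. *)
pose a n := x n - 2 * k / 2 ^+ n; pose b n := x n + 2 * k / 2 ^+ n.
have half n : 2 * k / 2 ^+ n.+1 = k / 2 ^+ n.
  by rewrite exprS invfM mulrACA divff ?mul1r // pnatr_eq0.
have two n : 2 * k / 2 ^+ n = k / 2 ^+ n + k / 2 ^+ n by ring.
have aS n : a n <= a n.+1.
  by rewrite /a half two; have := H n; rewrite ler_norml => /andP[]; lra.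
have bS n : b n.+1 <= b n.
  by rewrite /b half two; have := H n; rewrite ler_norml => /andP[]; lra.
have amono n m : a n <= a (n + m)%N.
  by elim: m => [|m IH]; rewrite ?addn0 // addnS (le_trans IH).
have bmono n m : b (n + m)%N <= b n.
  by elim: m => [|m IH]; rewrite ?addn0 // addnS (le_trans _ IH).
have ab n m : a n <= b m.
  apply: le_trans (amono n m) _; rewrite addnC; apply: le_trans _ (bmono m n).
  by rewrite /a /b two; have := k0 (m + n)%N; lra.
have hs : has_sup (range a).
  by split; [exists (a 0%N), 0%N | exists (b 0%N) => _ [n _ <-]].
exists (sup (range a)) => n; rewrite ler_distl -/(b n).
apply/andP; split; last by rewrite -lerBlDr; apply: (sup_upper_bound hs); exists n.
rewrite lerBlDr; apply: ge_sup; first by case: hs.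
by move=> _ [m _ <-]; exact: ab.
Qed.

(** * Global existence and uniqueness for planar Lipschitz fields *)

Definition solves {R : realType} (F1 F2 : R -> R -> R -> R) (u v : R -> R) : Prop :=
  forall t : R, is_derive t 1 u (F1 t (u t) (v t)) /\ is_derive t 1 v (F2 t (u t) (v t)).

(** Continuity is asked along continuous curves only, which is what integrating the right-hand side
    uses. The bound [M] gives all Picard iterates one Lipschitz constant, so that their limit is
    continuous. *)
Definition lipschitz_field {R : realType} (F : R -> R -> R -> R) (L M : R) : Prop :=
  [/\ forall u v : R -> R, continuous u -> continuous v -> continuous (fun t => F t (u t) (v t)),
      forall t x y x' y', `|F t x y - F t x' y'| <= L * (`|x - x'| + `|y - y'|) &
      forall t x y, `|F t x y| <= M].

(** With differences p and q of the components, E = p^2 + q^2 satisfies |E'| <= 2 L (|p| + |q|)^2 <=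
    4 L E, and [gronwall] applies. *)
Lemma solves_distance {R : realType} (F1 F2 : R -> R -> R -> R) (L M : R) (u v u' v' : R -> R) (t0 t : R) :
  lipschitz_field F1 L M -> lipschitz_field F2 L M -> 0 <= L ->
  solves F1 F2 u v -> solves F1 F2 u' v' ->
  (u t - u' t) ^+ 2 + (v t - v' t) ^+ 2 <=
  ((u t0 - u' t0) ^+ 2 + (v t0 - v' t0) ^+ 2) * expR (4 * L * `|t - t0|).
Proof.
move=> [_ l1 _] [_ l2 _] L0 S S'.
pose p s := u s - u' s; pose q s := v s - v' s.
pose dp s := F1 s (u s) (v s) - F1 s (u' s) (v' s).
pose dq s := F2 s (u s) (v s) - F2 s (u' s) (v' s).
apply: (gronwall (fun s => p s ^+ 2 + q s ^+ 2) (fun s => 2 * (p s * dp s + q s * dq s))).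
  move=> s; have [du dv] := S s; have [du' dv'] := S' s.
  have dps : is_derive s 1 p (dp s) by apply: is_derive_sub.
  have dqs : is_derive s 1 q (dq s) by apply: is_derive_sub.
  apply: is_derive_eq (is_derive_add _ _ _ _ _ (is_derive_mul _ _ _ _ _ dps dps)
     (is_derive_mul _ _ _ _ _ dqs dqs)) _; ring.
move=> s; have := l1 s (u s) (v s) (u' s) (v' s); have := l2 s (u s) (v s) (u' s) (v' s).
rewrite -/(p s) -/(q s) -/(dp s) -/(dq s) => h2 h1.
rewrite -(real_normK (num_real (p s))) -(real_normK (num_real (q s))).
rewrite normrM (ger0_norm (ler0n _ 2)).
have tri : `|p s * dp s + q s * dq s| <= `|p s| * `|dp s| + `|q s| * `|dq s|.
  by rewrite -!normrM ler_normD.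
have k1 := ler_wpM2l (normr_ge0 (p s)) h1; have k2 := ler_wpM2l (normr_ge0 (q s)) h2.
have := mulr_ge0 L0 (sqr_ge0 (`|p s| - `|q s|)); nra.
Qed.

Lemma solves_unique {R : realType} (F1 F2 : R -> R -> R -> R) (L M : R) (u v u' v' : R -> R) (t0 : R) :
  lipschitz_field F1 L M -> lipschitz_field F2 L M -> 0 <= L ->
  solves F1 F2 u v -> solves F1 F2 u' v' -> u t0 = u' t0 -> v t0 = v' t0 ->
  forall t, u t = u' t /\ v t = v' t.
Proof.
move=> h1 h2 L0 S S' eu ev t.
have := solves_distance F1 F2 L M u v u' v' t0 t h1 h2 L0 S S'.
rewrite eu ev !subrr expr0n /= addr0 mul0r => H.
have a := sqr_ge0 (u t - u' t); have b := sqr_ge0 (v t - v' t).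
have : (u t - u' t) ^+ 2 == 0 by rewrite eq_le a andbT; lra.
have : (v t - v' t) ^+ 2 == 0 by rewrite eq_le b andbT; lra.
by rewrite !sqrf_eq0 !subr_eq0 => /eqP -> /eqP ->.
Qed.

Lemma solves_continuous {R : realType} (F1 F2 : R -> R -> R -> R) (u v : R -> R) :
  solves F1 F2 u v -> continuous u /\ continuous v.
Proof.
by move=> S; split=> t; have [du dv] := S t; [exact: is_derive_continuous du|exact: is_derive_continuous dv].
Qed.

Lemma lipschitz_continuous1 {R : realType} (f : R -> R) (k : R) :
  (forall x y, `|f x - f y| <= k * `|x - y|) -> continuous f.
Proof.
move=> lf x; apply/cvgrPdist_lt => e e0.
have k1 : 0 < `|k| + 1 by rewrite ltr_wpDl.
near=> y; apply: le_lt_trans (lf x y) _.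
have xy : `|x - y| < e / (`|k| + 1).
  by near: y; apply: cvgr_dist_lt => //; rewrite divr_gt0.
move: xy; rewrite ltr_pdivlMr // => xy; have := ler_norm k; have := normr_ge0 (x - y); nra.
Unshelve. all: by end_near. Qed.

Lemma picard_lindelof {R : realType} (F1 F2 : R -> R -> R -> R) (L M t0 x0 y0 : R) :
  0 < L -> lipschitz_field F1 L M -> lipschitz_field F2 L M ->
  exists u v : R -> R, [/\ u t0 = x0, v t0 = y0 & solves F1 F2 u v].
Proof.
move=> L0 [c1 l1 b1] [c2 l2 b2].
have M0 : 0 <= M by apply: le_trans (b1 0 0 0).
(* [A (f, v)] is a primitive of [f] with value [v] at t0; the zero function is the default for
   discontinuous [f], which the iteration never meets. *)
have /choice[A HA] (p : (R -> R) * R) : exists F : R -> R, continuous p.1 ->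
    F t0 = p.2 /\ forall x : R, is_derive x 1 F (p.1 x).
  have [c|nc] := pselect (continuous p.1); last by exists (fun=> 0).
  by have [F HF] := primitive_exists p.1 t0 p.2 c; exists F.
pose step (w : (R -> R) * (R -> R)) :=
  (A (fun t => F1 t (w.1 t) (w.2 t), x0), A (fun t => F2 t (w.1 t) (w.2 t), y0)).
pose P n := iter n step ((fun=> x0 : R), (fun=> y0 : R)).
pose U n := (P n).1; pose V n := (P n).2.
have contD (f : R -> R) (g : R -> R) : (forall t : R, is_derive t 1 f (g t)) -> continuous f.
  by move=> df t; apply: is_derive_continuous (df t).
have cP n : continuous (U n) /\ continuous (V n).
  elim: n => [|n [cu cv]]; first by split; apply: cst_continuous.
  split; [have [_] := HA (_, x0) (c1 _ _ cu cv)|have [_] := HA (_, y0) (c2 _ _ cu cv)];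
    exact: contD.
have US n : U n.+1 t0 = x0 /\ forall t : R, is_derive t 1 (U n.+1) (F1 t (U n t) (V n t)).
  by have [cu cv] := cP n; exact: (HA (_, x0) (c1 _ _ cu cv)).
have VS n : V n.+1 t0 = y0 /\ forall t : R, is_derive t 1 (V n.+1) (F2 t (U n t) (V n t)).
  by have [cu cv] := cP n; exact: (HA (_, y0) (c2 _ _ cu cv)).
have U0 n : U n t0 = x0 by case: n => // n; case: (US n).
have V0 n : V n t0 = y0 by case: n => // n; case: (VS n).
(* The fields differ by at most L times the sum of two component differences; division by 4 L leaves
   half of the previous bound on each component. *)
pose c := 4 * L; have c0 : 0 < c by rewrite mulr_gt0.
pose K := 2 * M / c; have K0 : 0 <= K by rewrite divr_ge0 ?mulr_ge0 // ltW.
pose W t := expR (c * `|t - t0|).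
have W1 t : 1 <= W t by rewrite -expR0 ler_expR mulr_ge0 // ltW.
have contraction (f g df dg : R -> R) n :
    f t0 = g t0 -> (forall t : R, is_derive t 1 f (df t)) ->
    (forall t : R, is_derive t 1 g (dg t)) ->
    (forall t, `|df t - dg t| <= L * (4 * K / 2 ^+ n) * W t) ->
    forall t, `|f t - g t| <= K / 2 ^+ n * W t.
  move=> fg dff dgg bnd t.
  apply: le_trans (exp_weight_norm (fun s => f s - g s) (fun s => df s - dg s)
           (L * (4 * K / 2 ^+ n)) c t0 c0 _ _ _ bnd t) _.
  - by apply: mulr_ge0; [exact: ltW|rewrite divr_ge0 ?exprn_ge0 // mulr_ge0].
  - by rewrite fg subrr.
  rewrite ler_pM2r ?expR_gt0 // /c.
  have e2 : (2 : R) ^+ n != 0 by rewrite expf_neq0.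
  have L1 : L != 0 by rewrite gt_eqF.
  rewrite le_eqVlt; apply/orP; left; apply/eqP.
  by field; rewrite e2 L1.
have half n : K / 2 ^+ n = 2 * (K / 2 ^+ n.+1).
  by rewrite exprS; field; rewrite expf_neq0.
have D n t : `|U n.+1 t - U n t| <= K / 2 ^+ n * W t /\ `|V n.+1 t - V n t| <= K / 2 ^+ n * W t.
  elim: n t => [|n IH] t.
    have base (f df : R -> R) (z : R) : f t0 = z -> (forall t : R, is_derive t 1 f (df t)) ->
        (forall t, `|df t| <= M) -> `|f t - z| <= K / 2 ^+ 0 * W t.
      move=> fz dff bnd; rewrite expr0 divr1.
      apply: le_trans (exp_weight_norm (fun s => f s - z) df M c t0 c0 M0 _ _ _ t) _.
      - by rewrite fz subrr.
      - move=> s; rewrite -[df s]subr0; apply: is_derive_sub => //; exact: is_derive_const.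
      - move=> s; have := bnd s; have := W1 s; rewrite -/(W s); nra.
      rewrite ler_wpM2r ?expR_ge0 // /K ler_pM2r ?invr_gt0 //; lra.
    by split; [apply: base (proj1 (US 0%N)) (proj2 (US 0%N)) _|apply: base (proj1 (VS 0%N)) (proj2 (VS 0%N)) _].
  have H s : `|U n.+1 s - U n s| + `|V n.+1 s - V n s| <= 4 * K / 2 ^+ n.+1 * W s.
    have [h1 h2] := IH s; move: h1 h2; rewrite half; nra.
  split.
    apply: (contraction _ _ _ _ n.+1 _ (proj2 (US n.+1)) (proj2 (US n))); first by rewrite !U0.
    move=> s; apply: le_trans (l1 _ _ _ _ _) _.
    by rewrite -mulrA ler_pM2l // H.
  apply: (contraction _ _ _ _ n.+1 _ (proj2 (VS n.+1)) (proj2 (VS n))); first by rewrite !V0.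
  move=> s; apply: le_trans (l2 _ _ _ _ _) _.
  by rewrite -mulrA ler_pM2l // H.
have swap n t : K / 2 ^+ n * W t = K * W t / 2 ^+ n by rewrite mulrAC.
have /choice[u Hu] t : exists l, forall n, `|U n t - l| <= 2 * (K * W t) / 2 ^+ n.
  by apply: geometric_cvg => n; rewrite -swap; exact: (proj1 (D n t)).
have /choice[v Hv] t : exists l, forall n, `|V n t - l| <= 2 * (K * W t) / 2 ^+ n.
  by apply: geometric_cvg => n; rewrite -swap; exact: (proj2 (D n t)).
have lip (Z : nat -> R -> R) (G : nat -> R -> R) z :
    (forall n t, `|Z n t - z t| <= 2 * (K * W t) / 2 ^+ n) ->
    (forall n (t : R), is_derive t 1 (Z n.+1) (G n t)) -> (forall n t, `|G n t| <= M) ->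
    continuous z.
  move=> Zz dZ bG; apply: (@lipschitz_continuous1 _ _ M) => x y.
  rewrite -subr_le0; apply: (@le0_geometric _ _ (2 * (K * W x) + 2 * (K * W y))) => n.
  have zx := Zz n.+1 x; have zy := Zz n.+1 y.
  have ZL : `|Z n.+1 x - Z n.+1 y| <= M * `|x - y|.
    wlog xy : x y {zx zy} / x <= y.
      move=> H; have [/H//|/ltW/H] := leP x y; by rewrite distrC (distrC y).
    have [e _ ->] : exists2 e, x <= e <= y & Z n.+1 x - Z n.+1 y = G n e * (x - y).
      have [e xe eE] := mean_value (Z n.+1) (G n) x y xy (fun t _ => dZ n t).
      by exists e => //; rewrite -opprB eE; ring.
    by rewrite normrM ler_wpM2r.
  have := ler_distD (Z n.+1 x) (z x) (z y); have := ler_distD (Z n.+1 y) (Z n.+1 x) (z y).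
  have q (k : R) : 0 <= k -> 2 * k / 2 ^+ n.+1 <= 2 * k / 2 ^+ n.
    move=> k0; rewrite ler_wpM2l ?mulr_ge0 // lef_pV2 ?posrE ?exprn_gt0 //.
    by rewrite exprS ler_peMl ?exprn_ge0 // ler1n.
  have := q _ (mulr_ge0 K0 (le_trans ler01 (W1 x))).
  have := q _ (mulr_ge0 K0 (le_trans ler01 (W1 y))).
  rewrite (distrC (z x) (Z n.+1 x)) mulrDl; lra.
have cu : continuous u by exact: (lip U (fun n t => F1 t (U n t) (V n t)) u (fun n t => Hu t n) (fun n => proj2 (US n)) (fun n t => b1 _ _ _)).
have cv : continuous v by exact: (lip V (fun n t => F2 t (U n t) (V n t)) v (fun n t => Hv t n) (fun n => proj2 (VS n)) (fun n t => b2 _ _ _)).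
(* One more Picard step applied to the limit gives differentiable functions, which the contraction
   estimate identifies with [u] and [v]. *)
have [u1 [u1t du]] := primitive_exists _ t0 x0 (c1 u v cu cv).
have [v1 [v1t dv]] := primitive_exists _ t0 y0 (c2 u v cu cv).
have H n s : `|U n s - u s| + `|V n s - v s| <= 4 * K / 2 ^+ n * W s.
  have -> : 4 * K / 2 ^+ n * W s = 2 * (K * W s) / 2 ^+ n + 2 * (K * W s) / 2 ^+ n by ring.
  exact: lerD.
have lim (z z1 : R -> R) (Z : nat -> R -> R) :
   (forall t n, `|Z n t - z t| <= 2 * (K * W t) / 2 ^+ n) ->
   (forall n t, `|Z n.+1 t - z1 t| <= K / 2 ^+ n * W t) -> z1 = z.
  move=> hz hz1; apply/funext => t; apply/eqP; rewrite -subr_eq0 -normr_le0.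
  apply: (@le0_geometric _ _ (3 * (K * W t))) => n.
  have := ler_distD (Z n.+1 t) (z1 t) (z t); rewrite (distrC (z1 t) (Z n.+1 t)).
  have -> : 3 * (K * W t) / 2 ^+ n = 3 * (K / 2 ^+ n * W t) by ring.
  have := hz1 n t; have := hz t n.+1.
  have -> : 2 * (K * W t) / 2 ^+ n.+1 = K / 2 ^+ n * W t.
    by rewrite exprS; field; rewrite expf_neq0.
  have K2 : 0 <= K / 2 ^+ n * W t by apply: le_trans (proj1 (D n t)).
  lra.
have u1E : u1 = u.
  apply: (lim _ _ U) => [|n t]; first exact: Hu.
  apply: (contraction _ _ _ _ _ _ (proj2 (US n)) du) => [|s]; first by rewrite U0 u1t.
  by apply: le_trans (l1 _ _ _ _ _) _; rewrite -mulrA ler_pM2l // H.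
have v1E : v1 = v.
  apply: (lim _ _ V) => [|n t]; first exact: Hv.
  apply: (contraction _ _ _ _ _ _ (proj2 (VS n)) dv) => [|s]; first by rewrite V0 v1t.
  by apply: le_trans (l2 _ _ _ _ _) _; rewrite -mulrA ler_pM2l // H.
exists u1, v1; split => // t; have := du t; have := dv t.
by rewrite -u1E -v1E.
Qed.

(** * The system in log-polar coordinates *)

Lemma continuous_mul {T : topologicalType} {R : realType} (f g : T -> R) :
  continuous f -> continuous g -> continuous (fun t => f t * g t).
Proof. by move=> cf cg t; apply: cvgM; [exact: cf|exact: cg]. Qed.

Lemma continuous_add {T : topologicalType} {R : realType} (f g : T -> R) :
  continuous f -> continuous g -> continuous (fun t => f t + g t).
Proof. by move=> cf cg t; apply: cvgD; [exact: cf|exact: cg]. Qed.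

Lemma continuous_sub {T : topologicalType} {R : realType} (f g : T -> R) :
  continuous f -> continuous g -> continuous (fun t => f t - g t).
Proof. by move=> cf cg t; apply: cvgB; [exact: cf|exact: cg]. Qed.

Lemma continuous_opp {T : topologicalType} {R : realType} (f : T -> R) :
  continuous f -> continuous (fun t => - f t).
Proof. by move=> cf t; apply: cvgN; exact: cf. Qed.

Lemma continuous_compose {T U V : topologicalType} (f : U -> V) (g : T -> U) :
  continuous f -> continuous g -> continuous (fun t => f (g t)).
Proof. by move=> cf cg t; apply: continuous_comp; [exact: cg|exact: cf]. Qed.

Lemma derive_bound_lipschitz {R : realType} (f df : R -> R) (k x y : R) :
  (forall t : R, is_derive t 1 f (df t)) -> (forall t, `|df t| <= k) ->
  `|f x - f y| <= k * `|x - y|.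
Proof.
move=> dff bnd; wlog xy : x y / x <= y.
  by move=> H; have [/H//|/ltW/H] := leP x y; rewrite distrC (distrC y).
have [c _ fE] := mean_value f df x y xy (fun t _ => dff t).
by rewrite distrC fE normrM (distrC x) ler_wpM2r.
Qed.

Lemma cos_lipschitz {R : realType} (x y : R) : `|cos x - cos y| <= `|x - y|.
Proof.
rewrite -[leRHS]mul1r; apply: (derive_bound_lipschitz cos (fun t => - sin t)).
by move=> t; rewrite normrN sin_max.
Qed.

Lemma sin_lipschitz {R : realType} (x y : R) : `|sin x - sin y| <= `|x - y|.
Proof.
rewrite -[leRHS]mul1r; apply: (derive_bound_lipschitz sin cos).
exact: cos_max.
Qed.

(* The factor [f (r u) / r] at [r = e^s] through which [f] enters the equations in log-polar coordinates. *)
Definition radial {R : realType} (f : R -> R) (s u : R) : R := expR (- s) * f (expR s * u).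

Lemma radial_bound {R : realType} (f : R -> R) (K s u : R) : f 0 = 0 ->
  (forall x y, `|f x - f y| <= K * `|x - y|) -> `|radial f s u| <= K * `|u|.
Proof.
move=> f0 lf; have := lf (expR s * u) 0; rewrite f0 !subr0 normrM (ger0_norm (expR_ge0 _)) => h.
rewrite /radial normrM (ger0_norm (expR_ge0 _)) expRN mulrC ler_pdivrMr ?expR_gt0 //.
by apply: le_trans h _; rewrite mulrCA mulrC.
Qed.

(** The constant must not blow up as s tends to minus infinity. Multiplied by the larger radius r',
    the difference is at most 2 K (r' - r), and (r' - r) / r' = 1 - exp(s - s') is at most s' -
    s. *)
Lemma radial_lipschitz_s {R : realType} (f : R -> R) (K s s' u : R) : f 0 = 0 -> 0 <= K ->
  (forall x y, `|f x - f y| <= K * `|x - y|) -> `|u| <= 1 ->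
  `|radial f s u - radial f s' u| <= 2 * K * `|s - s'|.
Proof.
move=> f0 K0 lf u1; wlog ss : s s' / s <= s'.
  by move=> H; have [/H//|/ltW/H] := leP s s'; rewrite distrC (distrC s').
set r := expR s; set r' := expR s'.
have r0 : 0 < r by exact: expR_gt0.
have r'0 : 0 < r' by exact: expR_gt0.
have rr' : r <= r' by rewrite ler_expR.
have key : `|r' * (f (r * u) / r) - f (r' * u)| <= 2 * K * (r' - r).
  have -> : r' * (f (r * u) / r) - f (r' * u) =
      (r' - r) * (f (r * u) / r) + (f (r * u) - f (r' * u)).
    by rewrite mulrBl [r * (_ / r)]mulrC divfK ?gt_eqF //; ring.
  apply: le_trans (ler_normD _ _) _.
  have h1 : `|f (r * u) / r| <= K.
    have := radial_bound f K s u f0 lf; rewrite /radial expRN mulrC -/r => h.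
    by apply: le_trans h _; rewrite ler_piMr.
  have h2 : `|f (r * u) - f (r' * u)| <= K * (r' - r).
    apply: le_trans (lf _ _) _; rewrite -mulrBl normrM distrC (@ger0_norm _ (r' - r)) ?subr_ge0 //.
    by rewrite ler_wpM2l // ler_piMr // subr_ge0.
  rewrite normrM (@ger0_norm _ (r' - r)) ?subr_ge0 //.
  have : 0 <= r' - r by rewrite subr_ge0.
  nra.
have -> : radial f s u - radial f s' u = (r' * (f (r * u) / r) - f (r' * u)) / r'.
  by rewrite /radial !expRN -/r -/r'; field; rewrite !gt_eqF.
rewrite normrM normfV (gtr0_norm r'0) ler_pdivrMr //.
apply: le_trans key _; rewrite -[leRHS]mulrA ler_wpM2l ?mulr_ge0 //.
rewrite distrC ger0_norm ?subr_ge0 //.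
have : 1 - (s' - s) <= expR (- (s' - s)) by have := expR_ge1Dx (- (s' - s)).
rewrite opprB expRD expRN -/r -/r' ler_pdivlMr //; lra.
Qed.

Lemma radial_lipschitz_u {R : realType} (f : R -> R) (K s u u' : R) :
  (forall x y, `|f x - f y| <= K * `|x - y|) ->
  `|radial f s u - radial f s u'| <= K * `|u - u'|.
Proof.
move=> lf; rewrite /radial -mulrBr normrM (ger0_norm (expR_ge0 _)) expRN mulrC.
rewrite ler_pdivrMr ?expR_gt0 //; apply: le_trans (lf _ _) _.
by rewrite -mulrBr normrM (ger0_norm (expR_ge0 _)) mulrCA mulrC.
Qed.

(** This and [polar_th] are s' = (x x' + y y') / r^2 and th' = (x y' - y x') / r^2 with r = e^s. *)
Definition polar_s {R : realType} (g h b : R -> R) (t s th : R) : R :=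
  cos th * radial h s (sin th) - b t * (sin th * radial g s (cos th)).

Definition polar_th {R : realType} (g h b : R -> R) (t s th : R) : R :=
  - (sin th * radial h s (sin th)) - b t * (cos th * radial g s (cos th)).

Lemma trig_radial_lipschitz {R : realType} (f : R -> R) (K : R) (w z : R -> R) (s s' th th' : R) :
  f 0 = 0 -> 0 <= K -> (forall x y, `|f x - f y| <= K * `|x - y|) ->
  (forall x, `|w x| <= 1) -> (forall x, `|z x| <= 1) ->
  (forall x y, `|w x - w y| <= `|x - y|) -> (forall x y, `|z x - z y| <= `|x - y|) ->
  `|w th * radial f s (z th) - w th' * radial f s' (z th')| <= 2 * K * (`|s - s'| + `|th - th'|).
Proof.
move=> f0 K0 lf w1 z1 lw lz.
have -> : w th * radial f s (z th) - w th' * radial f s' (z th') =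
  w th * (radial f s (z th) - radial f s' (z th)) +
  (w th * (radial f s' (z th) - radial f s' (z th')) +
  (w th - w th') * radial f s' (z th')) by ring.
apply: le_trans (ler_normD _ _) _; rewrite [leRHS]mulrDr; apply: lerD.
  rewrite normrM; apply: le_trans (radial_lipschitz_s f K s s' (z th) f0 K0 lf (z1 _)).
  by rewrite ler_piMl.
apply: le_trans (ler_normD _ _) _; rewrite (normrM (w th)) (normrM (w th - w th')).
have -> : 2 * K * `|th - th'| = K * `|th - th'| + K * `|th - th'| by ring.
apply: lerD.
  apply: le_trans (ler_piMl _ (w1 _)) _ => //.
  by apply: le_trans (radial_lipschitz_u _ _ _ _ _ lf) _; rewrite ler_wpM2l.
rewrite [leRHS]mulrC; apply: ler_pM; [exact: normr_ge0|exact: normr_ge0|exact: lw|].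
by apply: le_trans (radial_bound f K s' (z th') f0 lf) _; rewrite ler_piMr.
Qed.

Lemma radial_continuous {R : realType} (f : R -> R) (u v : R -> R) :
  continuous f -> continuous u -> continuous v -> continuous (fun t => radial f (u t) (v t)).
Proof.
move=> cf cu cv; apply: continuous_mul.
  by apply: continuous_compose; [exact: continuous_expR|exact: continuous_opp].
apply: continuous_compose => //; apply: continuous_mul => //.
by apply: continuous_compose => //; exact: continuous_expR.
Qed.

Lemma polar_lipschitz {R : realType} (g h b : R -> R) (K beta : R) :
  g 0 = 0 -> h 0 = 0 -> 0 <= K ->
  (forall x y, `|g x - g y| <= K * `|x - y|) ->
  (forall x y, `|h x - h y| <= K * `|x - y|) ->
  continuous b -> (forall t, `|b t| <= beta) ->
  lipschitz_field (polar_s g h b) (2 * K * (1 + beta)) (K * (1 + beta)) /\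
  lipschitz_field (polar_th g h b) (2 * K * (1 + beta)) (K * (1 + beta)).
Proof.
move=> g0 h0 K0 lg lh cb bb.
have cg := lipschitz_continuous1 _ _ lg; have ch := lipschitz_continuous1 _ _ lh.
have csin (v : R -> R) : continuous v -> continuous (fun t => sin (v t)).
  by move=> cv; apply: continuous_compose => //; exact: continuous_sin.
have ccos (v : R -> R) : continuous v -> continuous (fun t => cos (v t)).
  by move=> cv; apply: continuous_compose => //; exact: continuous_cos.
have TR := trig_radial_lipschitz.
have c1 := @cos_max R; have s1 := @sin_max R.
have cl := @cos_lipschitz R; have sl := @sin_lipschitz R.
have B (f : R -> R) s u w : f 0 = 0 -> (forall x y, `|f x - f y| <= K * `|x - y|) ->
    `|u| <= 1 -> `|w| <= 1 -> `|w * radial f s u| <= K.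
  move=> f0 lf u1 w1; rewrite normrM; apply: le_trans (ler_piMl _ w1) _ => //.
  by apply: le_trans (radial_bound f K s u f0 lf) _; rewrite ler_piMr.
have comb (p q p' q' D t : R) : `|p - p'| <= 2 * K * D -> `|q - q'| <= 2 * K * D ->
    `|p - b t * q - (p' - b t * q')| <= 2 * K * (1 + beta) * D.
  move=> hp hq.
  have -> : p - b t * q - (p' - b t * q') = (p - p') - b t * (q - q') by ring.
  apply: le_trans (ler_normB _ _) _; rewrite normrM mulrDr mulr1 mulrDl.
  apply: lerD => //; rewrite mulrAC [leRHS]mulrC; exact: ler_pM.
have combb (p q t : R) : `|p| <= K -> `|q| <= K -> `|p - b t * q| <= K * (1 + beta).
  move=> hp hq; apply: le_trans (ler_normB _ _) _; rewrite normrM mulrDr mulr1.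
  by apply: lerD => //; rewrite mulrC; apply: ler_pM.
split; split.
- move=> u v cu cv; apply: continuous_sub.
    by apply: continuous_mul; [exact: ccos|apply: radial_continuous => //; exact: csin].
  apply: continuous_mul => //.
  by apply: continuous_mul; [exact: csin|apply: radial_continuous => //; exact: ccos].
- move=> t x y x' y'; apply: comb; [exact: TR|exact: TR].
- by move=> t x y; apply: combb; apply: B.
- move=> u v cu cv; apply: continuous_sub.
    by apply: continuous_opp; apply: continuous_mul; [exact: csin|apply: radial_continuous => //; exact: csin].
  apply: continuous_mul => //.
  by apply: continuous_mul; [exact: ccos|apply: radial_continuous => //; exact: ccos].
- move=> t x y x' y'; apply: comb; last exact: TR.
  by rewrite -opprD normrN; apply: TR.
- by move=> t x y; apply: combb; rewrite ?normrN; apply: B.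
Qed.

Lemma polar_to_cartesian {R : realType} (g h b : R -> R) (s th : R -> R) :
  solves (polar_s g h b) (polar_th g h b) s th -> forall t : R,
  is_derive t 1 (fun t => expR (s t) * cos (th t)) (h (expR (s t) * sin (th t))) /\
  is_derive t 1 (fun t => expR (s t) * sin (th t)) (- (b t * g (expR (s t) * cos (th t)))).
Proof.
move=> S t; have [ds dth] := S t.
have de := is_derive_compose _ _ _ _ _ (is_derive_expR (s t)) ds.
have dc := is_derive_compose _ _ _ _ _ (is_derive_cos (th t)) dth.
have dn := is_derive_compose _ _ _ _ _ (is_derive_sin (th t)) dth.
have e1 : expR (s t) * expR (- s t) = 1 by rewrite expRxMexpNx_1.
have cs := cos2Dsin2 (th t).
split.
  apply: is_derive_eq (is_derive_mul _ _ _ _ _ de dc) _.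
  rewrite /polar_s /polar_th /radial.
  transitivity ((expR (s t) * expR (- s t)) * (cos (th t) ^+ 2 + sin (th t) ^+ 2) *
     h (expR (s t) * sin (th t))); first by ring.
  by rewrite e1 cs !mul1r.
apply: is_derive_eq (is_derive_mul _ _ _ _ _ de dn) _.
rewrite /polar_s /polar_th /radial.
transitivity (- ((expR (s t) * expR (- s t)) * (cos (th t) ^+ 2 + sin (th t) ^+ 2) * (b t *
   g (expR (s t) * cos (th t))))); first by ring.
by rewrite e1 cs !mul1r.
Qed.

(** * The twist on [0, T1] *)

Definition same_sign {R : realType} (f : R -> R) : Prop :=
  f 0 = 0 /\ forall x, x != 0 -> 0 < f x * x.

Lemma same_sign_gt0 {R : realType} (f : R -> R) (x : R) : same_sign f -> 0 < x -> 0 < f x.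
Proof. by move=> [_ sf] x0; have := sf x; rewrite pmulr_lgt0 // gt_eqF //; apply. Qed.

Lemma same_sign_lt0 {R : realType} (f : R -> R) (x : R) : same_sign f -> x < 0 -> f x < 0.
Proof. by move=> [_ sf] x0; have := sf x; rewrite nmulr_lgt0 // lt_eqF //; apply. Qed.

Lemma same_sign_ge0 {R : realType} (f : R -> R) (x : R) : same_sign f -> 0 <= x -> 0 <= f x.
Proof.
move=> sf; rewrite le_eqVlt => /orP[/eqP <-|x0]; first by rewrite (proj1 sf).
exact/ltW/same_sign_gt0.
Qed.

Lemma same_sign_le0 {R : realType} (f : R -> R) (x : R) : same_sign f -> x <= 0 -> f x <= 0.
Proof.
move=> sf; rewrite le_eqVlt => /orP[/eqP ->|x0]; first by rewrite (proj1 sf).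
exact/ltW/same_sign_lt0.
Qed.

Lemma same_sign_mul_ge0 {R : realType} (f : R -> R) (x : R) : same_sign f -> 0 <= f x * x.
Proof.
move=> sf; have [->|/(proj2 sf)/ltW//] := eqVneq x 0; by rewrite mulr0.
Qed.

Lemma same_sign_ub {R : realType} (f : R -> R) (X G x : R) : same_sign f -> 0 <= G ->
  (forall v, `|v| <= X -> `|f v| <= G) -> x <= X -> f x <= G.
Proof.
move=> sf G0 bf xX; have [x0|x0] := leP x 0; first exact: le_trans (same_sign_le0 _ _ sf x0) G0.
by apply: le_trans (ler_norm _) _; apply: bf; rewrite gtr0_norm.
Qed.

Lemma same_sign_lb {R : realType} (f : R -> R) (X G x : R) : same_sign f -> 0 <= G ->
  (forall v, `|v| <= X -> `|f v| <= G) -> - X <= x -> - G <= f x.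
Proof.
move=> sf G0 bf xX; have [x0|x0] := leP 0 x.
  by apply: le_trans (same_sign_ge0 _ _ sf x0); rewrite oppr_le0.
rewrite lerNl; apply: le_trans (ler_norm _) _; rewrite normrN; apply: bf.
by rewrite ltr0_norm // lerNl.
Qed.

(** [M] is the one-sided speed bound, [Gam X] the bound on a speed driven by a coordinate in
    [-X, X]. Each stage adds speed times time to the initial bound [rho], and the sum dominates all
    four stages. *)
Definition apriori_bound {R : realType} (M tau rho : R) (Gam : R -> R) : R :=
  let X1 := rho + M * tau in let Y1 := rho + Gam X1 * tau in
  let X2 := rho + Gam Y1 * tau in let Y2 := rho + Gam X2 * tau in X1 + Y1 + X2 + Y2.

(* The sign conditions make all four estimates one-sided, so they chain without counting rotations: [x] from below, then [y] from above, [x] from above, [y] from below. *)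
Lemma apriori_chain {R : realType} (x y dx dy Gam : R -> R) (M tau hor rho : R) :
  0 <= tau <= hor -> 0 <= M -> (forall X, 0 <= Gam X) ->
  (forall t : R, 0 <= t <= tau -> is_derive t 1 x (dx t)) ->
  (forall t : R, 0 <= t <= tau -> is_derive t 1 y (dy t)) ->
  `|x 0| <= rho -> `|y 0| <= rho ->
  (forall t, 0 <= t <= tau -> - M <= dx t) ->
  (forall t X, 0 <= t <= tau -> 0 <= X -> - X <= x t -> dy t <= Gam X) ->
  (forall t Y, 0 <= t <= tau -> 0 <= Y -> y t <= Y -> dx t <= Gam Y) ->
  (forall t X, 0 <= t <= tau -> 0 <= X -> x t <= X -> - Gam X <= dy t) ->
  forall t, 0 <= t <= tau ->
  `|x t| <= apriori_bound M hor rho Gam /\ `|y t| <= apriori_bound M hor rho Gam.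
Proof.
move=> /andP[tau0 tauh] M0 G0 dxx dyy x0 y0 h1 h2 h3 h4.
have rho0 : 0 <= rho by apply: le_trans x0.
have /ler_normlP[x0l x0u] := x0.
have /ler_normlP[y0l y0u] := y0.
pose X1 := rho + M * hor; pose Y1 := rho + Gam X1 * hor.
pose X2 := rho + Gam Y1 * hor; pose Y2 := rho + Gam X2 * hor.
have hor0 := le_trans tau0 tauh.
have pos k : 0 <= k -> 0 <= rho + k * hor by move=> k0; rewrite addr_ge0 ?mulr_ge0.
have X10 : 0 <= X1 by exact: pos. have Y10 : 0 <= Y1 by exact: pos.
have X20 : 0 <= X2 by exact: pos. have Y20 : 0 <= Y2 by exact: pos.
have up (f df : R -> R) k : (forall t : R, 0 <= t <= tau -> is_derive t 1 f (df t)) ->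
    0 <= k -> f 0 <= rho -> (forall t, 0 <= t <= tau -> df t <= k) ->
    forall t, 0 <= t <= tau -> f t <= rho + k * hor.
  move=> dff k0 f0 bnd t /andP[t0 tt].
  have := derive_le_growth f df k 0 t t0; rewrite subr0 => H.
  have : f t <= f 0 + k * t.
    by apply: H => s /andP[s0 st]; [apply: dff|apply: bnd]; rewrite s0 (le_trans st).
  by move=> {}H; have := ler_wpM2l k0 (le_trans tt tauh); lra.
have lo (f df : R -> R) k : (forall t : R, 0 <= t <= tau -> is_derive t 1 f (df t)) ->
    0 <= k -> - rho <= f 0 -> (forall t, 0 <= t <= tau -> - k <= df t) ->
    forall t, 0 <= t <= tau -> - (rho + k * hor) <= f t.
  move=> dff k0 f0 bnd t ht; rewrite lerNl.
  apply: (up (fun s => - f s) (fun s => - df s) k) => //.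
  - by move=> s hs; exact: is_derive_opp (dff s hs).
  - by rewrite lerNl.
  - by move=> s hs; rewrite lerNl; exact: bnd.
have b1 := lo x dx M dxx M0 ltac:(lra) h1.
have b2 := up y dy (Gam X1) dyy (G0 _) ltac:(lra) (fun t ht => h2 t X1 ht X10 (b1 t ht)).
have b3 := up x dx (Gam Y1) dxx (G0 _) ltac:(lra) (fun t ht => h3 t Y1 ht Y10 (b2 t ht)).
have b4 := lo y dy (Gam X2) dyy (G0 _) ltac:(lra) (fun t ht => h4 t X2 ht X20 (b3 t ht)).
move=> t ht; move: (b1 t ht) (b2 t ht) (b3 t ht) (b4 t ht).
rewrite /apriori_bound -/X1 -/Y1 -/X2 -/Y2 => c1 c2 c3 c4.
by split; apply/ler_normlP; split; rewrite -/X1 -/Y1 -/X2 -/Y2 in c1 c2 c3 c4 *;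
  clear -c1 c2 c3 c4 X10 Y10 X20 Y20; lra.
Qed.

Definition bounded_somewhere {R : realType} (g h : R -> R) (M : R) : Prop :=
  (forall s, s <= 0 -> `|h s| <= M) \/ (forall s, 0 <= s -> `|h s| <= M) \/
  (forall s, s <= 0 -> `|g s| <= M) \/ (forall s, 0 <= s -> `|g s| <= M).

Lemma half_bounded_lb {R : realType} (f : R -> R) (M s : R) : same_sign f -> 0 <= M ->
  (forall s, s <= 0 -> `|f s| <= M) -> - M <= f s.
Proof.
move=> sf M0 bf; have [s0|s0] := leP s 0; first by have /ler_normlP[] := bf s s0; lra.
by have := same_sign_gt0 f s sf s0; lra.
Qed.

Lemma half_bounded_ub {R : realType} (f : R -> R) (M s : R) : same_sign f -> 0 <= M ->
  (forall s, 0 <= s -> `|f s| <= M) -> f s <= M.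
Proof.
move=> sf M0 bf; have [s0|s0] := leP 0 s; first by have /ler_normlP[] := bf s s0; lra.
by have := same_sign_lt0 f s sf s0; lra.
Qed.

(** The four cases are quarter turns of one: [apriori_chain] is applied to (x, y), (-x, -y), (-y, x)
    or (y, -x), so that the first coordinate is the one whose derivative is bounded below. Stated
    with a horizon [hor], the bound does not depend on [tau]. *)
Lemma forward_bound {R : realType} (x y b g h Gam : R -> R) (M beta tau hor rho : R) :
  0 <= tau <= hor -> 0 <= M -> 0 <= beta -> (forall X, 0 <= Gam X) ->
  same_sign g -> same_sign h -> bounded_somewhere g h M ->
  (forall X v, `|v| <= X -> `|g v| <= Gam X) -> (forall X v, `|v| <= X -> `|h v| <= Gam X) ->
  (forall t, 0 <= t <= tau -> 0 <= b t <= beta) ->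
  (forall t : R, 0 <= t <= tau -> is_derive t 1 x (h (y t))) ->
  (forall t : R, 0 <= t <= tau -> is_derive t 1 y (- (b t * g (x t)))) ->
  `|x 0| <= rho -> `|y 0| <= rho ->
  let B := apriori_bound ((1 + beta) * M) hor rho (fun X => (1 + beta) * Gam X) in
  forall t, 0 <= t <= tau -> `|x t| <= B /\ `|y t| <= B.
Proof.
move=> tau0 M0 beta0 G0 sg sh four bg bh bb dx dy x0 y0 B.
have MM : 0 <= (1 + beta) * M by rewrite mulr_ge0 ?addr_ge0.
have GG X : 0 <= (1 + beta) * Gam X by rewrite mulr_ge0 ?addr_ge0.
have M1 : M <= (1 + beta) * M by rewrite ler_peMl // lerDl.
have G1 X : Gam X <= (1 + beta) * Gam X by rewrite ler_peMl // lerDl.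
have gu X v : v <= X -> g v <= Gam X by apply: same_sign_ub => //; exact: bg.
have gl X v : - X <= v -> - Gam X <= g v by apply: same_sign_lb => //; exact: bg.
have hu X v : v <= X -> h v <= Gam X by apply: same_sign_ub => //; exact: bh.
have hl X v : - X <= v -> - Gam X <= h v by apply: same_sign_lb => //; exact: bh.
have wu t (v k : R) : 0 <= t <= tau -> 0 <= k -> v <= k -> b t * v <= (1 + beta) * k.
  by move=> /bb/andP[b0 b1] k0 vk; have := ler_wpM2l b0 vk; have := ler_wpM2r k0 b1; lra.
have wl t (v k : R) : 0 <= t <= tau -> 0 <= k -> - k <= v -> - ((1 + beta) * k) <= b t * v.
  by move=> ht k0 vk; have := wu t (- v) k ht k0; rewrite mulrN; lra.
have dNx t : 0 <= t <= tau -> is_derive t 1 (fun t => - x t) (- h (y t)).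
  by move=> ht; apply: is_derive_opp; exact: dx.
have dNy t : 0 <= t <= tau -> is_derive t 1 (fun t => - y t) (b t * g (x t)).
  by move=> ht; rewrite -[b t * _]opprK; apply: is_derive_opp; exact: dy.
case: four => [hm|[hp|[gm|gp]]].
- apply: (apriori_chain _ _ _ _ _ _ _ _ _ tau0 MM GG dx dy x0 y0).
  + by move=> t ht; have := half_bounded_lb h M (y t) sh M0 hm; lra.
  + by move=> t X ht X0 hX; rewrite lerNl; apply: wl => //; exact: gl.
  + by move=> t Y ht Y0 hY; apply: le_trans (hu _ _ hY) _.
  + by move=> t X ht X0 hX; rewrite lerN2; apply: wu => //; exact: gu.
- have H := apriori_chain _ _ _ _ _ _ _ _ _ tau0 MM GG dNx dNy.
  move=> t ht; rewrite -(normrN (x t)) -(normrN (y t)); apply: H ht; rewrite ?normrN //.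
  + by move=> {}t ht; have := half_bounded_ub h M (y t) sh M0 hp; lra.
  + by move=> {}t X ht X0; rewrite lerN2 => hX; apply: wu => //; exact: gu.
  + move=> {}t Y ht Y0; rewrite lerNl => hY; rewrite lerNl.
    by apply: le_trans (hl _ _ hY); rewrite lerN2.
  + by move=> {}t X ht X0; rewrite lerNl => hX; apply: wl => //; exact: gl.
- have H := apriori_chain _ _ _ _ _ _ _ _ _ tau0 MM GG dNy dx.
  move=> t ht; rewrite -(normrN (y t)) and_comm; apply: H ht; rewrite ?normrN //.
  + by move=> {}t ht; apply: wl => //; exact: half_bounded_lb.
  + by move=> {}t X ht X0; rewrite lerN2 => hX; apply: le_trans (hu _ _ hX) _.
  + by move=> {}t Y ht Y0 hY; apply: wu => //; exact: gu.
  + move=> {}t X ht X0; rewrite lerNl => hX.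
    by apply: le_trans (hl _ _ hX); rewrite lerN2.
- have H := apriori_chain _ _ _ _ _ _ _ _ _ tau0 MM GG dy dNx.
  move=> t ht; rewrite -(normrN (x t)) and_comm; apply: H ht; rewrite ?normrN //.
  + by move=> {}t ht; rewrite lerN2; apply: wu => //; exact: half_bounded_ub.
  + by move=> {}t X ht X0 hX; rewrite lerNl; apply: le_trans (hl _ _ hX); rewrite lerN2.
  + by move=> {}t Y ht Y0; rewrite lerNl => hY; rewrite lerNl; apply: wl => //; exact: gl.
  + by move=> {}t X ht X0 hX; rewrite lerN2; apply: le_trans (hu _ _ hX) _.
Qed.

Lemma is_derive_reverse {R : realType} (f : R -> R) (T t a : R) :
  is_derive (T - t) 1 f a -> is_derive t 1 (fun s => f (T - s)) (- a).
Proof.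
move=> df; rewrite -[- a]mulr1 mulNr -mulrN.
apply: (is_derive_compose f (fun s => T - s)) => //.
by apply: is_derive_eq (is_derive_sub _ _ _ _ _ (is_derive_const T t) (is_derive_id t 1)) _; rewrite sub0r.
Qed.

(** Meant to be used contrapositively: a solution that starts far from the origin cannot come close
    to it within the horizon. *)
Lemma backward_bound {R : realType} (x y b g h Gam : R -> R) (M beta tau hor rho : R) :
  0 <= tau <= hor -> 0 <= M -> 0 <= beta -> (forall X, 0 <= Gam X) ->
  same_sign g -> same_sign h -> bounded_somewhere g h M ->
  (forall X v, `|v| <= X -> `|g v| <= Gam X) -> (forall X v, `|v| <= X -> `|h v| <= Gam X) ->
  (forall t, 0 <= t <= tau -> 0 <= b t <= beta) ->
  (forall t : R, 0 <= t <= tau -> is_derive t 1 x (h (y t))) ->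
  (forall t : R, 0 <= t <= tau -> is_derive t 1 y (- (b t * g (x t)))) ->
  `|x tau| <= rho -> `|y tau| <= rho ->
  let B := apriori_bound ((1 + beta) * M) hor rho (fun X => (1 + beta) * Gam X) in
  `|x 0| <= B /\ `|y 0| <= B.
Proof.
move=> tau0 M0 beta0 G0 sg sh four bg bh bb dx dy xt yt B.
have rev t : 0 <= t <= tau -> 0 <= tau - t <= tau by lra.
(* Reversing time and reflecting x turns the system into the one with -g(-x) in place of g. *)
have [|||||||||] := @forward_bound R (fun t => - x (tau - t)) (fun t => y (tau - t))
   (fun t => b (tau - t)) (fun v => - g (- v)) h Gam M beta tau hor rho tau0 M0 beta0 G0 _ sh _ _ bh
   _ _ _ _ _ tau.
- split; first by rewrite oppr0 (proj1 sg) oppr0.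
  by move=> v v0; rewrite mulNr -mulrN; apply: (proj2 sg); rewrite oppr_eq0.
- case: four => [H|[H|[H|H]]]; [by left|by right; left| |].
    by right; right; right => s s0; rewrite normrN; apply: H; rewrite oppr_le0.
  by right; right; left => s s0; rewrite normrN; apply: H; rewrite oppr_ge0.
- by move=> X v hv; rewrite normrN; apply: bg; rewrite normrN.
- by move=> t ht; apply: bb; exact: rev.
- move=> t ht; rewrite -[h _]opprK; apply: is_derive_opp; apply: is_derive_reverse.
  by apply: dx; exact: rev.
- move=> t ht; rewrite opprK mulrN opprK -[b _ * _]opprK.
  by apply: is_derive_reverse; apply: dy; exact: rev.
- by rewrite subr0 normrN.
- by rewrite subr0.
- by move: tau0 => /andP[-> _]; rewrite lexx.
- by rewrite subrr normrN.
Qed.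

(** [z] is the projection on the direction [al]. A half turn at distance at least W takes it from at
    least W to at most -W, a larger fall than the bound on its derivative permits in time [tau]. *)
Lemma rotation_lt_half_turn {R : realType} (s th z dz : R -> R) (al M W tau : R) :
  0 <= tau -> continuous th -> al <= th 0 ->
  (forall t, z t = expR (s t) * cos (th t - al)) ->
  (forall t : R, 0 <= t <= tau -> is_derive t 1 z (dz t)) ->
  (forall t, 0 <= t <= tau -> - M <= dz t) -> 0 <= M ->
  (forall t, 0 <= t <= tau -> W <= expR (s t)) -> M * tau < 2 * W ->
  al - pi < th tau.
Proof.
move=> tau0 cth th0 zE dzz zM M0 sW MW; rewrite ltNge; apply/negP => thtau.
have p0 := @pi_gt0 R.
have [t1 /andP[t10 t1t] et1] : exists2 c, 0 <= c <= tau & th c = al.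
  by apply: ivt => //; right; apply/andP; split; lra.
have [t2 /andP[t12 t2t] et2] : exists2 c, t1 <= c <= tau & th c = al - pi.
  by apply: ivt => //; right; rewrite et1; apply/andP; split; lra.
have := @derive_ge_growth R z dz (- M) t1 t2 t12.
rewrite !zE et1 et2 subrr cos0 addrAC subrr sub0r cosN cospi mulr1 mulrN1 => H.
have {}H : expR (s t1) + - M * (t2 - t1) <= - expR (s t2).
  by apply: H => t /andP[h1 h2]; [apply: dzz|apply: zM]; lra.
have := sW t1; have := sW t2; rewrite t10 t1t t2t (le_trans t10 t12) => /(_ isT) a1 /(_ isT) a2.
have : M * (t2 - t1) <= M * tau by rewrite ler_wpM2l //; lra.
lra.
Qed.

Lemma last_nonneg {R : realType} (f : R -> R) (t0 t1 : R) : t0 <= t1 -> continuous f ->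
  0 <= f t0 -> f t1 < 0 ->
  exists2 r, t0 <= r <= t1 & f r = 0 /\ forall t, r < t <= t1 -> f t < 0.
Proof.
move=> t01 cf f0 f1.
pose A := [set t | t0 <= t <= t1 /\ 0 <= f t].
have hs : has_sup A.
  split; first by exists t0; split => //; rewrite lexx.
  by exists t1 => t [/andP[]].
pose r := sup A.
have rA t : A t -> t <= r by move=> At; exact: sup_upper_bound.
have r0 : t0 <= r by apply: rA; split => //; rewrite lexx.
have r1 : r <= t1 by apply: ge_sup; [case: hs|move=> t [/andP[]]].
have after t : r < t <= t1 -> f t < 0.
  move=> /andP[rt tt]; rewrite ltNge; apply/negP => ft.
  suff : t <= r by rewrite leNgt rt.
  by apply: rA; split => //; rewrite tt (le_trans r0 (ltW rt)).
have fr0 : 0 <= f r.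
  rewrite leNgt; apply/negP => fr.
  have : \forall t \near r, f t < 0 :=
    cf r [set y | y < 0] (open_nbhs_nbhs (conj (@open_lt R 0) fr)).
  move=> /nbhs_ballP[e /= e0 eB].
  have [a Aa ra] := sup_adherent e0 hs.
  have : f a < 0.
    apply: eB; rewrite /ball /= ger0_norm ?subr_ge0; last exact: rA.
    by rewrite ltrBlDl -ltrBlDr.
  by rewrite ltNge (proj2 Aa).
exists r; first by rewrite r0.
split=> //; apply/eqP; rewrite eq_le fr0 andbT leNgt; apply/negP => fr.
have [c /andP[rc ct] fc] : exists2 c, r <= c <= t1 & f c = 0.
  by apply: ivt => //; right; rewrite !ltW.
have cr : c = r.
  by apply/eqP; rewrite eq_le rc rA // /A /= fc lexx ct (le_trans r0 rc).
by move: fr; rewrite -cr fc ltxx.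
Qed.

(** If f became negative, then after its last zero the hypothesis would read df >= L f, so that f
    e^(-L t) could not decrease from 0. *)
Lemma nonneg_preserved {R : realType} (f df : R -> R) (L t0 t1 : R) : t0 <= t1 ->
  continuous f -> (forall t : R, t0 <= t <= t1 -> is_derive t 1 f (df t)) ->
  (forall t, t0 <= t <= t1 -> - (L * `|f t|) <= df t) -> 0 <= f t0 -> 0 <= f t1.
Proof.
move=> t01 cf dff bnd f0; rewrite leNgt; apply/negP => f1.
have [r /andP[r0 r1] [fr neg]] := last_nonneg f t0 t1 t01 cf f0 f1.
have : f r * expR (- L * r) <= f t1 * expR (- L * t1).
  apply: (derive_ge0_le (fun s => f s * expR (- L * s))
    (fun s => df s * expR (- L * s) + f s * (- L * expR (- L * s)))) => // s /andP[rs st].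
    by apply: is_derive_mul; [apply: dff; lra|exact: is_derive_expl].
  have fs : f s <= 0.
    move: rs; rewrite le_eqVlt => /orP[/eqP <-|rs]; first by rewrite fr.
    by apply/ltW/neg; rewrite rs.
  have := bnd s; rewrite (le_trans r0 rs) st ler0_norm // => /(_ isT).
  have := expR_gt0 (- L * s); nra.
by rewrite fr mul0r leNgt nmulr_rlt0 // expR_gt0.
Qed.

Definition cart_x {R : realType} (s th : R -> R) (t : R) : R := expR (s t) * cos (th t).
Definition cart_y {R : realType} (s th : R -> R) (t : R) : R := expR (s t) * sin (th t).

Lemma cart_norm {R : realType} (s th : R -> R) (t : R) :
  `|cart_x s th t| <= expR (s t) /\ `|cart_y s th t| <= expR (s t).
Proof.
rewrite !normrM (ger0_norm (expR_ge0 _)).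
by split; apply: ler_piMr; rewrite ?expR_ge0 ?cos_max ?sin_max.
Qed.

Lemma polar_th_cart {R : realType} (g h b : R -> R) (t s th : R) :
  polar_th g h b t s th = - (expR (- s) ^+ 2 * (h (expR s * sin th) * (expR s * sin th) +
     b t * (g (expR s * cos th) * (expR s * cos th)))).
Proof.
have e1 : expR (- s) * expR s = 1 by rewrite mulrC expRxMexpNx_1.
rewrite /polar_th /radial.
transitivity (- ((expR (- s) * expR s) * expR (- s) * (h (expR s * sin th) * sin th +
     b t * (g (expR s * cos th) * cos th)))); last by ring.
by rewrite e1; ring.
Qed.

Lemma polar_th_le0 {R : realType} (g h b : R -> R) (t s th : R) :
  same_sign g -> same_sign h -> 0 <= b t -> polar_th g h b t s th <= 0.
Proof.
move=> sg sh b0; rewrite polar_th_cart oppr_le0; apply: mulr_ge0; first exact: sqr_ge0.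
apply: addr_ge0; first exact: same_sign_mul_ge0.
by apply: mulr_ge0 => //; exact: same_sign_mul_ge0.
Qed.

(* A half-plane in which one of the nonlinearities is bounded cannot be crossed in time [tau] at distance at least [W] from the origin. *)
Lemma outer_rotation {R : realType} (g h b s th : R -> R) (M beta tau W : R) :
  0 <= tau -> 0 <= M -> 0 <= beta -> same_sign g -> same_sign h -> bounded_somewhere g h M ->
  (forall t, 0 <= t <= tau -> 0 <= b t <= beta) ->
  solves (polar_s g h b) (polar_th g h b) s th -> 0 <= th 0 ->
  (forall t, 0 <= t <= tau -> W <= expR (s t)) -> (1 + beta) * M * tau < 2 * W ->
  - (5 * pi / 2) < th tau.
Proof.
move=> tau0 M0 beta0 sg sh four bb S th0 sW MW.
have [_ cth] := solves_continuous _ _ _ _ S.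
have pi0 := @pi_gt0 R.
have MM : 0 <= (1 + beta) * M by rewrite mulr_ge0 ?addr_ge0.
have M1 : M <= (1 + beta) * M by rewrite ler_peMl // lerDl.
have RT z dz al := rotation_lt_half_turn s th z dz al ((1 + beta) * M) W tau tau0 cth.
have dx t := proj1 (polar_to_cartesian _ _ _ _ _ S t).
have dy t := proj2 (polar_to_cartesian _ _ _ _ _ S t).
have wu t (v : R) : 0 <= t <= tau -> v <= M -> b t * v <= (1 + beta) * M.
  by move=> /bb/andP[b0 b1] vk; have := ler_wpM2l b0 vk; have := ler_wpM2r M0 b1; lra.
have wl t (v : R) : 0 <= t <= tau -> - M <= v -> - ((1 + beta) * M) <= b t * v.
  by move=> ht vk; have := wu t (- v) ht; rewrite mulrN; lra.
case: four => [hm|[hp|[gm|gp]]].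
- have := RT (cart_x s th) (fun t => h (cart_y s th t)) 0 th0.
  rewrite sub0r => H; have {H}: - pi < th tau; last by lra.
  apply: H => //; first by move=> t; rewrite subr0.
  by move=> t ht; have := half_bounded_lb h M (cart_y s th t) sh M0 hm; lra.
- have := RT (fun t => - cart_x s th t) (fun t => - h (cart_y s th t)) (- pi).
  move=> H; have {H}: - pi - pi < th tau; last by lra.
  apply: H => //; first by lra.
  + by move=> t; rewrite opprK cosDpi mulrN.
  by move=> t ht; have := half_bounded_ub h M (cart_y s th t) sh M0 hp; lra.
- have := RT (fun t => - cart_y s th t) (fun t => b t * g (cart_x s th t)) (- (pi / 2)).
  move=> H; have {H}: - (pi / 2) - pi < th tau; last by lra.
  apply: H => //; first by lra.
  + by move=> t; rewrite opprK cosDpihalf mulrN.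
  + by move=> t ht; rewrite -[b t * _]opprK; apply: is_derive_opp; exact: dy.
  by move=> t ht; apply: wl => //; exact: half_bounded_lb.
(* Here y is the useful projection, and its direction pi / 2 first occurs at or below the angle 0 as
   -3 pi / 2. The half turn then ends at -5 pi / 2, the worst of the four cases and the origin of
   the constant. *)
- have := RT (cart_y s th) (fun t => - (b t * g (cart_x s th t))) (- (pi / 2 + pi)).
  move=> H; have {H}: - (pi / 2 + pi) - pi < th tau; last by lra.
  apply: H => //; first by lra.
  + by move=> t; rewrite opprK addrA cosDpi cosDpihalf opprK.
  by move=> t ht; rewrite lerN2; apply: wu => //; exact: half_bounded_ub.
Qed.

(** The bound [C] on s' keeps the radius below [dl]. There the linear lower bounds together with r^2
    = x^2 + y^2 give angular speed at least [om] on [al, be]; at other times the angle still does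
    not increase. *)
Lemma inner_rotation {R : realType} (g h b s th : R -> R) (C om dl al be tau : R) :
  0 <= al -> al <= be -> be <= tau -> 0 <= C -> same_sign g -> same_sign h ->
  (forall t, 0 <= t <= tau -> 0 <= b t) ->
  solves (polar_s g h b) (polar_th g h b) s th ->
  (forall t, 0 <= t <= tau -> polar_s g h b t (s t) (th t) <= C) -> expR (s 0 + C * tau) <= dl ->
  (forall v, `|v| <= dl -> om * v ^+ 2 <= h v * v) ->
  (forall t v, al <= t <= be -> `|v| <= dl -> om * v ^+ 2 <= b t * (g v * v)) ->
  th tau <= th 0 - om * (be - al).
Proof.
move=> al0 ab bt C0 sg sh b0 S sC small hom gom.
have dth (t : R) : is_derive t 1 th (polar_th g h b t (s t) (th t)) := proj2 (S t).
have sb t : 0 <= t <= tau -> expR (s t) <= dl.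
  move=> /andP[t0 tt]; apply: le_trans small; rewrite ler_expR.
  have : s t <= s 0 + C * (t - 0).
    by apply: (derive_le_growth _ _ _ _ _ t0 (fun t _ => proj1 (S t))) => r hr; apply: sC; lra.
  by have := ler_wpM2l C0 tt; lra.
have dec u v : 0 <= u -> u <= v -> v <= tau -> th v <= th u.
  move=> u0 uv vt; apply: (derive_le0_ge _ _ _ _ uv (fun t _ => dth t)) => t /andP[ut tv].
  by apply: polar_th_le0 => //; apply: b0; lra.
have h1 := dec 0 al (lexx _) al0 (le_trans ab bt).
have h3 := dec be tau (le_trans al0 ab) bt (lexx _).
have h2 : th be <= th al + - om * (be - al).
  apply: (derive_le_growth _ _ _ _ _ ab (fun t _ => dth t)) => t /andP[at_ tb].
  have t0 : 0 <= t <= tau by lra.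
  rewrite polar_th_cart lerN2.
  have [nx ny] := cart_norm s th t.
  have hy := hom (cart_y s th t) (le_trans ny (sb t t0)).
  have gx := gom t (cart_x s th t) ltac:(lra) (le_trans nx (sb t t0)).
  have -> : om = expR (- s t) ^+ 2 * (om * cart_y s th t ^+ 2 + om * cart_x s th t ^+ 2).
    have e1 : expR (- s t) * expR (s t) = 1 by rewrite mulrC expRxMexpNx_1.
    transitivity (om * (expR (- s t) * expR (s t)) ^+ 2 * (cos (th t) ^+ 2 + sin (th t) ^+ 2)).
      by rewrite e1 cos2Dsin2 expr1n !mulr1.
    by rewrite /cart_x /cart_y; ring.
  by rewrite ler_wpM2l ?sqr_ge0 // lerD.
lra.
Qed.

(** * The saddle on [T1, T] *)

Section SaddlePhase.
Variables (R : realType) (g h b s th : R -> R) (K beta t1 t2 : R).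
Hypotheses (sg : same_sign g) (sh : same_sign h) (K0 : 0 <= K) (t12 : t1 <= t2).
Hypotheses (lg : forall x y : R, `|g x - g y| <= K * `|x - y|)
  (lh : forall x y : R, `|h x - h y| <= K * `|x - y|).
Hypothesis bneg : forall t : R, t1 <= t <= t2 -> - beta <= b t <= 0.
Hypothesis S : solves (polar_s g h b) (polar_th g h b) s th.

Let x := cart_x s th.
Let y := cart_y s th.

Let dx (t : R) : is_derive t 1 x (h (y t)) := proj1 (polar_to_cartesian _ _ _ _ _ S t).
Let dy (t : R) : is_derive t 1 y (- (b t * g (x t))) := proj2 (polar_to_cartesian _ _ _ _ _ S t).

Lemma mul_radial_ge0 (f : R -> R) (r w : R) : same_sign f -> 0 <= w * radial f r w.
Proof.
move=> sf; have -> : w * radial f r w = expR (- r) ^+ 2 * (f (expR r * w) * (expR r * w)).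
  transitivity ((expR (- r) * expR r) * expR (- r) * (f (expR r * w) * w)).
    by rewrite (mulrC (expR (- r)) (expR r)) expRxMexpNx_1 /radial; ring.
  by ring.
by apply: mulr_ge0; [exact: sqr_ge0|exact: same_sign_mul_ge0].
Qed.

Lemma mul_radial_le (f : R -> R) (r w z : R) : f 0 = 0 ->
  (forall u v : R, `|f u - f v| <= K * `|u - v|) -> `|w| <= 1 -> `|w| <= z ->
  w * radial f r w <= K * z.
Proof.
move=> f0 lf w1 wz; apply: le_trans (ler_norm _) _; rewrite normrM.
apply: le_trans (ler_piMl (normr_ge0 _) w1) _.
by apply: le_trans (radial_bound f K r w f0 lf) _; rewrite ler_wpM2l.
Qed.

(** As b <= 0, the g term only raises the angle, and near a ray with sin ga = 0 the h term is at
    most K |th - ga|: the x-axis cannot be crossed clockwise. *)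
Lemma th_above_preserved (ga u v : R) : sin ga = 0 -> t1 <= u -> u <= v -> v <= t2 ->
  ga <= th u -> ga <= th v.
Proof.
move=> sga u1 uv v2 gu; rewrite -subr_ge0.
have [_ cth] := solves_continuous _ _ _ _ S.
apply: (nonneg_preserved (fun t => th t - ga)
  (fun t => polar_th g h b t (s t) (th t) - 0) K u v uv); last by rewrite subr_ge0.
- by apply: continuous_sub => //; exact: cst_continuous.
- move=> t _; exact: is_derive_sub (proj2 (S t)) (is_derive_const _ _).
move=> t tuv; rewrite subr0 /polar_th.
have /andP[_ b0] : - beta <= b t <= 0 by apply: bneg; lra.
have c1 := mul_radial_ge0 g (s t) (cos (th t)) sg.
have sle : `|sin (th t)| <= `|th t - ga| by have := sin_lipschitz (th t) ga; rewrite sga subr0.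
have s1 := mul_radial_le h (s t) _ _ (proj1 sh) lh (sin_max (th t)) sle.
nra.
Qed.

(** Dually, the h term only lowers the angle and the g term vanishes on the y-axis, which cannot be
    crossed counterclockwise. *)
Lemma th_below_preserved (ga u v : R) : cos ga = 0 -> t1 <= u -> u <= v -> v <= t2 ->
  th u <= ga -> th v <= ga.
Proof.
move=> cga u1 uv v2 gu; rewrite -subr_ge0.
have [_ cth] := solves_continuous _ _ _ _ S.
apply: (nonneg_preserved (fun t => ga - th t)
  (fun t => 0 - polar_th g h b t (s t) (th t)) (beta * K) u v uv); last by rewrite subr_ge0.
- by apply: continuous_sub => //; exact: cst_continuous.
- move=> t _; exact: is_derive_sub (is_derive_const _ _) (proj2 (S t)).
move=> t tuv; rewrite sub0r /polar_th.
have /andP[b1 b0] : - beta <= b t <= 0 by apply: bneg; lra.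
have c1 := mul_radial_ge0 g (s t) (cos (th t)) sg.
have s1 := mul_radial_ge0 h (s t) (sin (th t)) sh.
have cle : `|cos (th t)| <= `|ga - th t|.
  by have := cos_lipschitz (th t) ga; rewrite cga subr0 distrC.
have := mul_radial_le g (s t) _ _ (proj1 sg) lg (cos_max (th t)) cle.
have := normr_ge0 (ga - th t).
set r := cos _ * _ in c1 *; set q := sin _ * _ in s1 *; set n := `|_| => n0 rn.
have : - beta * r <= b t * r by rewrite ler_wpM2r.
have : beta * r <= beta * (K * n) by rewrite ler_wpM2l //; lra.
lra.
Qed.

Lemma x_nondecreasing (u v : R) : u <= v -> (forall t : R, u <= t <= v -> 0 <= y t) -> x u <= x v.
Proof.
move=> uv hy; apply: (derive_ge0_le _ _ _ _ uv (fun t _ => dx t)) => t /hy.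
exact: same_sign_ge0.
Qed.

Lemma x_nonincreasing (u v : R) : u <= v -> (forall t : R, u <= t <= v -> y t <= 0) -> x v <= x u.
Proof.
move=> uv hy; apply: (derive_le0_ge _ _ _ _ uv (fun t _ => dx t)) => t /hy.
exact: same_sign_le0.
Qed.

Lemma y_nondecreasing (u v : R) : t1 <= u -> u <= v -> v <= t2 ->
  (forall t : R, u <= t <= v -> 0 <= x t) -> y u <= y v.
Proof.
move=> u1 uv v2 hx; apply: (derive_ge0_le _ _ _ _ uv (fun t _ => dy t)) => t tuv.
have /andP[_ b0] : - beta <= b t <= 0 by apply: bneg; lra.
by rewrite oppr_ge0 mulr_le0_ge0 // same_sign_ge0 // hx.
Qed.

Lemma y_nonincreasing (u v : R) : t1 <= u -> u <= v -> v <= t2 ->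
  (forall t : R, u <= t <= v -> x t <= 0) -> y v <= y u.
Proof.
move=> u1 uv v2 hx; apply: (derive_le0_ge _ _ _ _ uv (fun t _ => dy t)) => t tuv.
have /andP[_ b0] : - beta <= b t <= 0 by apply: bneg; lra.
by rewrite oppr_le0 mulr_le0 // same_sign_le0 // hx.
Qed.

Lemma x_ge0 (t : R) : - (pi / 2) <= th t <= pi / 2 -> 0 <= x t.
Proof. by move=> ht; rewrite mulr_ge0 ?expR_ge0 ?cos_ge0_pihalf. Qed.

Lemma y_ge0 (t : R) : 0 <= th t <= pi -> 0 <= y t.
Proof. by move=> ht; rewrite mulr_ge0 ?expR_ge0 ?sin_ge0_pi. Qed.

Lemma first_quadrant_invariant (u v : R) : t1 <= u -> u <= v -> v <= t2 ->
  0 <= th u <= pi / 2 -> 0 <= th v <= pi / 2.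
Proof.
move=> u1 uv v2 /andP[h0 hp]; rewrite (th_above_preserved 0 u v) ?sin0 //=.
by rewrite (th_below_preserved (pi / 2) u v) ?cos_pihalf.
Qed.

Variables (al be kap : R).
Hypotheses (al1 : t1 < al) (albe : al < be) (be2 : be < t2) (kap0 : 0 <= kap).
Hypothesis bkap : forall t : R, al <= t <= be -> b t <= - kap.

Lemma y_growth (ga : R) : 0 <= ga -> (forall t : R, al <= t <= be -> ga <= g (x t)) ->
  y al + kap * ga * (be - al) <= y be.
Proof.
move=> ga0 hg; apply: (derive_ge_growth _ _ _ _ _ (ltW albe) (fun t _ => dy t)) => t ht.
rewrite -mulNr; apply: ler_pM => //; last exact: hg.
by rewrite lerNr; exact: bkap.
Qed.

Lemma y_decay (ga : R) : 0 <= ga -> (forall t : R, al <= t <= be -> g (x t) <= - ga) ->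
  y be <= y al + - (kap * ga) * (be - al).
Proof.
move=> ga0 hg; apply: (derive_le_growth _ _ _ _ _ (ltW albe) (fun t _ => dy t)) => t ht.
rewrite lerN2 -[leRHS]mulrNN; apply: ler_pM => //; first by rewrite lerNr; exact: bkap.
by rewrite lerNr; exact: hg.
Qed.

(** The first quadrant is invariant, so x never falls below its initial value e^s, and y rises on
    [al, be] at speed at least kap * ga. *)
Lemma right_exit_large (eta ga : R) : 0 <= ga -> th t1 = 0 -> eta <= expR (s t1) ->
  (forall v : R, eta <= v -> ga <= g v) ->
  0 <= th t2 <= pi / 2 /\ kap * ga * (be - al) <= expR (s t2).
Proof.
move=> ga0 th1 hs hg; have pi0 := @pi_gt0 R.
have [a1 ab b2 t0] : [/\ t1 < al, al < be, be < t2 & t1 <= t2] by [].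
have Q t : t1 <= t -> t <= t2 -> 0 <= th t <= pi / 2.
  by move=> a c; apply: (first_quadrant_invariant t1 t) => //; rewrite th1; lra.
split; first exact: Q.
have xp t : t1 <= t -> t <= t2 -> 0 <= x t by move=> a c; apply: x_ge0; have := Q t a c; lra.
have yp t : t1 <= t -> t <= t2 -> 0 <= y t by move=> a c; apply: y_ge0; have := Q t a c; lra.
have xb t : t1 <= t -> t <= t2 -> eta <= x t.
  move=> a c; have xx : x t1 <= x t by apply: x_nondecreasing => // u hu; apply: yp; lra.
  by apply: le_trans xx; rewrite /x /cart_x th1 cos0 mulr1.
have G : y al + kap * ga * (be - al) <= y be.
  by apply: y_growth => // t ht; apply: hg; apply: xb; lra.
have y1 : 0 <= y al by apply: yp; lra.
have y2 : y be <= y t2 by apply: y_nondecreasing; try lra; move=> u hu; apply: xp; lra.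
have := cart_norm s th t2 => -[_ /(le_trans (ler_norm _))]; rewrite -/y; lra.
Qed.

(** On the positive y-axis g(x) vanishes, so y gets no push at first. The time [t1, al] serves to
    bring x up to gah * (al - t1); after that y rises on [al, be]. *)
Lemma top_exit_large (eta gah ga : R) : 0 <= ga -> 0 <= gah -> th t1 = pi / 2 -> eta <= expR (s t1) ->
  (forall v : R, eta <= v -> gah <= h v) -> (forall v : R, gah * (al - t1) <= v -> ga <= g v) ->
  0 <= th t2 <= pi / 2 /\ kap * ga * (be - al) <= expR (s t2).
Proof.
move=> ga0 gah0 th1 hs hh hg; have pi0 := @pi_gt0 R.
have [a1 ab b2 t0] : [/\ t1 < al, al < be, be < t2 & t1 <= t2] by [].
have Q t : t1 <= t -> t <= t2 -> 0 <= th t <= pi / 2.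
  by move=> a c; apply: (first_quadrant_invariant t1 t) => //; rewrite th1; lra.
split; first exact: Q.
have xp t : t1 <= t -> t <= t2 -> 0 <= x t by move=> a c; apply: x_ge0; have := Q t a c; lra.
have yp t : t1 <= t -> t <= t2 -> 0 <= y t by move=> a c; apply: y_ge0; have := Q t a c; lra.
have yb t : t1 <= t -> t <= t2 -> eta <= y t.
  move=> a c; have yy : y t1 <= y t by apply: y_nondecreasing => // u hu; apply: xp; lra.
  by apply: le_trans yy; rewrite /y /cart_y th1 sin_pihalf mulr1.
have xal : gah * (al - t1) <= x al.
  have : x t1 + gah * (al - t1) <= x al.
    apply: (derive_ge_growth _ _ _ _ _ (ltW al1) (fun t _ => dx t)) => t ht.
    by apply: hh; apply: yb; lra.
  by have := xp t1 (lexx _) t12; lra.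
have xb t : al <= t <= be -> gah * (al - t1) <= x t.
  move=> ht; apply: le_trans xal (x_nondecreasing al t _ _); first lra.
  by move=> u hu; apply: yp; lra.
have G : y al + kap * ga * (be - al) <= y be.
  by apply: y_growth => // t ht; apply: hg; exact: xb.
have y1 : 0 <= y al by apply: yp; lra.
have y2 : y be <= y t2 by apply: y_nondecreasing; try lra; move=> u hu; apply: xp; lra.
have := cart_norm s th t2 => -[_ /(le_trans (ler_norm _))]; rewrite -/y; lra.
Qed.

Lemma fourth_quadrant_right_half (t : R) : - (pi / 2) <= th t1 <= 0 -> 0 <= th t2 ->
  t1 <= t -> t <= t2 -> - (pi / 2) <= th t <= pi / 2.
Proof.
move=> /andP[a1 a2] a3 tl tr; have pi0 := @pi_gt0 R; apply/andP; split; last first.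
  by apply: (th_below_preserved (pi / 2) t1 t); rewrite ?cos_pihalf //; lra.
rewrite leNgt; apply/negP => lt.
have : th t2 <= - (pi / 2) by apply: (th_below_preserved _ t t2); rewrite ?cosN ?cos_pihalf // ltW.
lra.
Qed.

Lemma second_quadrant_upper_half (t : R) : pi / 2 <= th t1 <= pi -> th t2 <= pi / 2 ->
  t1 <= t -> t <= t2 -> 0 <= th t <= pi.
Proof.
move=> /andP[a1 a2] a3 tl tr; have pi0 := @pi_gt0 R; apply/andP; split.
  by apply: (th_above_preserved 0 t1 t); rewrite ?sin0 //; lra.
rewrite leNgt; apply/negP => lt.
have : pi <= th t2 by apply: (th_above_preserved _ t t2); rewrite ?sinpi // ltW.
lra.
Qed.

(** Here y increases to y t2 = 0, hence is nonpositive and x decreases. If x ended at eta or more,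
    it would be at least eta all along, and y would rise by more than B, although it starts at -B or
    above. *)
Lemma right_exit_small (B eta ga : R) : 0 <= ga -> - (pi / 2) <= th t1 <= 0 -> th t2 = 0 ->
  expR (s t1) <= B -> (forall v : R, eta <= v -> ga <= g v) -> B < kap * ga * (be - al) ->
  expR (s t2) < eta.
Proof.
move=> ga0 h1 h2 sB hg big; rewrite ltNge; apply/negP => small; have pi0 := @pi_gt0 R.
have [a1 ab b2 t0] : [/\ t1 < al, al < be, be < t2 & t1 <= t2] by [].
have xp t : t1 <= t -> t <= t2 -> 0 <= x t.
  by move=> a c; apply: x_ge0; apply: fourth_quadrant_right_half => //; rewrite h2.
have ym u v : t1 <= u -> u <= v -> v <= t2 -> y u <= y v.
  by move=> *; apply: y_nondecreasing => // t ht; apply: xp; lra.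
have y2 : y t2 = 0 by rewrite /y /cart_y h2 sin0 mulr0.
have x2 : x t2 = expR (s t2) by rewrite /x /cart_x h2 cos0 mulr1.
have G : y al + kap * ga * (be - al) <= y be.
  apply: y_growth => // t ht; apply: hg; apply: le_trans small _; rewrite -x2.
  by apply: x_nonincreasing => [|u hu]; [lra|rewrite -y2; apply: ym; lra].
have [_ ny] := cart_norm s th t1.
have /ler_normlP[ny1 _] := ny.
have alt : al <= t2 by rewrite ltW // (lt_trans ab).
have t1be : t1 <= be by rewrite ltW // (lt_trans a1).
have q1 := ym t1 al (lexx _) (ltW a1) alt.
have := ym be t2 t1be (ltW b2) (lexx _); rewrite y2 => q2.
rewrite -/y in ny1; lra.
Qed.

(** Now the time after [be] is used: with y >= eta all along, the growth of x up to x t2 = 0 forces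
    x <= - gah * (t2 - be) on [al, be]. Then y, at most B initially, would become negative. *)
Lemma top_exit_small (B eta gah ga : R) : 0 <= ga -> 0 <= gah -> pi / 2 <= th t1 <= pi ->
  th t2 = pi / 2 -> expR (s t1) <= B -> (forall v : R, eta <= v -> gah <= h v) ->
  (forall v : R, v <= - (gah * (t2 - be)) -> g v <= - ga) -> B < kap * ga * (be - al) ->
  expR (s t2) < eta.
Proof.
move=> ga0 gah0 h1 h2 sB hh hg big; rewrite ltNge; apply/negP => small; have pi0 := @pi_gt0 R.
have [a1 ab b2 t0] : [/\ t1 < al, al < be, be < t2 & t1 <= t2] by [].
have yp t : t1 <= t -> t <= t2 -> 0 <= y t.
  by move=> a c; apply: y_ge0; apply: second_quadrant_upper_half => //; rewrite h2.
have xm u v : t1 <= u -> u <= v -> v <= t2 -> x u <= x v.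
  by move=> *; apply: x_nondecreasing => // t ht; apply: yp; lra.
have x2 : x t2 = 0 by rewrite /x /cart_x h2 cos_pihalf mulr0.
have y2 : y t2 = expR (s t2) by rewrite /y /cart_y h2 sin_pihalf mulr1.
have ym u v : t1 <= u -> u <= v -> v <= t2 -> y v <= y u.
  by move=> *; apply: y_nonincreasing => // t ht; rewrite -x2; apply: xm; lra.
have xbe : x be + gah * (t2 - be) <= x t2.
  apply: (derive_ge_growth _ _ _ _ _ (ltW b2) (fun t _ => dx t)) => t ht.
  by apply: hh; apply: le_trans small _; rewrite -y2; apply: ym; lra.
have G : y be <= y al + - (kap * ga) * (be - al).
  apply: y_decay => // t ht; apply: hg.
  have : x t <= x be by apply: xm; lra.
  lra.
have [_ /(le_trans (ler_norm _)) ny] := cart_norm s th t1.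
have q1 : y al <= y t1 by apply: ym; lra.
have q2 : 0 <= y be by apply: yp; lra.
rewrite -/y in ny; lra.
Qed.

(** The bound is free of [beta]: y is nondecreasing, and x decreases while y < 0 and increases
    afterwards, so both are controlled by their values at the two ends. *)
Lemma right_exit_box (B t : R) : - (pi / 2) <= th t1 <= 0 -> 0 <= th t2 <= pi / 2 ->
  `|x t1| <= B -> `|y t1| <= B -> expR (s t2) <= B -> t1 <= t -> t <= t2 ->
  `|x t| <= B /\ `|y t| <= B.
Proof.
move=> h1 /andP[h2 h3] /ler_normlP[xa xb] /ler_normlP[ya yb] sB tl tr; have pi0 := @pi_gt0 R.
have [nx ny] := cart_norm s th t2.
have /ler_normlP[xa' xb'] := le_trans nx sB.
have /ler_normlP[ya' yb'] := le_trans ny sB.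
have xp u : t1 <= u -> u <= t2 -> 0 <= x u.
  by move=> a c; apply: x_ge0; apply: fourth_quadrant_right_half.
have ym u v : t1 <= u -> u <= v -> v <= t2 -> y u <= y v.
  by move=> *; apply: y_nondecreasing => // w hw; apply: xp; lra.
have y1 := ym t1 t (lexx _) tl tr; have y2 := ym t t2 tl tr (lexx _).
have xt := xp t tl tr; rewrite -/x -/y in xa' xb' ya' yb'.
have xle : x t <= B.
  have [y0|y0] := leP 0 (y t).
    apply: le_trans xb'; apply: x_nondecreasing => // u /andP[tu ut].
    exact: le_trans y0 (ym t u tl tu ut).
  apply: le_trans xb; apply: x_nonincreasing => // u /andP[tu ut].
  exact: le_trans (ym u t tu ut tr) (ltW y0).
split; first by rewrite ger0_norm.
by rewrite ler_norml (le_trans _ y1) 1?lerNl // (le_trans y2).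
Qed.

Lemma top_exit_box (B t : R) : pi / 2 <= th t1 <= pi -> 0 <= th t2 <= pi / 2 ->
  `|x t1| <= B -> `|y t1| <= B -> expR (s t2) <= B -> t1 <= t -> t <= t2 ->
  `|x t| <= B /\ `|y t| <= B.
Proof.
move=> h1 /andP[h2 h3] /ler_normlP[xa xb] /ler_normlP[ya yb] sB tl tr; have pi0 := @pi_gt0 R.
have [nx ny] := cart_norm s th t2.
have /ler_normlP[xa' xb'] := le_trans nx sB.
have /ler_normlP[ya' yb'] := le_trans ny sB.
have yp u : t1 <= u -> u <= t2 -> 0 <= y u.
  by move=> a c; apply: y_ge0; apply: second_quadrant_upper_half.
have xm u v : t1 <= u -> u <= v -> v <= t2 -> x u <= x v.
  by move=> *; apply: x_nondecreasing => // w hw; apply: yp; lra.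
have x1 := xm t1 t (lexx _) tl tr; have x2 := xm t t2 tl tr (lexx _).
have yt := yp t tl tr; rewrite -/x -/y in xa' xb' ya' yb'.
have yle : y t <= B.
  have [x0|x0] := leP 0 (x t).
    apply: le_trans yb'; apply: y_nondecreasing => // u /andP[tu ut].
    exact: le_trans x0 (xm t u tl tu ut).
  apply: le_trans yb; apply: y_nonincreasing => // u /andP[tu ut].
  exact: le_trans (xm u t tu ut tr) (ltW x0).
split; last by rewrite ger0_norm.
by rewrite ler_norml (le_trans _ x1) 1?lerNl // (le_trans x2).
Qed.
End SaddlePhase.

(** * Orbits with prescribed itinerary *)

Definition clamp {R : realType} (lo hi x : R) : R := Num.max lo (Num.min hi x).

Lemma clampP {R : realType} (lo hi x : R) : lo <= hi ->
  lo <= clamp lo hi x <= hi /\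
  [\/ x <= lo /\ clamp lo hi x = lo, hi <= x /\ clamp lo hi x = hi |
      lo <= x <= hi /\ clamp lo hi x = x].
Proof.
move=> lh; rewrite /clamp; have [hx|xh] := leP hi x.
  by rewrite (max_idPr lh) lh lexx; split => //; apply: Or32.
have [lx|xl] := leP lo x; last by rewrite lexx lh; split => //; apply: Or31; rewrite ltW.
by rewrite lx ltW //; split => //; apply: Or33.
Qed.

Lemma clamp_id {R : realType} (lo hi x : R) : lo <= x <= hi -> clamp lo hi x = x.
Proof. by move=> /andP[lx xh]; rewrite /clamp (min_idPr xh) (max_idPr lx). Qed.

Lemma clamp_le {R : realType} (lo hi x : R) : lo <= hi -> x <= lo -> clamp lo hi x = lo.
Proof.
by move=> lh xl; have [_ []] := clampP lo hi x lh => [[_ ->]|[? ->]|[? ->]] //; lra.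
Qed.

Lemma clamp_ge {R : realType} (lo hi x : R) : lo <= hi -> hi <= x -> clamp lo hi x = hi.
Proof.
by move=> lh xl; have [_ []] := clampP lo hi x lh => [[? ->]|[_ ->]|[? ->]] //; lra.
Qed.

Lemma clamp_interior {R : realType} (lo hi x : R) : lo < clamp lo hi x < hi -> clamp lo hi x = x.
Proof.
move=> /andP[h1 h2]; have [_ []] := clampP lo hi x (ltW (lt_trans h1 h2)).
- by move=> [_ e]; rewrite e ltxx in h1.
- by move=> [_ e]; rewrite e ltxx in h2.
- by case.
Qed.

Lemma clamp_lipschitz {R : realType} (lo hi x y : R) : lo <= hi ->
  `|clamp lo hi x - clamp lo hi y| <= `|x - y|.
Proof.
move=> lh; wlog xy : x y / x <= y.
  by move=> H; have [/H//|/ltW/H] := leP x y; rewrite distrC (distrC y).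
have /andP[h1 h2] : 0 <= clamp lo hi y - clamp lo hi x <= y - x.
  have [/andP[a1 a2] A] := clampP lo hi x lh; have [/andP[b1 b2] B] := clampP lo hi y lh.
  by case: A B => [[? ->]|[? ->]|[/andP[? ?] ->]] [[? ->]|[? ->]|[/andP[? ?] ->]];
    apply/andP; lra.
by rewrite distrC (distrC x) (ger0_norm h1) ger0_norm // (le_trans h1 h2).
Qed.

Lemma clamp_continuous {R : realType} (lo hi : R) : lo <= hi -> continuous (clamp lo hi).
Proof.
move=> lh; apply: (lipschitz_continuous1 _ 1) => x y; rewrite mul1r; exact: clamp_lipschitz.
Qed.

Lemma glue_continuous {T : topologicalType} {R : realType} (f si : T -> R) (low : R) :
  continuous f -> continuous si -> (forall z, f z = 0 -> si z = low) ->
  continuous (fun z => if f z <= 0 then low else si z).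
Proof.
move=> cf cs fs z.
have [fz|fz|fz] := ltgtP (f z) 0.
- have nf : \forall z' \near z, f z' < 0 :=
    cf z [set y | y < 0] (open_nbhs_nbhs (conj (@open_lt R 0) fz)).
  apply/cvgrPdist_lt => e e0; near=> z'.
  have -> : f z' <= 0 by apply: ltW; near: z'.
  by rewrite (ltW fz) subrr normr0.
- have nf : \forall z' \near z, 0 < f z' :=
    cf z [set y | 0 < y] (open_nbhs_nbhs (conj (@open_gt R 0) fz)).
  apply/cvgrPdist_lt => e e0; near=> z'.
  have fz' : 0 < f z' by near: z'.
  rewrite !leNgt fz fz' /=; near: z'.
  by move/cvgrPdist_lt: (cs z) => /(_ e e0).
- apply/cvgrPdist_lt => e e0; near=> z'.
  rewrite /= fz lexx -{1}(fs z fz); case: ifP => _; first by rewrite -(fs z fz) subrr normr0.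
  near: z'; by move/cvgrPdist_lt: (cs z) => /(_ e e0).
Unshelve. all: by end_near. Qed.

Lemma lipschitz_continuous2 {R : realType} (f : R * R -> R) (k : R) :
  (forall z w, `|f z - f w| <= k * (`|z.1 - w.1| + `|z.2 - w.2|)) -> continuous f.
Proof.
move=> lf z; apply/cvgrPdist_lt => e e0.
have k1 : 0 < 2 * (`|k| + 1) by rewrite mulr_gt0 // ltr_wpDl.
have c1 : continuous (fst : R * R -> R) by move=> q; exact: cvg_fst.
have c2 : continuous (snd : R * R -> R) by move=> q; exact: cvg_snd.
near=> w; apply: le_lt_trans (lf z w) _.
have z1 : `|z.1 - w.1| < e / (2 * (`|k| + 1)).
  by near: w; move/cvgrPdist_lt: (c1 z); apply; rewrite divr_gt0.
have z2 : `|z.2 - w.2| < e / (2 * (`|k| + 1)).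
  by near: w; move/cvgrPdist_lt: (c2 z); apply; rewrite divr_gt0.
move: z1 z2; rewrite !ltr_pdivlMr //; have := ler_norm k.
have := normr_ge0 (z.1 - w.1); have := normr_ge0 (z.2 - w.2); nra.
Unshelve. all: by end_near. Qed.

Lemma continuous_pair {T U V : topologicalType} (f : T -> U) (g : T -> V) :
  continuous f -> continuous g -> continuous (fun z => (f z, g z)).
Proof. by move=> cf cg z; apply: cvg_pair; [exact: cf|exact: cg]. Qed.

(* Once the first coordinate leaves [[sm, sp]] it never comes back, so a fixed point of the composition
   stays in the rectangle all along. *)
Lemma horseshoe_orbit {R : realType} (Psi : nat -> R * R -> R * R) (e : nat -> bool)
    (sm sp c d : R) (m : nat) :
  sm < sp -> c <= d -> (0 < m)%N -> (forall i, continuous (Psi i)) ->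
  (forall i z, c <= (Psi i z).2 <= d) ->
  (forall i z, z.1 <= sm -> if e i then (Psi i z).1 < sm else sp < (Psi i z).1) ->
  (forall i z, sp <= z.1 -> if e i then sp < (Psi i z).1 else (Psi i z).1 < sm) ->
  exists z : nat -> R * R,
   [/\ forall i, (i <= m)%N -> sm <= (z i).1 <= sp /\ c <= (z i).2 <= d,
       forall i, (i < m)%N -> z i.+1 = Psi i (z i) & z m = z 0%N].
Proof.
move=> sms cd m0 cPsi Psi2 left_face right_face.
pose C := fix C (n : nat) (z : R * R) := if n is n'.+1 then Psi n' (C n' z) else z.
(* [E n] records whether the first n maps together keep the left side on the left or exchange the
   two sides. *)
pose E := fix E (n : nat) := if n is n'.+1 then (e n' == E n') else true.
have CS n z : C n.+1 z = Psi n (C n z) by [].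
have cC n : continuous (C n).
  elim: n => [|n IH]; first by move=> z; exact: cvg_id.
  by apply: (continuous_compose (Psi n) (C n)).
have Cl n z : z.1 <= sm -> if E n then (C n z).1 <= sm else sp <= (C n z).1.
  move=> zl; elim: n => [//|n IH].
  rewrite CS /=; case: (E n) IH => IH; [have := left_face n _ IH|have := right_face n _ IH];
  by case: (e n) => /ltW.
have Cr n z : sp <= z.1 -> if E n then sp <= (C n z).1 else (C n z).1 <= sm.
  move=> zr; elim: n => [//|n IH].
  rewrite CS /=; case: (E n) IH => IH; [have := right_face n _ IH|have := left_face n _ IH];
  by case: (e n) => /ltW.
have Cl' z : z.1 <= sm -> if E m then (C m z).1 < sm else sp < (C m z).1.
  move=> zl; case: (m) m0 => // n _; have := Cl n z zl.
  rewrite CS /=; case: (E n) => H; [have := left_face n _ H|have := right_face n _ H]; by case: (e n).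
have Cr' z : sp <= z.1 -> if E m then sp < (C m z).1 else (C m z).1 < sm.
  move=> zr; case: (m) m0 => // n _; have := Cr n z zr.
  rewrite CS /=; case: (E n) => H; [have := right_face n _ H|have := left_face n _ H]; by case: (e n).
have C2 z : c <= (C m z).2 <= d by case: (m) m0 => // n _; rewrite CS.
pose sg : R := if E m then 1 else -1.
have cf1 : continuous (fun z => sg * ((C m z).1 - z.1)).
  apply: continuous_mul; first exact: cst_continuous.
  apply: continuous_sub; last by move=> z; exact: cvg_fst.
  by apply: (continuous_compose fst (C m)) => // z; exact: cvg_fst.
have cf2 : continuous (fun z : R * R => z.2 - (C m z).2).
  apply: continuous_sub; first by move=> z; exact: cvg_snd.
  by apply: (continuous_compose snd (C m)) => // z; exact: cvg_snd.
(* The second coordinate of [C m z] lies in [c, d]; enlarging the rectangle by 1 makes the sign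
   conditions on the horizontal sides strict. *)
have [|||||z [z1 z2 f1 f2]] := poincare_miranda _ _ sm sp (c - 1) (d + 1) cf1 cf2 sms.
- by lra.
- by move=> y; have := Cl' (sm, y) (lexx _); rewrite /sg /=; case: (E m) => ?; lra.
- by move=> y; have := Cr' (sp, y) (lexx _); rewrite /sg /=; case: (E m) => ?; lra.
- by move=> x; have := C2 (x, c - 1) => /=; lra.
- by move=> x; have := C2 (x, d + 1) => /=; lra.
have fix1 : (C m z).1 = z.1.
  by apply/eqP; rewrite -subr_eq0; move: f1; rewrite /sg; case: (E m) => ?; apply/eqP; lra.
have fix2 : (C m z).2 = z.2 by lra.
have out n : ~~ (sm <= (C n z).1 <= sp) -> forall r, ~~ (sm <= (C (n + r)%N z).1 <= sp).
  move=> H; elim=> [|r IH]; first by rewrite addn0.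
  rewrite addnS CS; move: IH; rewrite !negb_and -!ltNge => /orP[/ltW IH|/ltW IH].
    by have := left_face (n + r)%N _ IH; case: (e _) => ->; rewrite ?orbT.
  by have := right_face (n + r)%N _ IH; case: (e _) => ->; rewrite ?orbT.
exists (fun n => C n z); split => // [i im|].
  split.
    apply: contraT => /out /(_ (m - i)%N); rewrite subnKC // fix1 z1; by [].
  case: i im => [_|i im]; first by rewrite /= -fix2.
  by rewrite CS.
by rewrite (surjective_pairing (C m z)) fix1 fix2 -surjective_pairing.
Qed.

Lemma flow_exists {R : realType} (F1 F2 : R -> R -> R -> R) (L M : R) :
  0 < L -> lipschitz_field F1 L M -> lipschitz_field F2 L M ->
  exists Phi : R -> R * R -> R -> R * R,
   [/\ forall t0 z, Phi t0 z t0 = z,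
       forall t0 z, solves F1 F2 (fun t => (Phi t0 z t).1) (fun t => (Phi t0 z t).2) &
       forall t0 t, continuous (fun z => Phi t0 z t)].
Proof.
move=> L0 l1 l2.
have /choice[P HP] (q : R * (R * R)) : exists w : (R -> R) * (R -> R),
    [/\ w.1 q.1 = q.2.1, w.2 q.1 = q.2.2 & solves F1 F2 w.1 w.2].
  by have [u [v H]] := picard_lindelof F1 F2 L M q.1 q.2.1 q.2.2 L0 l1 l2; exists (u, v).
exists (fun t0 z t => ((P (t0, z)).1 t, (P (t0, z)).2 t)); split => [t0 z|t0 z|t0 t].
- by have [/= -> -> _] := HP (t0, z); rewrite -surjective_pairing.
- by have [_ _] := HP (t0, z).
pose Ex := expR (4 * L * `|t - t0|).
have E1 : 1 <= Ex by rewrite -expR0 ler_expR !mulr_ge0 // ltW.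
have D z w : ((P (t0, z)).1 t - (P (t0, w)).1 t) ^+ 2 + ((P (t0, z)).2 t - (P (t0, w)).2 t) ^+ 2 <=
    (Ex * (`|z.1 - w.1| + `|z.2 - w.2|)) ^+ 2.
  have [/= a1 a2 Sz] := HP (t0, z); have [/= b1 b2 Sw] := HP (t0, w).
  have := solves_distance F1 F2 L M _ _ _ _ t0 t l1 l2 (ltW L0) Sz Sw.
  rewrite a1 a2 b1 b2 -/Ex => /le_trans; apply.
  rewrite -(real_normK (num_real (z.1 - w.1))) -(real_normK (num_real (z.2 - w.2))).
  rewrite exprMn mulrC; apply: ler_pM; rewrite ?addr_ge0 ?sqr_ge0 ?expR_ge0 //.
    by rewrite expr2 ler_peMr // expR_ge0.
  have := mulr_ge0 (normr_ge0 (z.1 - w.1)) (normr_ge0 (z.2 - w.2)); nra.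
have root (a q : R) : 0 <= q -> a ^+ 2 <= q ^+ 2 -> `|a| <= q.
  by move=> q0; rewrite -(real_normK (num_real a)) ler_pXn2r ?nnegrE.
apply: continuous_pair; apply: (@lipschitz_continuous2 _ _ Ex) => z w /=; apply: root.
- by rewrite mulr_ge0 ?addr_ge0 ?expR_ge0.
- by have := D z w; have := sqr_ge0 ((P (t0, z)).2 t - (P (t0, w)).2 t); lra.
- by rewrite mulr_ge0 ?addr_ge0 ?expR_ge0.
- by have := D z w; have := sqr_ge0 ((P (t0, z)).1 t - (P (t0, w)).1 t); lra.
Qed.

Lemma sin_shift {R : realType} (a : R) (n : nat) : sin (a + 2 * n%:R * pi) = sin a.
Proof.
elim: n => [|n IH]; first by rewrite mulr0 mul0r addr0.
rewrite -[RHS]IH -[RHS]sinD2pi; congr sin.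
by rewrite -natr1 mulr2n; ring.
Qed.

Lemma cos_shift {R : realType} (a : R) (n : nat) : cos (a + 2 * n%:R * pi) = cos a.
Proof.
elim: n => [|n IH]; first by rewrite mulr0 mul0r addr0.
rewrite -[RHS]IH -[RHS]cosD2pi; congr cos.
by rewrite -natr1 mulr2n; ring.
Qed.

Lemma solves_shift_angle {R : realType} (g h b s th : R -> R) (n : nat) :
  solves (polar_s g h b) (polar_th g h b) s th ->
  solves (polar_s g h b) (polar_th g h b) s (fun t => th t + 2 * n%:R * pi).
Proof.
move=> S t; have [ds dth] := S t; rewrite /polar_s /polar_th sin_shift cos_shift.
by split => //; apply: is_derive_eq (is_derive_add _ _ _ _ _ dth (is_derive_const _ _)) _; rewrite addr0.
Qed.

Lemma is_derive_translate {R : realType} (f : R -> R) (c t a : R) :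
  is_derive (c + t) 1 f a -> is_derive t 1 (fun s => f (c + s)) a.
Proof.
move=> df; apply: is_derive_eq (is_derive_compose f (fun s => c + s) t a 1 df _) _; last by rewrite mulr1.
by apply: is_derive_eq (is_derive_add _ _ _ _ _ (is_derive_const c t) (is_derive_id t 1)) _; rewrite add0r.
Qed.

Lemma solves_shift_time {R : realType} (g h b s th : R -> R) (c : R) :
  (forall t, b (c + t) = b t) ->
  solves (polar_s g h b) (polar_th g h b) s th ->
  solves (polar_s g h b) (polar_th g h b) (fun t => s (c + t)) (fun t => th (c + t)).
Proof.
move=> bc S t; have [ds dth] := S (c + t).
by move: ds dth; rewrite /polar_s /polar_th bc => ds dth; split; apply: is_derive_translate.
Qed.

(* Positive exactly when the angle [th], followed from the fourth quadrant ([o = false]) or from the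
   second one ([o = true]), has entered the first quadrant. *)
Definition entry {R : realType} (o : bool) (th : R) : R := if o then pi / 2 - th else th.

(* During [[0, T1]] an orbit with symbol [j] turns clockwise into the second or fourth quadrant; adding
   [turn j], a multiple of 2pi, brings its angle back to [[-pi/2, 0]] ([j] even) or [[pi/2, pi]] ([j] odd). *)
Definition turn {R : realType} (j : nat) : R := 2 * ((j + 3)./2)%:R * pi.

(** [turn] rounds (j + 2) pi up to a multiple of 2 pi, so for both parities symbol j means an angle
    at T1 in the window [-(j + 2) pi - pi / 2, -(j + 2) pi]. The offset 2 puts even the window of j
    = 1 below -5 pi / 2, hence out of reach from s = sp. *)
Lemma turnE {R : realType} (j : nat) : turn j = (j%:R + 2 + (odd j)%:R) * pi :> R.
Proof.
rewrite /turn; congr (_ * pi).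
have -> : (j%:R + 2 + (odd j)%:R : R) = (j + 2 + odd j)%:R by rewrite !natrD.
rewrite -natrM; congr (_%:R); rewrite mul2n.
by have := odd_double_half (j + 3); rewrite oddD /=; case: (odd j) => /=; lia.
Qed.

Definition sector_lo {R : realType} (o : bool) : R := if o then pi / 2 else - (pi / 2).

Lemma entry_sector {R : realType} (o : bool) (th : R) :
  sector_lo o <= th <= sector_lo o + pi / 2 -> - (pi / 2) <= entry o th <= 0.
Proof. by rewrite /entry /sector_lo; case: o => ?; lra. Qed.

Lemma entry_sector_lo {R : realType} (o : bool) :
  entry o (sector_lo o) = if o then 0 else - (pi / 2) :> R.
Proof. by rewrite /entry /sector_lo; case: o; rewrite ?subrr. Qed.

Lemma entry_sector_hi {R : realType} (o : bool) :
  entry o (sector_lo o + pi / 2) = if o then - (pi / 2) else 0 :> R.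
Proof. by rewrite /entry /sector_lo; case: o; lra. Qed.

Lemma turn_below_sector {R : realType} (j k : nat) (a : R) : (j <= 2 * k)%N ->
  a <= - ((2 * k + 2)%:R * pi) - pi / 2 -> a + turn j <= sector_lo (odd j).
Proof.
have pi0 := @pi_gt0 R; move=> jk; have jk' : j%:R <= 2 * k%:R :> R by rewrite -natrM ler_nat.
have oj : odd j -> j%:R + 1 <= 2 * k%:R :> R.
  move=> oj; rewrite -natrM natr1 ler_nat ltn_neqAle jk andbT.
  by apply/eqP => e; move: oj; rewrite e oddM.
rewrite turnE natrD natrM /sector_lo.
by case: (odd j) oj => /= [/(_ isT) oj|_] ?; nra.
Qed.

Lemma turn_above_sector {R : realType} (j : nat) (a : R) : (1 <= j)%N ->
  - (5 * pi / 2) <= a -> sector_lo (odd j) + pi / 2 <= a + turn j.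
Proof.
have pi0 := @pi_gt0 R; move=> j1; have j1' : (1 : R) <= j%:R by rewrite ler1n.
have oj : ~~ odd j -> (2 : R) <= j%:R.
  by move=> oj; rewrite ler_nat; case: j oj j1 {j1'} => [|[]].
rewrite turnE /sector_lo.
by case: (odd j) oj => /= [_|/(_ isT) oj] ?; nra.
Qed.

Section Itinerary.
Variables (R : realType) (g h b : R -> R) (T T1 L M sm sp sim sip : R) (k : nat).
Let sol := solves (polar_s g h b) (polar_th g h b).
Hypotheses (L0 : 0 < L) (lip1 : lipschitz_field (polar_s g h b) L M)
  (lip2 : lipschitz_field (polar_th g h b) L M).
Hypotheses (smsp : sm < sp) (bT : forall t : R, b (T + t) = b t).
Hypothesis inner : forall s th, sol s th -> s 0 = sm -> 0 <= th 0 <= pi / 2 ->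
  th T1 <= - ((2 * k + 2)%:R * pi) - pi / 2.
Hypothesis outer : forall s th, sol s th -> s 0 = sp -> 0 <= th 0 <= pi / 2 ->
  - (5 * pi / 2) <= th T1.
Hypothesis range : forall s th, sol s th -> sm <= s 0 <= sp -> 0 <= th 0 <= pi / 2 ->
  sim <= s T1 <= sip.
Hypothesis saddle_invariant : forall o s th, sol s th -> sim <= s T1 <= sip ->
  - (pi / 2) <= entry o (th T1) <= 0 -> 0 < entry o (th T) -> 0 <= th T <= pi / 2.
Hypothesis saddle_large : forall o s th, sol s th -> sim <= s T1 <= sip ->
  entry o (th T1) = 0 -> 0 <= entry o (th T) /\ sp + 1 <= s T.
Hypothesis saddle_other : forall o s th, sol s th -> sim <= s T1 <= sip ->
  entry o (th T1) = - (pi / 2) -> entry o (th T) <= 0.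
Hypothesis saddle_small : forall o s th, sol s th -> sim <= s T1 <= sip ->
  - (pi / 2) <= entry o (th T1) <= 0 -> entry o (th T) = 0 -> s T <= sm - 1.

Definition symbol_segment (j : nat) (s th : R -> R) : Prop :=
  [/\ sm <= s 0 <= sp, 0 <= th 0 <= pi / 2,
      - (pi / 2) <= entry (odd j) (th T1 + turn j) <= 0,
      sm <= s T <= sp & 0 <= th T + turn j <= pi / 2].

(** The orbit closes up only modulo 2 pi in the angle, whence the integers [n]. Each period is also
    given as a solution restarted at time 0 with its angle in the first quadrant, the form to which
    [symbol_segment] refers. *)
Lemma itinerary_solution (xi : nat -> nat) (m : nat) : (0 < m)%N ->
  (forall i, (1 <= xi i <= 2 * k)%N) ->
  exists s th, [/\ sol s th,
    exists n : nat, forall t : R, s (m%:R * T + t) = s t /\ th (m%:R * T + t) = th t - 2 * n%:R * pi &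
    forall i, (i < m)%N -> exists (s' th' : R -> R) (n : nat), [/\ sol s' th', symbol_segment (xi i) s' th' &
      forall t : R, s (i%:R * T + t) = s' t /\ th (i%:R * T + t) = th' t - 2 * n%:R * pi]].
Proof.
move=> m0 xik; have pi0 := @pi_gt0 R.
have sms : sm < sp by [].
have [Phi [Phi0 PhiS Phic]] := flow_exists _ _ L M L0 lip1 lip2.
have uniq := fun s th s' th' t0 => solves_unique _ _ L M s th s' th' t0 lip1 lip2 (ltW L0).
have pi2 : (0 : R) <= pi / 2 by rewrite divr_ge0 // ltW.
have smsp1 : sm - 1 <= sp + 1 by lra.
have lohi o : sector_lo o <= sector_lo o + pi / 2 :> R by rewrite lerDl.
(* The maps must be total: [Q] retracts the plane onto the admissible initial data, and [w2] moves
   the angle at T1 to the nearest point of the sector of [j]. *)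
pose Q (z : R * R) := (clamp sm sp z.1, clamp 0 (pi / 2) z.2).
have QP z : sm <= (Q z).1 <= sp /\ 0 <= (Q z).2 <= pi / 2.
  by have [? _] := clampP sm sp z.1 (ltW sms); have [? _] := clampP 0 (pi / 2) z.2 pi2.
pose w1 z := Phi 0 (Q z) T1.
pose w2 j z := ((w1 z).1, clamp (sector_lo (odd j)) (sector_lo (odd j) + pi / 2) ((w1 z).2 + turn j)).
pose w3 j z := Phi T1 (w2 j z) T.
(* Orbits that miss the first quadrant get the value sm - 1. This is continuous: on the border,
   where [entry] is 0, [saddle_small] gives s <= sm - 1, which the clamp turns into exactly sm -
   1. *)
pose Psi j z := (if entry (odd j) (w3 j z).2 <= 0 then sm - 1 else clamp (sm - 1) (sp + 1) (w3 j z).1,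
   clamp 0 (pi / 2) (w3 j z).2).
have r1 z : sim <= (w1 z).1 <= sip.
  have [q1 q2] := QP z.
  by apply: (range _ _ (PhiS 0 (Q z))); rewrite Phi0.
have S3 j z := PhiS T1 (w2 j z).
have r2 j z : sim <= (Phi T1 (w2 j z) T1).1 <= sip by rewrite Phi0; exact: r1.
have e2 j z : - (pi / 2) <= entry (odd j) (Phi T1 (w2 j z) T1).2 <= 0.
  rewrite Phi0; apply: entry_sector.
  by have [] := clampP _ _ ((w1 z).2 + turn j) (lohi (odd j)).
have invariant j z := saddle_invariant (odd j) _ _ (S3 j z) (r2 j z) (e2 j z).
have small j z := saddle_small (odd j) _ _ (S3 j z) (r2 j z) (e2 j z).
have large j z := saddle_large (odd j) _ _ (S3 j z) (r2 j z).
have other j z := saddle_other (odd j) _ _ (S3 j z) (r2 j z).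
(* Orbits pushed to an edge of the sector have a known fate: from the edge shared with the first
   quadrant they end beyond sp, from the opposite edge they never enter. *)
have near_case j z : entry (odd j) (w2 j z).2 = 0 -> sp < (Psi j z).1.
  move=> en; have [] := large j z; first by rewrite Phi0.
  move=> f0 s0; rewrite /Psi /= leNgt.
  have -> : 0 < entry (odd j) (w3 j z).2.
    rewrite lt_neqAle f0 andbT; apply/eqP => /esym /(small j z); rewrite -/(w3 j z) in s0 *; lra.
  by rewrite /= (clamp_ge _ _ _ smsp1 s0) ltrDl.
have far_case j z : entry (odd j) (w2 j z).2 = - (pi / 2) -> (Psi j z).1 < sm.
  move=> en; have := other j z; rewrite Phi0 => /(_ en).
  by rewrite -/(w3 j z) /Psi /= => ->; lra.
have cPsi j : continuous (Psi j).
  have sub1 : continuous (fun z : R * R => z.1) by move=> z; exact: cvg_fst.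
  have sub2 : continuous (fun z : R * R => z.2) by move=> z; exact: cvg_snd.
  have cQ : continuous Q.
    apply: continuous_pair; apply: continuous_compose => //.
      exact/clamp_continuous/ltW.
    by apply: clamp_continuous; lra.
  have cw1 : continuous w1 by apply: continuous_compose (Phic 0 T1) cQ.
  have cw2 : continuous (w2 j).
    apply: continuous_pair; first exact: continuous_compose sub1 cw1.
    apply: continuous_compose; first by apply: clamp_continuous; lra.
    by apply: continuous_add; [exact: continuous_compose sub2 cw1|exact: cst_continuous].
  have cw3 : continuous (w3 j) by apply: continuous_compose (Phic T1 T) cw2.
  have c31 : continuous (fun z => (w3 j z).1) by exact: continuous_compose sub1 cw3.
  have c32 : continuous (fun z => (w3 j z).2) by exact: continuous_compose sub2 cw3.
  apply: continuous_pair.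
    apply: glue_continuous.
    - rewrite /entry; case: (odd j) => //.
      by apply: continuous_sub => //; exact: cst_continuous.
    - by apply: continuous_compose c31; apply: clamp_continuous; lra.
    move=> z /(small j z); rewrite -/(w3 j z).
    exact: clamp_le.
  by apply: continuous_compose c32; apply: clamp_continuous; lra.
have Psi2 j z : 0 <= (Psi j z).2 <= pi / 2.
  by have [] := clampP 0 (pi / 2) (w3 j z).2 pi2.
(* The lower edge of the fourth quadrant is the one away from the first quadrant, that of the second
   quadrant is the adjacent one; so the orientation alternates with the parity of j. *)
have lo_case j z : (w2 j z).2 = sector_lo (odd j) ->
    if ~~ odd j then (Psi j z).1 < sm else sp < (Psi j z).1.
  move=> e; have := far_case j z; have := near_case j z; rewrite e entry_sector_lo.
  by case: (odd j) => nn nf; [exact: nn|exact: nf].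
have hi_case j z : (w2 j z).2 = sector_lo (odd j) + pi / 2 ->
    if ~~ odd j then sp < (Psi j z).1 else (Psi j z).1 < sm.
  move=> e; have := far_case j z; have := near_case j z; rewrite e entry_sector_hi.
  by case: (odd j) => nn nf; [exact: nf|exact: nn].
have left_face j z : (1 <= j <= 2 * k)%N -> z.1 <= sm ->
    if ~~ odd j then (Psi j z).1 < sm else sp < (Psi j z).1.
  move=> /andP[_ jk] zl; have [_ q2] := QP z.
  have := inner _ _ (PhiS 0 (Q z)); rewrite Phi0 -/(w1 z) => /(_ (clamp_le _ _ _ (ltW sms) zl) q2).
  by move=> /(turn_below_sector j k _ jk) low; apply: lo_case; apply: clamp_le.
have right_face j z : (1 <= j <= 2 * k)%N -> sp <= z.1 ->
    if ~~ odd j then sp < (Psi j z).1 else (Psi j z).1 < sm.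
  move=> /andP[j1 _] zr; have [_ q2] := QP z.
  have := outer _ _ (PhiS 0 (Q z)); rewrite Phi0 -/(w1 z) => /(_ (clamp_ge _ _ _ (ltW sms) zr) q2).
  by move=> /(turn_above_sector j _ j1) high; apply: hi_case; apply: clamp_ge.
(* A value in [sm, sp] excludes every clamp, since both edges of the sector and the default sm - 1
   lead outside. What remains is the true flow over one period, turned back by [turn j]. *)
have genuine j z : sm <= z.1 <= sp -> 0 <= z.2 <= pi / 2 -> sm <= (Psi j z).1 <= sp ->
    symbol_segment j (fun t => (Phi 0 z t).1) (fun t => (Phi 0 z t).2) /\
    Psi j z = ((Phi 0 z T).1, (Phi 0 z T).2 + turn j).
  move=> z1 z2 zP.
  have Qz : Q z = z by rewrite /Q !clamp_id // -surjective_pairing.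
  have notlo : (w2 j z).2 = (w1 z).2 + turn j.
    have lc := lo_case j z; have hc := hi_case j z; case/andP: zP => zP1 zP2.
    have [_ []] := clampP _ _ ((w1 z).2 + turn j) (lohi (odd j)).
    - by move=> [_ /lc]; rewrite !ltNge zP1 zP2; case: (~~ _).
    - by move=> [_ /hc]; rewrite !ltNge zP1 zP2; case: (~~ _).
    - by case.
  have w3E : w3 j z = ((Phi 0 z T).1, (Phi 0 z T).2 + turn j).
    have S' := solves_shift_angle _ _ _ _ _ ((j + 3)./2) (PhiS 0 z).
    have [|| <- <-] := uniq _ _ _ _ T1 (S3 j z) S' _ _ T.
    - by rewrite Phi0 /w2 /= /w1 Qz.
    - by rewrite Phi0 notlo /w1 Qz.
    by rewrite /w3 -surjective_pairing.
  have fpos : 0 < entry (odd j) (w3 j z).2.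
    by rewrite ltNge; apply/negP => H; move: zP; rewrite /Psi /= H; lra.
  have q := invariant j z fpos.
  have P1 : (Psi j z).1 = (w3 j z).1.
    move: zP; rewrite /Psi /= (leNgt (entry _ _) 0) fpos /= => /andP[zP1 zP2].
    by apply: clamp_interior; rewrite (lt_le_trans _ zP1) 1?ltrBlDr ?ltrDl // (le_lt_trans zP2) ?ltrDl.
  have P2 : (Psi j z).2 = (w3 j z).2 by rewrite /Psi /= clamp_id.
  have PE : Psi j z = ((Phi 0 z T).1, (Phi 0 z T).2 + turn j).
    by rewrite -w3E (surjective_pairing (Psi j z)) P1 P2 -surjective_pairing.
  split => //; split; rewrite ?Phi0 //.
  - by have := e2 j z; rewrite Phi0 notlo /w1 Qz.
  - by move: zP; rewrite PE.
  - by move: q; rewrite -/(w3 j z) w3E.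
have [|||||z [zQ zS zm]] := horseshoe_orbit (fun i => Psi (xi i)) (fun i => ~~ odd (xi i)) sm sp 0 (pi / 2) m sms _ m0.
- by lra.
- by move=> i; exact: cPsi.
- by move=> i; exact: Psi2.
- by move=> i w; exact: left_face.
- by move=> i w; exact: right_face.
have G i : (i < m)%N -> symbol_segment (xi i) (fun t => (Phi 0 (z i) t).1) (fun t => (Phi 0 (z i) t).2) /\
    z i.+1 = ((Phi 0 (z i) T).1, (Phi 0 (z i) T).2 + turn (xi i)).
  move=> im; have [q1 q2] := zQ i (ltnW im); have [q3 _] := zQ i.+1 im.
  by rewrite (zS i im) in q3 *; exact: genuine.
have orbit i : (i <= m)%N -> exists n : nat, forall t : R,
    (Phi 0 (z 0%N) (i%:R * T + t)).1 = (Phi 0 (z i) t).1 /\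
    (Phi 0 (z 0%N) (i%:R * T + t)).2 = (Phi 0 (z i) t).2 - 2 * n%:R * pi.
  elim: i => [_|i IH im].
    by exists 0%N => t; rewrite mul0r add0r mulr0 mul0r subr0.
  have [n Hn] := IH (ltnW im); have [_ zE] := G i im.
  exists (n + (xi i + 3)./2)%N => t.
  have S1 := solves_shift_angle _ _ _ _ _ ((xi i + 3)./2) (solves_shift_time _ _ _ _ _ T bT (PhiS 0 (z i))).
  have [||e1 e2'] := uniq _ _ _ _ 0 S1 (PhiS 0 (z i.+1)) _ _ t.
  - by rewrite addr0 Phi0 zE.
  - by rewrite addr0 Phi0 zE.
  have -> : i.+1%:R * T + t = i%:R * T + (T + t) by rewrite -natr1; ring.
  have [-> ->] := Hn (T + t).
  by rewrite -e1 -e2' natrD; split => //; ring.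
exists (fun t => (Phi 0 (z 0%N) t).1), (fun t => (Phi 0 (z 0%N) t).2); split.
- exact: PhiS.
- by have [n] := orbit m (leqnn m); rewrite zm => Hn; exists n.
move=> i im; have [n Hn] := orbit i (ltnW im).
exists (fun t => (Phi 0 (z i) t).1), (fun t => (Phi 0 (z i) t).2), n.
by split; [exact: PhiS|exact: (proj1 (G i im))|exact: Hn].
Qed.
End Itinerary.

(** * Truncation and choice of the parameters *)

Lemma locally_lipschitz_continuous {R : realType} (f : R -> R) :
  locally_lipschitz f -> continuous f.
Proof.
move=> lf x; have [d [K [d0 H]]] := lf x.
apply/cvgrPdist_lt => e e0.
have K1 : 0 < `|K| + 1 by rewrite ltr_wpDl.
have ed : 0 < Num.min d (e / (`|K| + 1)) by rewrite lt_min d0 divr_gt0.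
have c : \forall y \near x, `|x - y| < Num.min d (e / (`|K| + 1)).
  by move/cvgrPdist_lt: (@cvg_id _ (nbhs x)); apply.
apply: filterS c => y; rewrite lt_min => /andP[yd ye].
apply: le_lt_trans (H x y _ _) _; first by rewrite subrr normr0.
  by rewrite distrC.
move: ye; rewrite ltr_pdivlMr //; have := ler_norm K; have := normr_ge0 (x - y); nra.
Qed.

(** Supremum argument: the constant on [a, t], for t close to the supremum [r], plus the local
    constant at [r] works up to any point below r + d, so b < r + d. *)
Lemma locally_lipschitz_segment {R : realType} (f : R -> R) (a b : R) : a <= b ->
  locally_lipschitz f ->
  exists2 K, 0 < K & forall x y, a <= x <= b -> a <= y <= b -> `|f x - f y| <= K * `|x - y|.
Proof.
move=> ab lf.
pose lip K t := forall x y : R, a <= x -> x <= y -> y <= t -> `|f x - f y| <= K * (y - x).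
pose A := [set t | a <= t <= b /\ exists2 K, 0 < K & lip K t].
have Aa : A a.
  split; first by rewrite lexx.
  exists 1 => // x y ax xy ya.
  have -> : y = x by lra.
  by rewrite !subrr normr0 mulr0.
have hs : has_sup A by split; [exists a|exists b => t [/andP[]]].
pose r := sup A.
have r0 : a <= r by exact: sup_upper_bound.
have r1 : r <= b by apply: ge_sup; [exists a|move=> t [/andP[]]].
have [d [L [d0 H]]] := lf r.
have [t [/andP[at_ tb] [K K0 Kt]] rt] := sup_adherent d0 hs.
have tr : t <= r by apply: sup_upper_bound => //; split; [rewrite at_|exists K].
pose K' := K + `|L|.
have L0 := normr_ge0 L; have LL := ler_norm L.
have ext t' : t' < r + d -> lip K' t'.
  move=> t'd x y ax xy yt'.
  have loc u v : t <= u -> u <= v -> v <= t' -> `|f u - f v| <= L * (v - u).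
    move=> tu uv vt; have := H u v; rewrite (distrC u v) (@ger0_norm _ (v - u)) ?subr_ge0 //.
    rewrite -/r in rt; apply; rewrite ltr_norml; lra.
  have [yt|ty] := leP y t.
    have := Kt x y ax xy yt; rewrite /K'; have : 0 <= y - x by lra.
    nra.
  have [tx|xt] := leP t x.
    have := loc x y tx xy yt'; rewrite /K'; have : 0 <= y - x by lra.
    nra.
  have := loc t y (lexx _) (ltW ty) yt'; have := Kt x t ax (ltW xt) (lexx _).
  have := ler_distD (f t) (f x) (f y); rewrite /K'.
  have : 0 <= y - t by lra. have : 0 <= t - x by lra.
  nra.
have K'0 : 0 < K' by rewrite ltr_wpDr.
have br : b < r + d.
  rewrite ltNge; apply/negP => H'.
  have : A (r + d / 2).
    split; first lra.
    by exists K' => //; apply: ext; lra.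
  move=> /(sup_upper_bound hs); rewrite -/r; lra.
exists K' => // x y /andP[ax xb] /andP[ay yb].
have [xy|/ltW yx] := leP x y.
  by rewrite (distrC x) (@ger0_norm _ (y - x)) ?subr_ge0 //; apply: (ext b br).
by rewrite distrC (@ger0_norm _ (x - y)) ?subr_ge0 //; apply: (ext b br).
Qed.

Lemma continuous_segment_bound {R : realType} (f : R -> R) (X : R) : continuous f ->
  exists2 G, 0 <= G & forall v, `|v| <= X -> `|f v| <= G.
Proof.
move=> cf; have [X0|X0] := leP 0 X; last first.
  by exists 0 => // v vX; have := le_lt_trans vX X0; rewrite ltNge normr_ge0.
have cnf : {within `[- X, X], continuous (fun v => `|f v|)}.
  apply: continuous_subspaceT => v; apply: cvg_norm; exact: cf.
have [|c _ cP] := EVT_max _ cnf; first lra.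
by exists `|f c| => // v vX; apply: cP; rewrite in_itv /= -ler_norml.
Qed.

Definition truncate {R : realType} (B : R) (f : R -> R) (v : R) : R := f (clamp (- B) B v).

Lemma truncate_id {R : realType} (B : R) (f : R -> R) (v : R) : `|v| <= B -> truncate B f v = f v.
Proof. by move=> vB; rewrite /truncate clamp_id // -ler_norml. Qed.

Lemma clamp_sign {R : realType} (B v : R) : 0 < B ->
  [/\ (0 < v -> 0 < clamp (- B) B v <= v), (v < 0 -> v <= clamp (- B) B v < 0),
      v = 0 -> clamp (- B) B v = 0 & `|clamp (- B) B v| <= B].
Proof.
move=> B0; have [c1 C] := clampP (- B) B v ltac:(lra).
split; last by rewrite ler_norml.
- by case: C => [[? ->]|[? ->]|[? ->]]; lra.
- by case: C => [[? ->]|[? ->]|[? ->]]; lra.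
- by case: C => [[? ->]|[? ->]|[? ->]]; lra.
Qed.

Lemma truncate_same_sign {R : realType} (B : R) (f : R -> R) : 0 < B ->
  same_sign f -> same_sign (truncate B f).
Proof.
move=> B0 sf; split=> [|v v0]; rewrite /truncate.
  by have [_ _ -> // _] := clamp_sign B 0 B0; exact: (proj1 sf).
have [p n _ _] := clamp_sign B v B0.
have [vn|vp|e] := ltgtP v 0; last by rewrite e eqxx in v0.
  by have /andP[_ c0] := n vn; rewrite nmulr_lgt0 //; exact: same_sign_lt0.
by have /andP[c0 _] := p vp; rewrite pmulr_lgt0 //; exact: same_sign_gt0.
Qed.

Lemma truncate_bound {R : realType} (B X G : R) (f : R -> R) : 0 < B ->
  (forall v, `|v| <= X -> `|f v| <= G) -> forall v, `|v| <= X -> `|truncate B f v| <= G.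
Proof.
move=> B0 bf v vX; apply: bf; have [p n z _] := clamp_sign B v B0; apply: le_trans vX.
have [v0|v0|v0] := ltgtP v 0.
- by have /andP[? ?] := n v0; rewrite !ltr0_norm //; lra.
- by have /andP[? ?] := p v0; rewrite !gtr0_norm.
- by rewrite z // v0.
Qed.

Lemma truncate_bounded_somewhere {R : realType} (B M : R) (g h : R -> R) : 0 < B ->
  bounded_somewhere g h M -> bounded_somewhere (truncate B g) (truncate B h) M.
Proof.
move=> B0.
have neg (f : R -> R) : (forall s, s <= 0 -> `|f s| <= M) -> forall s, s <= 0 -> `|truncate B f s| <= M.
  move=> H s s0; apply: H; have [_ n z _] := clamp_sign B s B0.
  by move: s0; rewrite le_eqVlt => /orP[/eqP/z ->|/n/andP[_ /ltW]].
have pos (f : R -> R) : (forall s, 0 <= s -> `|f s| <= M) -> forall s, 0 <= s -> `|truncate B f s| <= M.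
  move=> H s s0; apply: H; have [p _ z _] := clamp_sign B s B0.
  by move: s0; rewrite le_eqVlt => /orP[/eqP/esym/z ->|/p/andP[/ltW]].
by move=> [H|[H|[H|H]]]; [left|right; left|do 2 right; left|do 3 right]; auto.
Qed.

Lemma truncate_lipschitz {R : realType} (B : R) (f : R -> R) : 0 < B -> locally_lipschitz f ->
  exists2 K, 0 < K & forall x y, `|truncate B f x - truncate B f y| <= K * `|x - y|.
Proof.
move=> B0 lf; have [|K K0 H] := locally_lipschitz_segment f (- B) B _ lf; first lra.
exists K => // x y.
have [_ _ _ cx] := clamp_sign B x B0; have [_ _ _ cy] := clamp_sign B y B0.
apply: le_trans (H _ _ _ _) _; rewrite -?ler_norml // ler_pM2l //.
by apply: clamp_lipschitz; lra.
Qed.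

(** f itself may tend to 0 at infinity; its truncation is constant beyond B, so extrema over compact
    segments suffice. *)
Lemma truncate_coercive {R : realType} (B eta : R) (f : R -> R) : 0 < B -> 0 < eta ->
  continuous f -> same_sign f ->
  exists2 ga, 0 < ga & (forall v, eta <= v -> ga <= truncate B f v) /\
    (forall v, v <= - eta -> truncate B f v <= - ga).
Proof.
move=> B0 eta0 cf sf.
pose e := Num.min eta B; have e0 : 0 < e by rewrite lt_min eta0 B0.
have eB : e <= B by rewrite ge_min lexx orbT.
have [c1 c1i c1P] := EVT_min eB (continuous_subspaceT cf).
have [c2 c2i c2P] := @EVT_max R f (- B) (- e) ltac:(lra) (continuous_subspaceT cf).
move: c1i c2i; rewrite !in_itv /= => /andP[c1l c1r] /andP[c2l c2r].
have f1 : 0 < f c1 by apply: same_sign_gt0 => //; lra.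
have f2 : f c2 < 0 by apply: same_sign_lt0 => //; lra.
have ee : e <= eta by rewrite ge_min lexx.
exists (Num.min (f c1) (- f c2)); first by rewrite lt_min f1 oppr_gt0.
split => v hv.
  apply: le_trans (c1P (clamp (- B) B v) _); first by rewrite ge_min lexx.
  rewrite in_itv /=; have [_ C] := clampP (- B) B v ltac:(lra).
  by case: C => [[? ->]|[? ->]|[/andP[? ?] ->]]; lra.
apply: le_trans (c2P (clamp (- B) B v) _) _; last by rewrite lerNr ge_min lexx orbT.
rewrite in_itv /=; have [_ C] := clampP (- B) B v ltac:(lra).
by case: C => [[? ->]|[? ->]|[/andP[? ?] ->]]; lra.
Qed.

Lemma exp_le_cart {R : realType} (s th : R -> R) (t : R) :
  expR (s t) <= `|cart_x s th t| + `|cart_y s th t|.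
Proof.
rewrite !normrM (ger0_norm (expR_ge0 _)) -mulrDr ler_peMr ?expR_ge0 //.
have := cos2Dsin2 (th t).
rewrite -(real_normK (num_real (cos (th t)))) -(real_normK (num_real (sin (th t)))).
have := cos_max (th t); have := sin_max (th t).
have := normr_ge0 (cos (th t)); have := normr_ge0 (sin (th t)); nra.
Qed.

Lemma polar_s_bound {R : realType} (g h b : R -> R) (K t s th : R) : g 0 = 0 -> h 0 = 0 -> 0 <= K ->
  (forall x y, `|g x - g y| <= K * `|x - y|) -> (forall x y, `|h x - h y| <= K * `|x - y|) ->
  `|polar_s g h b t s th| <= K * (1 + `|b t|).
Proof.
move=> g0 h0 K0 lg lh; rewrite /polar_s.
have bd (f : R -> R) u w : f 0 = 0 -> (forall x y, `|f x - f y| <= K * `|x - y|) ->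
    `|u| <= 1 -> `|w| <= 1 -> `|w * radial f s u| <= K.
  move=> f0 lf u1 w1; rewrite normrM; apply: le_trans (ler_piMl _ w1) _ => //.
  by apply: le_trans (radial_bound f K s u f0 lf) _; rewrite ler_piMr.
apply: le_trans (ler_normB _ _) _; rewrite mulrDr mulr1 [in leLHS](normrM (b t)); apply: lerD.
  by apply: bd => //; [exact: sin_max|exact: cos_max].
rewrite mulrC ler_wpM2r //.
by apply: bd => //; [exact: cos_max|exact: sin_max].
Qed.

(** [B] is quantified after [sp] and [Bf] so that it can be defined from them. This is possible
    since [M] and [Gam] bound the truncated nonlinearities as well. *)
Lemma phase1_constants {R : realType} (g h : R -> R) (M beta T1 : R) :
  continuous g -> continuous h -> same_sign g -> same_sign h ->
  bounded_somewhere g h M -> 0 <= M -> 0 <= beta -> 0 <= T1 ->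
  exists sp Bf : R, 0 < Bf /\ forall (B : R) (b s th : R -> R), 0 < B ->
    (forall t : R, 0 <= t <= T1 -> 0 <= b t <= beta) ->
    solves (polar_s (truncate B g) (truncate B h) b) (polar_th (truncate B g) (truncate B h) b) s th ->
    (s 0 = sp -> 0 <= th 0 -> - (5 * pi / 2) < th T1) /\
    (s 0 <= sp -> forall t : R, 0 <= t <= T1 -> `|cart_x s th t| <= Bf /\ `|cart_y s th t| <= Bf).
Proof.
move=> cg ch sg sh four M0 beta0 T10.
have /choice[Gam HG] (X : R) : exists G, 0 <= G /\
    ((forall v, `|v| <= X -> `|g v| <= G) /\ (forall v, `|v| <= X -> `|h v| <= G)).
  have [G1 G10 H1] := continuous_segment_bound g X cg.
  have [G2 G20 H2] := continuous_segment_bound h X ch.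
  exists (G1 + G2); split; first lra.
  by split=> v vX; [have := H1 v vX|have := H2 v vX]; lra.
pose bd rho := apriori_bound ((1 + beta) * M) T1 rho (fun X => (1 + beta) * Gam X).
have GG X : 0 <= (1 + beta) * Gam X by rewrite mulr_ge0 ?addr_ge0 //; case: (HG X).
have MT : 0 <= (1 + beta) * M * T1 by rewrite !mulr_ge0 ?addr_ge0.
have bd0 rho : 0 <= rho -> 0 <= bd rho.
  by move=> r0; rewrite /bd /apriori_bound !addr_ge0 // mulr_ge0.
pose W := (1 + beta) * M * T1 + 1; have W0 : 0 < W by rewrite /W; lra.
have bW := bd0 W (ltW W0).
(* Should the radius drop below W at some time, [backward_bound] would give |x|, |y| <= bd W at time
   0, hence an initial radius of at most 2 * bd W, less than e^sp. *)
pose sp := ln (2 * bd W + 1).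
have spE : expR sp = 2 * bd W + 1 by rewrite lnK // posrE; lra.
have br := bd0 (expR sp) (expR_ge0 sp).
exists sp, (bd (expR sp) + 1); split; first lra.
move=> B b s th B0 bb S.
have sg' := truncate_same_sign B g B0 sg; have sh' := truncate_same_sign B h B0 sh.
have four' := truncate_bounded_somewhere B M g h B0 four.
have bg X v : `|v| <= X -> `|truncate B g v| <= Gam X.
  by apply: truncate_bound => //; case: (HG X) => _ [].
have bh X v : `|v| <= X -> `|truncate B h v| <= Gam X.
  by apply: truncate_bound => //; case: (HG X) => _ [].
have G0 X : 0 <= Gam X by case: (HG X).
have dx (t : R) := proj1 (polar_to_cartesian _ _ _ _ _ S t).
have dy (t : R) := proj2 (polar_to_cartesian _ _ _ _ _ S t).
split; last first.
  move=> s0 t ht; have [n1 n2] := cart_norm s th 0.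
  have se : expR (s 0) <= expR sp by rewrite ler_expR.
  have T1T : 0 <= T1 <= T1 by rewrite T10 lexx.
  have [] := forward_bound _ _ b _ _ Gam M beta T1 T1 (expR sp) T1T M0 beta0 G0 sg' sh'
    four' bg bh bb (fun t _ => dx t) (fun t _ => dy t) (le_trans n1 se) (le_trans n2 se) t ht.
  rewrite -/(bd _) => h1 h2; split; [move: h1|move: h2]; rewrite /cart_x /cart_y; clear -B0; lra.
move=> s0 th0.
apply: (outer_rotation _ _ _ s th M beta T1 W T10 M0 beta0 sg' sh' four' bb S th0); last first.
  by rewrite /W; lra.
move=> t /andP[t0 tT]; rewrite leNgt; apply/negP => small.
have [n1 n2] := cart_norm s th t.
have tb : 0 <= t <= T1 by rewrite t0.
have bb' (r : R) : 0 <= r <= t -> 0 <= b r <= beta by move=> hr; apply: bb; lra.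
have [h1 h2] := backward_bound _ _ b _ _ Gam M beta t T1 W tb M0 beta0 G0 sg' sh'
    four' bg bh bb' (fun t _ => dx t) (fun t _ => dy t) (le_trans n1 (ltW small)) (le_trans n2 (ltW small)).
rewrite -/(bd W) in h1 h2; have := exp_le_cart s th 0; rewrite s0 spE.
rewrite /cart_x /cart_y; lra.
Qed.

Lemma saddle_constants {R : realType} (g h : R -> R) (K T1 T al be b0 sim sip sm sp : R) :
  same_sign g -> same_sign h -> 0 <= K ->
  (forall x y, `|g x - g y| <= K * `|x - y|) -> (forall x y, `|h x - h y| <= K * `|x - y|) ->
  (forall eta, 0 < eta -> exists2 ga, 0 < ga & (forall v, eta <= v -> ga <= g v) /\
    (forall v, v <= - eta -> g v <= - ga)) ->
  (forall eta, 0 < eta -> exists2 ga, 0 < ga & (forall v, eta <= v -> ga <= h v) /\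
    (forall v, v <= - eta -> h v <= - ga)) ->
  T1 < al -> al < be -> be < T -> 0 < b0 ->
  exists2 mu0 : R, 0 < mu0 & forall (mu beta : R) (b : R -> R), mu0 < mu ->
   (forall t : R, T1 <= t <= T -> - beta <= b t <= 0) ->
   (forall t : R, al <= t <= be -> b t <= - (mu * b0)) ->
   forall (o : bool) (s th : R -> R), solves (polar_s g h b) (polar_th g h b) s th ->
   sim <= s T1 <= sip ->
   [/\ - (pi / 2) <= entry o (th T1) <= 0 -> 0 < entry o (th T) -> 0 <= th T <= pi / 2,
    entry o (th T1) = 0 -> 0 <= entry o (th T) /\ sp + 1 <= s T,
    entry o (th T1) = - (pi / 2) -> entry o (th T) <= 0 &
    - (pi / 2) <= entry o (th T1) <= 0 -> entry o (th T) = 0 -> s T <= sm - 1].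
Proof.
move=> sg sh K0 lg lh cg ch T1al albe beT b00.
have pi0 := @pi_gt0 R; have T1T : T1 <= T by lra.
(* The radius at T1 is at least e^sim, the level for the large exits (g1 on the right; h1, g2 at the
   top). The small exits refute a final radius of e^(sm - 1) or more (g3; h3, g4). *)
have [g1 g10 [G1 _]] := cg _ (expR_gt0 sim).
have [h1 h10 [H1 _]] := ch _ (expR_gt0 sim).
have [g2 g20 [G2 _]] := cg (h1 * (al - T1)) ltac:(by rewrite mulr_gt0 // subr_gt0).
have [g3 g30 [G3 _]] := cg _ (expR_gt0 (sm - 1)).
have [h3 h30 [H3 _]] := ch _ (expR_gt0 (sm - 1)).
have [g4 g40 [_ G4]] := cg (h3 * (T - be)) ltac:(by rewrite mulr_gt0 // subr_gt0).
pose ga := Num.min (Num.min g1 g2) (Num.min g3 g4).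
have ga0 : 0 < ga by rewrite !lt_min g10 g20 g30 g40.
have ga1 : ga <= g1 by rewrite !ge_min lexx.
have ga2 : ga <= g2 by rewrite !ge_min lexx orbT.
have ga3 : ga <= g3 by rewrite !ge_min lexx orbT.
have ga4 : ga <= g4 by rewrite !ge_min lexx !orbT.
have q0 : 0 < b0 * ga * (be - al) by rewrite !mulr_gt0 // subr_gt0.
(* One threshold for both tasks: e^(sp + 1) is to be reached by the large exits, and e^sip bounds
   the radius at T1, which the growth of y has to beat in the small ones. *)
pose D := expR (sp + 1) + expR sip + 1.
have D0 : 0 < D by rewrite /D; have := expR_ge0 (sp + 1); have := expR_ge0 sip; lra.
exists (D / (b0 * ga * (be - al))); first by rewrite divr_gt0.
move=> mu beta b; rewrite ltr_pdivrMr // => big bneg bkap o s th S /andP[s1 s2].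
have mu0 : 0 < mu by rewrite -(pmulr_lgt0 _ q0); lra.
have kap0 : 0 <= mu * b0 by rewrite mulr_ge0 // ltW.
have bigE (x : R) : ga <= x -> D < mu * b0 * x * (be - al).
  move=> gx; apply: lt_le_trans big _; rewrite !mulrA.
  apply: ler_wpM2r; first by rewrite subr_ge0 ltW.
  by rewrite ler_pM2l // mulr_gt0.
have es1 : expR sim <= expR (s T1) by rewrite ler_expR.
have es2 : expR (s T1) <= expR sip by rewrite ler_expR.
have e1 := expR_ge0 (sp + 1); have e2 := expR_ge0 sip.
have above ga' := th_above_preserved R g h b s th K beta T1 T sg sh K0 lh bneg S ga' T1 T.
have below ga' := th_below_preserved R g h b s th K beta T1 T sg sh K0 lg bneg S ga' T1 T.
case: o; rewrite /entry; split.
- move=> h0 hT; apply/andP; split; last by clear -hT; lra.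
  by apply: above; rewrite ?sin0 //; clear -h0 pi0; lra.
- move=> h0; have th1 : th T1 = pi / 2 by clear -h0; lra.
  have [h1' h2'] := top_exit_large R g h b s th K beta T1 T sg sh K0 T1T lg lh bneg S al be _
    T1al albe beT kap0 bkap (expR sim) h1 g2 (ltW g20) (ltW h10) th1 es1 H1 G2.
  split; first by clear -h1' pi0; lra.
  rewrite -ler_expR; apply: le_trans h2'.
  by have := bigE g2 ga2; rewrite /D; clear -e1 e2; lra.
- move=> h0; suff : pi <= th T by clear -pi0; lra.
  by apply: above; rewrite ?sinpi //; clear -h0; lra.
- move=> h0 hT; apply/ltW; rewrite -ltr_expR.
  apply: (top_exit_small R g h b s th K beta T1 T sg sh K0 T1T lh bneg S al be _
    T1al albe beT kap0 bkap (expR sip) _ h3 g4 (ltW g40) (ltW h30) _ _ es2 H3 G4); try by clear -h0 hT pi0; lra.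
  by have := bigE g4 ga4; rewrite /D; clear -e1 e2; lra.
- move=> h0 hT; apply/andP; split; first by clear -hT; lra.
  by apply: below; rewrite ?cos_pihalf //; clear -h0 pi0; lra.
- move=> th1.
  have [h1' h2'] := right_exit_large R g h b s th K beta T1 T sg sh K0 T1T lg lh bneg S al be _
    T1al albe beT kap0 bkap (expR sim) g1 (ltW g10) th1 es1 G1.
  split; first by clear -h1' pi0; lra.
  rewrite -ler_expR; apply: le_trans h2'.
  by have := bigE g1 ga1; rewrite /D; clear -e1 e2; lra.
- move=> h0; suff : th T <= - (pi / 2) by clear -pi0; lra.
  by apply: below; rewrite ?cosN ?cos_pihalf //; clear -h0; lra.
- move=> h0 hT; apply/ltW; rewrite -ltr_expR.
  apply: (right_exit_small R g h b s th K beta T1 T sg sh K0 T1T lg bneg S al be _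
    T1al albe beT kap0 bkap (expR sip) _ g3 (ltW g30) h0 hT es2 G3).
  by have := bigE g3 ga3; rewrite /D; clear -e1 e2; lra.
Qed.

(** * Compact sets in the quadrant and removal of the truncation *)

Definition polar_point {R : realType} (z : R * R) : R * R :=
  (expR z.1 * cos z.2, expR z.1 * sin z.2).

Lemma polar_point_continuous {R : realType} : continuous (@polar_point R).
Proof.
have c1 : continuous (fun z : R * R => z.1) by move=> z; exact: cvg_fst.
have c2 : continuous (fun z : R * R => z.2) by move=> z; exact: cvg_snd.
have ce := continuous_compose expR _ (@continuous_expR R) c1.
by apply: continuous_pair; apply: continuous_mul => //; apply: continuous_compose => //;
  [exact: continuous_cos|exact: continuous_sin].
Qed.

Lemma polar_point_neq0 {R : realType} (z : R * R) : polar_point z != (0, 0).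
Proof.
apply/eqP => -[/eqP c0 /eqP s0]; have := cos2Dsin2 z.2.
move: c0 s0; rewrite !mulf_eq0 !(gt_eqF (expR_gt0 z.1)) /= => /eqP -> /eqP ->.
by rewrite expr0n addr0 => /esym/eqP; rewrite oner_eq0.
Qed.

Lemma polar_point_first_quadrant {R : realType} (z : R * R) : 0 <= z.2 <= pi / 2 ->
  first_quadrant_punct (polar_point z).
Proof.
move=> z2; have pi0 := @pi_gt0 R; split; last split; last exact: polar_point_neq0.
  by rewrite mulr_ge0 ?expR_ge0 // cos_ge0_pihalf //; lra.
by rewrite mulr_ge0 ?expR_ge0 // sin_ge0_pi //; lra.
Qed.

Lemma polar_point_inj {R : realType} (z w : R * R) : 0 <= z.2 <= pi / 2 -> 0 <= w.2 <= pi / 2 ->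
  polar_point z = polar_point w -> z = w.
Proof.
move=> z2 w2 [ec es]; have pi0 := @pi_gt0 R.
have sq (v : R * R) : expR v.1 ^+ 2 = (expR v.1 * cos v.2) ^+ 2 + (expR v.1 * sin v.2) ^+ 2.
  by rewrite !exprMn -mulrDr cos2Dsin2 mulr1.
have e1 : expR z.1 = expR w.1.
  have := sq z; rewrite ec es -(sq w) => /eqP.
  by rewrite eqrXn2 ?expR_ge0 // => /eqP.
have z1 : z.1 = w.1 by exact: expR_inj.
move: ec; rewrite e1 => /(mulfI (lt0r_neq0 (expR_gt0 _))) ec.
have z2' : z.2 = w.2 by apply: cos_inj => //; rewrite in_itv /=; lra.
by rewrite (surjective_pairing z) z1 z2' -surjective_pairing.
Qed.

Lemma entry_turn_disjoint {R : realType} (j j' : nat) (a : R) :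
  - (pi / 2) <= entry (odd j) (a + turn j) <= 0 ->
  - (pi / 2) <= entry (odd j') (a + turn j') <= 0 -> j = j'.
Proof.
have pi0 := @pi_gt0 R.
have E (i : nat) : - (pi / 2) <= entry (odd i) (a + turn i) <= 0 -> - (pi / 2) <= a + (i%:R + 2) * pi <= 0.
  by rewrite turnE /entry; case: (odd i) => /=; rewrite ?addr0; lra.
wlog jj : j j' / (j <= j')%N.
  by move=> H; have [/H//|/ltnW/H q] := leqP j j' => h1 h2; apply/esym/q.
move=> /E h1 /E h2; move: jj; rewrite leq_eqVlt => /orP[/eqP //|lt].
have /(ler_wpM2r (ltW pi0)) : (j%:R + 1 : R) <= j'%:R by rewrite natr1 ler_nat.
by move=> ?; exfalso; lra.
Qed.

Lemma periodic_int {R : realType} {U : Type} (f : R -> U) (c : R) (q : int) (t : R) :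
  (forall t, f (c + t) = f t) -> f (q%:~R * c + t) = f t.
Proof.
move=> fc; have P (n : nat) r : f (n%:R * c + r) = f r.
  elim: n r => [|n IH] r; first by rewrite mul0r add0r.
  by rewrite -natr1 mulrDl mul1r -addrA IH fc.
case: q => n; first by rewrite -pmulrn P.
rewrite NegzE mulrNz -pmulrn.
by rewrite -[LHS](P n.+1); congr f; ring.
Qed.

Lemma period_decomposition {R : realType} (T t : R) (m : nat) : 0 < T -> (0 < m)%N ->
  exists (q : int) (i : nat) (r : R), [/\ (i < m)%N, 0 <= r <= T &
    t = q%:~R * (m%:R * T) + (i%:R * T + r)].
Proof.
move=> T0 m0; pose q := Num.floor (t / T); pose i := `|(q %% m)%Z|%N; pose r := t - q%:~R * T.
have mz : m%:Z != 0 by rewrite -lt0n in m0 *; apply/eqP; lia.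
have iE : i%:Z = (q %% m)%Z by rewrite /i gez0_abs // modz_ge0.
exists (q %/ m)%Z, i, r; split.
- by rewrite -ltz_nat iE; apply: ltz_pmod; lia.
- have /andP[f1 f2] := floor_itv (t / T).
  move: f1 f2; rewrite -/q ler_pdivlMr // ltr_pdivrMr // intrD mulrDl mul1r /r; lra.
have e : q%:~R = (q %/ m)%Z%:~R * m%:R + i%:R :> R.
  by rewrite [in LHS](divz_eq q m) intrD intrM -iE -!pmulrn.
by rewrite /r e; ring.
Qed.

(** On [T1, T] the angle is shifted by [turn j], after which the box lemmas of the saddle bound the
    orbit through its values at T1 and T. As [B] is independent of mu, this is what undoes the
    truncation. *)
Lemma segment_box {R : realType} (g h b s th : R -> R) (K beta T T1 sm sp B : R) (j : nat) :
  same_sign g -> same_sign h -> 0 <= K -> T1 <= T ->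
  (forall x y, `|g x - g y| <= K * `|x - y|) -> (forall x y, `|h x - h y| <= K * `|x - y|) ->
  (forall t : R, T1 <= t <= T -> - beta <= b t <= 0) -> 0 <= T1 -> expR sp <= B ->
  solves (polar_s g h b) (polar_th g h b) s th -> symbol_segment R T T1 sm sp j s th ->
  (forall t : R, 0 <= t <= T1 -> `|cart_x s th t| <= B /\ `|cart_y s th t| <= B) ->
  forall t : R, 0 <= t <= T -> `|cart_x s th t| <= B /\ `|cart_y s th t| <= B.
Proof.
move=> sg sh K0 T1T lg lh bneg T10 spB S [_ _ q3 /andP[_ q4] q5] bx t /andP[t0 tT].
have [tT1|T1t] := leP t T1; first by apply: bx; rewrite t0.
have [|nx ny] := bx T1; first by rewrite T10 lexx.
have S' := solves_shift_angle _ _ _ _ _ ((j + 3)./2) S.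
have cx (r : R) : cart_x s (fun t => th t + 2 * ((j + 3)./2)%:R * pi) r = cart_x s th r.
  by rewrite /cart_x cos_shift.
have cy (r : R) : cart_y s (fun t => th t + 2 * ((j + 3)./2)%:R * pi) r = cart_y s th r.
  by rewrite /cart_y sin_shift.
rewrite -cx -cy; rewrite -cx in nx; rewrite -cy in ny.
have eB : expR (s T) <= B by apply: le_trans spB; rewrite ler_expR.
move: q3; rewrite /entry -/(turn j); case: (odd j) => q3.
  apply: (top_exit_box R g h b s _ K beta T1 T sg sh K0 lh bneg S' B t _ q5 nx ny eB (ltW T1t) tT).
  by rewrite -/(turn j); lra.
exact: (right_exit_box R g h b s _ K beta T1 T sg sh K0 lg bneg S' B t q3 q5 nx ny eB (ltW T1t) tT).
Qed.

Lemma first_quadrant_core {R : realType} (g h bp bm : R -> R)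
    (M beta T T1 al be b0 a1 a2 om dl : R) (k : nat) :
  locally_lipschitz g -> locally_lipschitz h -> same_sign g -> same_sign h ->
  bounded_somewhere g h M -> 0 <= M ->
  0 < T1 -> T1 < T -> continuous bp -> continuous bm ->
  (forall t, bp (T + t) = bp t) -> (forall t, bm (T + t) = bm t) ->
  (forall t : R, 0 <= bp t <= beta) -> (forall t : R, 0 <= bm t <= beta) ->
  (forall t : R, 0 <= t <= T1 -> bm t = 0) -> (forall t : R, T1 <= t <= T -> bp t = 0) ->
  T1 < al -> al < be -> be < T -> 0 < b0 -> (forall t : R, al <= t <= be -> b0 <= bm t) ->
  0 <= a1 -> a1 <= a2 -> a2 <= T1 -> 0 < dl ->
  (forall v, `|v| <= dl -> om * v ^+ 2 <= h v * v) ->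
  (forall t v : R, a1 <= t <= a2 -> `|v| <= dl -> om * v ^+ 2 <= bp t * (g v * v)) ->
  (2 * k + 4)%:R * pi <= om * (a2 - a1) ->
  exists2 mu0 : R, 0 < mu0 & forall mu, mu0 < mu -> exists S : nat -> set (R * R),
   [/\ forall j, (1 <= j <= 2 * k)%N -> S j !=set0 /\ compact (S j) /\ S j `<=` @first_quadrant_punct R,
       forall j j', j != j' -> S j `&` S j' = set0 &
       forall (xi : nat -> nat) (m : nat), (0 < m)%N -> (forall i, (1 <= xi i <= 2 * k)%N) ->
       exists u : R -> R * R, [/\ forall t : R, is_derive t 1 (fun s => (u s).1) (h (u t).2) /\
          is_derive t 1 (fun s => (u s).2) (- ((bp t - mu * bm t) * g (u t).1)),
         forall t, u (m%:R * T + t) = u t, forall t, u t != (0, 0) &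
         forall i, (i < m)%N -> S (xi i) (u (i%:R * T))]].
Proof.
move=> lg lh sg sh four M0 T10 T1T cbp cbm bpT bmT bpb bmb bm0 bp0 T1al albe beT b00 bmal a10 a12 a2T dl0
  omh omg omk; have pi0 := @pi_gt0 R.
have beta0 : 0 <= beta by have := bpb 0; lra.
have cg := locally_lipschitz_continuous _ lg; have ch := locally_lipschitz_continuous _ lh.
have [sp [Bf [Bf0 P1]]] := phase1_constants g h M beta T1 cg ch sg sh four M0 beta0 (ltW T10).
pose B := Bf + expR sp; have B0 : 0 < B by rewrite addr_gt0 ?expR_gt0.
pose gB := truncate B g; pose hB := truncate B h.
have sgB : same_sign gB by exact: truncate_same_sign.
have shB : same_sign hB by exact: truncate_same_sign.
have [Kg Kg0 lgB'] := truncate_lipschitz B g B0 lg.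
have [Kh Kh0 lhB'] := truncate_lipschitz B h B0 lh.
pose K := Kg + Kh; have K0 : 0 < K by rewrite addr_gt0.
have lgB (x y : R) : `|gB x - gB y| <= K * `|x - y|.
  by apply: le_trans (lgB' x y) _; rewrite ler_wpM2r // /K; lra.
have lhB (x y : R) : `|hB x - hB y| <= K * `|x - y|.
  by apply: le_trans (lhB' x y) _; rewrite ler_wpM2r // /K; lra.
pose C := K * (1 + beta); have C0 : 0 <= C by rewrite mulr_ge0 ?addr_ge0 // ltW.
pose dl' := Num.min dl B; have dl'0 : 0 < dl' by rewrite lt_min dl0 B0.
have dl'1 : dl' <= dl by rewrite ge_min lexx.
have dl'2 : dl' <= B by rewrite ge_min lexx orbT.
(* The second term keeps the radius below dl' <= B throughout [0, T1] for orbits starting at s = sm: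
   there the linear lower bounds hold and truncation has no effect. *)
pose sm := Num.min (sp - 1) (ln dl' - C * T1).
have sm1 : sm <= sp - 1 by rewrite ge_min lexx.
have sm2 : sm <= ln dl' - C * T1 by rewrite ge_min lexx orbT.
have smsp : sm < sp by lra.
(* [C] bounds |s'| on [0, T1], and |x|, |y| <= Bf gives a radius of at most 2 * Bf. *)
pose sim := sm - C * T1; pose sip := ln (2 * Bf).
have sipE : expR sip = 2 * Bf by rewrite lnK // posrE mulr_gt0.
have [mu0 mu00 saddle] := saddle_constants gB hB K T1 T al be b0 sim sip sm sp sgB shB (ltW K0) lgB lhB
  (fun eta e0 => truncate_coercive B eta g B0 e0 cg sg)
  (fun eta e0 => truncate_coercive B eta h B0 e0 ch sh) T1al albe beT b00.
exists mu0 => // mu mumu; have mupos : 0 < mu := lt_trans mu00 mumu.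
pose b t := bp t - mu * bm t.
have b1 (t : R) : 0 <= t <= T1 -> b t = bp t by move=> ht; rewrite /b bm0 // mulr0 subr0.
have b2 (t : R) : T1 <= t <= T -> b t = - (mu * bm t) by move=> ht; rewrite /b bp0 // sub0r.
have bphase1 (t : R) : 0 <= t <= T1 -> 0 <= b t <= beta by move=> /b1 ->.
have bphase2 (t : R) : T1 <= t <= T -> - (mu * beta) <= b t <= 0.
  move=> /b2 ->; have /andP[q1 q2] := bmb t; rewrite lerN2 oppr_le0.
  by rewrite ler_pM2l // q2 mulr_ge0 // ltW.
have bkap (t : R) : al <= t <= be -> b t <= - (mu * b0).
  by move=> ht; rewrite b2 ?lerN2 ?ler_pM2l ?bmal //; clear -ht T1al beT; lra.
have bbound (t : R) : `|b t| <= beta + mu * beta.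
  have /andP[p1 p2] := bpb t; have /andP[q1 q2] := bmb t.
  have r1 : 0 <= mu * bm t by rewrite mulr_ge0 // ltW.
  have r2 : mu * bm t <= mu * beta by rewrite ler_pM2l.
  by rewrite /b ler_norml; clear -p1 p2 r1 r2; lra.
have cb : continuous b.
  by apply: continuous_sub => //; apply: continuous_mul => //; exact: cst_continuous.
have bT (t : R) : b (T + t) = b t by rewrite /b bpT bmT.
have [lip1 lip2] := polar_lipschitz gB hB b K _ (proj1 sgB) (proj1 shB) (ltW K0) lgB lhB cb bbound.
set L := 2 * K * _ in lip1 lip2; set Mf := K * _ in lip1 lip2.
have L0 : 0 < L by rewrite /L !mulr_gt0 // ltr_wpDr // addr_ge0 // mulr_ge0 // ltW.
pose sol := solves (polar_s gB hB b) (polar_th gB hB b).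
have drift s th : sol s th -> forall t : R, 0 <= t <= T1 -> `|polar_s gB hB b t (s t) (th t)| <= C.
  move=> S t ht; apply: le_trans (polar_s_bound _ _ _ _ _ _ _ (proj1 sgB) (proj1 shB) (ltW K0) lgB lhB) _.
  by have /andP[p1 p2] := bphase1 t ht; rewrite ger0_norm // /C ler_pM2l // lerD2l.
have outer s th : sol s th -> s 0 = sp -> 0 <= th 0 <= pi / 2 -> - (5 * pi / 2) <= th T1.
  by move=> S s0 /andP[t0 _]; have [H _] := P1 B b s th B0 bphase1 S; apply/ltW/H.
have box1 s th : sol s th -> s 0 <= sp -> forall t : R, 0 <= t <= T1 ->
    `|cart_x s th t| <= Bf /\ `|cart_y s th t| <= Bf.
  by move=> S; have [_ H] := P1 B b s th B0 bphase1 S.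
have inner s th : sol s th -> s 0 = sm -> 0 <= th 0 <= pi / 2 ->
    th T1 <= - ((2 * k + 2)%:R * pi) - pi / 2.
  move=> S s0 th0.
  have := inner_rotation gB hB b s th C om dl' a1 a2 T1 a10 a12 a2T C0 sgB shB _ S _ _ _ _.
  move=> H; have {H}: th T1 <= th 0 - om * (a2 - a1).
    apply: H => [t ht|t ht|||].
    - by have /andP[] := bphase1 t ht.
    - exact: le_trans (ler_norm _) (drift s th S t ht).
    - by rewrite s0 -(@lnK _ dl') ?posrE // ler_expR -lerBrDr.
    - by move=> v hv; rewrite /hB truncate_id ?(le_trans hv) //; apply: omh; exact: le_trans hv dl'1.
    - move=> t v ht hv; rewrite /gB truncate_id ?(le_trans hv) // b1; last by clear -ht a10 a2T; lra.
      by apply: omg => //; exact: le_trans hv dl'1.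
  by move=> th1; move: omk; rewrite !natrD; clear -th1 th0 pi0; lra.
have range s th : sol s th -> sm <= s 0 <= sp -> 0 <= th 0 <= pi / 2 -> sim <= s T1 <= sip.
  move=> S /andP[s0 s1] th0; apply/andP; split.
    have : s 0 + - C * (T1 - 0) <= s T1.
      apply: (derive_ge_growth _ _ _ _ _ (ltW T10) (fun t _ => proj1 (S t))) => t ht.
      by have /ler_normlP[+ _] := drift s th S t ht; rewrite lerNl.
    by rewrite subr0 mulNr => /(le_trans _); apply; rewrite /sim lerD2r.
  have [|n1 n2] := box1 s th S s1 T1; first by rewrite ltW //= lexx.
  rewrite -ler_expR sipE; apply: le_trans (exp_le_cart s th T1) _.
  by rewrite mulr_natl mulr2n lerD.
have sad := saddle mu (mu * beta) b mumu bphase2 bkap.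
have itin := itinerary_solution R gB hB b T T1 L Mf sm sp sim sip k L0 lip1 lip2 smsp bT inner outer range
  (fun o s th S r => let: And4 q _ _ _ := sad o s th S r in q)
  (fun o s th S r => let: And4 _ q _ _ := sad o s th S r in q)
  (fun o s th S r => let: And4 _ _ q _ := sad o s th S r in q)
  (fun o s th S r => let: And4 _ _ _ q := sad o s th S r in q).
have [Phi [Phi0 PhiS Phic]] := flow_exists _ _ L Mf L0 lip1 lip2.
(* Only the angle at T1 is prescribed, a closed condition that already separates the symbols;
   nothing is asked at time T. *)
pose A j := [set z : R * R | [/\ sm <= z.1 <= sp, 0 <= z.2 <= pi / 2 &
   - (pi / 2) <= entry (odd j) ((Phi 0 z T1).2 + turn j) <= 0]].
have segA j s th : sol s th -> symbol_segment R T T1 sm sp j s th -> A j (s 0, th 0).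
  move=> S [q1 q2 q3 _ _]; split => //=.
  have [||_ ->] := solves_unique _ _ L Mf _ _ s th 0 lip1 lip2 (ltW L0) (PhiS 0 (s 0, th 0)) S _ _ T1 => //;
    by rewrite Phi0.
exists (fun j => polar_point @` A j); split.
- move=> j jk; split; last split.
  (* Nonemptiness comes from the orbit with constant itinerary j and m = 1. *)
  + have [s [th [_ _ H]]] := itin (fun=> j) 1%N isT (fun=> jk).
    have [s' [th' [n [S' seg _]]]] := H 0%N isT.
    by exists (polar_point (s' 0, th' 0)), (s' 0, th' 0) => //; exact: segA.
  + apply: continuous_compact; first by apply: continuous_subspaceT; exact: polar_point_continuous.
    have c1 : continuous (fun z : R * R => z.1) by move=> z; exact: cvg_fst.
    have c2 : continuous (fun z : R * R => z.2) by move=> z; exact: cvg_snd.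
    apply: (subclosed_compact _ (compact_setX (@segment_compact _ sm sp) (@segment_compact _ 0 (pi / 2)))).
      pose e z := entry (odd j) ((Phi 0 z T1).2 + turn j).
      have ce : continuous e.
        have c3 : continuous (fun z => (Phi 0 z T1).2 + turn j).
          by apply: continuous_add; [exact: continuous_compose c2 (Phic 0 T1)|exact: cst_continuous].
        rewrite /e /entry; case: (odd j) => //.
        by apply: continuous_sub => //; exact: cst_continuous.
      have -> : A j = ((fun z => z.1) @^-1` `[sm, sp]%classic `&` (fun z => z.2) @^-1` `[0, pi / 2]%classic)
          `&` e @^-1` `[- (pi / 2), 0]%classic.
        by apply/seteqP; split => z /=; rewrite !in_itv /=; [case|case=> -[]].
      apply: closedI; first apply: closedI.
      * by apply: preimage_closed => [z _|]; [exact: c1|exact: itv_closed].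
      * by apply: preimage_closed => [z _|]; [exact: c2|exact: itv_closed].
      * by apply: preimage_closed => [z _|]; [exact: ce|exact: itv_closed].
    by move=> z [q1 q2 _]; split; rewrite /= in_itv.
  by move=> _ [z [_ q _] <-]; exact: polar_point_first_quadrant.
- move=> j j' jj; apply/seteqP; split => // p [[z [_ z2 ze] <-] [w [_ w2 we]]] /esym.
  move=> /(polar_point_inj _ _ z2 w2) zw; rewrite -zw in we.
  by move/eqP: jj; apply; exact: entry_turn_disjoint ze we.
move=> xi m m0 xik; have [s [th [S [n per] seg]]] := itin xi m m0 xik.
pose u t := polar_point (s t, th t).
have u_shift (s' th' : R -> R) (q : nat) (t r : R) : s t = s' r -> th t = th' r - 2 * q%:R * pi ->
    u t = polar_point (s' r, th' r).
  move=> e1 e2; rewrite /u /polar_point /= e1 -(cos_shift (th t) q) -(sin_shift (th t) q) e2.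
  by rewrite subrK.
have uper t : u (m%:R * T + t) = u t by have [e1 e2] := per t; exact: u_shift e1 e2.
have box2 (j : nat) s' th' : sol s' th' -> symbol_segment R T T1 sm sp j s' th' -> forall t : R, 0 <= t <= T ->
    `|cart_x s' th' t| <= B /\ `|cart_y s' th' t| <= B.
  move=> S' seg' t tT; apply: (segment_box gB hB b s' th' K (mu * beta) T T1 sm sp B j) => //.
  - exact: ltW K0.
  - exact: ltW T1T.
  - exact: ltW T10.
  - by rewrite /B lerDr ltW.
  move=> r hr; have s0 : s' 0 <= sp by case: seg' => /andP[].
  by have [q1 q2] := box1 s' th' S' s0 r hr; split; [apply: le_trans q1 _|apply: le_trans q2 _];
    rewrite /B lerDl expR_ge0.
(* All of the orbit lies where the truncated and the original nonlinearities agree. *)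
have ubox t : `|(u t).1| <= B /\ `|(u t).2| <= B.
  have [q [i [r [im r0 ->]]]] := period_decomposition T t m (lt_trans T10 T1T) m0.
  rewrite (periodic_int u (m%:R * T)) //.
  have [s' [th' [n' [S' sg' H]]]] := seg i im.
  have [e1 e2] := H r; rewrite (u_shift _ _ _ _ _ e1 e2).
  exact: (box2 _ _ _ S' sg' r r0).
exists u; split => //.
- move=> t; have [d1 d2] := polar_to_cartesian _ _ _ _ _ S t; have [u1 u2] := ubox t.
  by rewrite -(truncate_id B h _ u2) -(truncate_id B g _ u1).
- by move=> t; exact: polar_point_neq0.
move=> i im; have [s' [th' [n' [S' sg' H]]]] := seg i im.
have [] := H 0; rewrite addr0 => e1 e2; rewrite (u_shift _ _ _ _ _ e1 e2).
by exists (s' 0, th' 0) => //; exact: segA.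
Qed.

(** * Signs of the weight and rescaling of the system *)

Lemma positive_subinterval {R : realType} (a : R -> R) (lo hi p : R) : continuous a -> lo < hi ->
  lo <= p <= hi -> 0 < a p ->
  exists a1 a2, [/\ lo < a1, a1 < a2, a2 < hi & forall t : R, a1 <= t <= a2 -> a p / 2 <= a t].
Proof.
move=> ca lohi /andP[lp ph] ap.
have : \forall t \near p, a p / 2 < a t.
  by apply: (ca p [set y | a p / 2 < y]); apply: open_nbhs_nbhs; split; [exact: open_gt|rewrite /=; lra].
move=> /nbhs_ballP[e /= e0 eP].
pose l := Num.max lo (p - e); pose r := Num.min hi (p + e).
have l1 : lo <= l by rewrite le_max lexx.
have l2 : p - e <= l by rewrite le_max lexx orbT.
have r1 : r <= hi by rewrite ge_min lexx.
have r2 : r <= p + e by rewrite ge_min lexx orbT.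
have lr : l < r by rewrite /l /r gt_max !lt_min; apply/andP; split; apply/andP; split; lra.
(* The middle third avoids the end points of [lo, hi] even when p is one of them. *)
exists (l + (r - l) / 3), (l + 2 * (r - l) / 3); split; [lra|lra|lra|].
move=> t /andP[t1 t2]; apply/ltW; apply: eP.
by suff : `|p - t| < e by []; rewrite ltr_norml; lra.
Qed.

(** By continuity a negative value would persist on an interval of positive measure. *)
Lemma succ0_on_ge0 {R : realType} (a : R -> R) (lo hi t : R) : continuous a -> lo < hi ->
  succ0_on a lo hi -> lo <= t <= hi -> 0 <= a t.
Proof.
move=> ca lohi [ae _] ht; rewrite leNgt; apply/negP => at0.
have cN : continuous (fun t => - a t) by exact: continuous_opp.
have [|a1 [a2 [h1 h12 h2 H]]] := positive_subinterval _ lo hi t cN lohi ht; first by rewrite oppr_gt0.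
have neg : (@lebesgue_measure R).-negligible `[a1, a2]%classic.
  apply: negligibleS ae => r /=; rewrite in_itv /= => hr H'.
  have := H r hr; have := H' ltac:(lra); lra.
have : lebesgue_measure (`[a1, a2]%classic : set R) = 0%E.
  have E := measure_negligible (mu := @lebesgue_measure R) (measurable_itv `[a1, a2]) neg.
  exact: E.
rewrite lebesgue_measure_itv /= lte_fin h12 => /eqP.
by rewrite -EFinB eqe subr_eq0 (gt_eqF h12).
Qed.

Lemma succ0_on_witness {R : realType} (a : R -> R) (lo hi : R) : succ0_on a lo hi ->
  exists2 t, lo <= t <= hi & 0 < a t.
Proof.
move=> [_ pos]; apply: contrapT => none.
have E : [set t : R | (lo <= t <= hi)%R /\ (0 < a t)%R] = set0.
  by apply/seteqP; split => // t [ht at0]; apply: none; exists t.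
by move: pos; rewrite E measure0 ltxx.
Qed.

Lemma pos_part_pos {R : realType} (a : R -> R) (t : R) : 0 <= a t ->
  pos_part a t = a t /\ neg_part a t = 0.
Proof.
by move=> a0; rewrite /neg_part /pos_part ger0_norm //; split; field.
Qed.

Lemma pos_part_neg {R : realType} (a : R -> R) (t : R) : a t <= 0 ->
  pos_part a t = 0 /\ neg_part a t = - a t.
Proof.
by move=> a0; rewrite /neg_part /pos_part ler0_norm // addrN mul0r sub0r.
Qed.

Lemma pos_part_bounds {R : realType} (a : R -> R) (t : R) :
  0 <= pos_part a t <= `|a t| /\ 0 <= neg_part a t <= `|a t|.
Proof.
have [a0|/ltW a0] := leP 0 (a t).
  by have [-> ->] := pos_part_pos a t a0; rewrite ger0_norm //; split; lra.
by have [-> ->] := pos_part_neg a t a0; rewrite ler0_norm //; split; lra.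
Qed.

Lemma pos_part_continuous {R : realType} (a : R -> R) : continuous a ->
  continuous (pos_part a) /\ continuous (neg_part a).
Proof.
move=> ca; have cp : continuous (pos_part a).
  apply: continuous_mul; last exact: cst_continuous.
  by apply: continuous_add => // t; apply: cvg_norm; exact: ca.
by split => //; apply: continuous_sub.
Qed.

Lemma periodic_bounded {R : realType} (a : R -> R) (T : R) : 0 < T -> continuous a ->
  (forall t, a (T + t) = a t) -> exists2 A, 0 <= A & forall t, `|a t| <= A.
Proof.
move=> T0 ca aT; have [A A0 H] := continuous_segment_bound a T ca.
exists A => // t; have [q [i [r [i1 r0 ->]]]] := period_decomposition T t 1 T0 isT.
rewrite (periodic_int a (1%:R * T)); last by move=> u; rewrite mul1r aT.
case: i i1 => // _; rewrite mul0r add0r; apply: H; rewrite ger0_norm; by case/andP: r0.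
Qed.

(** The sets serve all m and all itineraries at once. That [u] avoids the origin is recorded for the
    later proof that the period is minimal. *)
Definition realizes {R : realType} (g h a : R -> R) (lam mu T : R) (k : nat)
    (D : set (R * R)) (S : nat -> set (R * R)) : Prop :=
  [/\ forall j, (1 <= j <= 2 * k)%N -> S j !=set0 /\ compact (S j) /\ S j `<=` D,
      forall j j', j != j' -> S j `&` S j' = set0 &
      forall (xi : nat -> nat) (m : nat), (0 < m)%N -> (forall i, (1 <= xi i <= 2 * k)%N) ->
      exists u : R -> R * R, [/\ is_solution g h a lam mu u,
        forall t, u (m%:R * T + t) = u t, forall t, u t != (0, 0) &
        forall i, (i < m)%N -> S (xi i) (u (i%:R * T))]].

Lemma liminf_ratio_lb {R : realType} (f : R -> R) : liminf_ratio_at0_pos f ->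
  exists c d : R, [/\ 0 < c, 0 < d & forall v : R, `|v| < d -> c * v ^+ 2 <= f v * v].
Proof.
move=> [c [d [c0 [d0 H]]]]; exists c, d; split => // v vd.
have [->|v0] := eqVneq v 0; first by rewrite expr0n /= !mulr0.
have -> : f v * v = f v / v * v ^+ 2 by field.
by apply: ler_wpM2r; [exact: sqr_ge0|exact: H].
Qed.

Lemma bounded_somewhereE {R : realType} (g h : R -> R) :
  (bounded_neg h \/ bounded_pos h \/ bounded_neg g \/ bounded_pos g) ->
  exists2 M, 0 <= M & bounded_somewhere g h M.
Proof.
have up (M x : R) : x <= M -> x <= `|M| by move=> xM; apply: le_trans xM (ler_norm _).
by move=> [[M H]|[[M H]|[[M H]|[M H]]]]; exists `|M| => //; rewrite /bounded_somewhere;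
  [left|right; left|do 2 right; left|do 3 right] => s /H /up.
Qed.

Lemma first_quadrant_family {R : realType} (g h a : R -> R) (T T1 : R) (k : nat) :
  locally_lipschitz g -> locally_lipschitz h -> cond_C0 g h ->
  (bounded_neg h \/ bounded_pos h \/ bounded_neg g \/ bounded_pos g) ->
  continuous a -> (forall t, a (T + t) = a t) -> 0 < T1 -> T1 < T ->
  succ0_on a 0 T1 -> prec0_on a T1 T ->
  exists2 Lam : R, 0 < Lam & forall lam, Lam < lam -> exists2 mu0 : R, 0 < mu0 &
    forall mu, mu0 < mu -> exists S, realizes g h a lam mu T k (@first_quadrant_punct R) S.
Proof.
move=> lg lh [h0 [hs [g0 [gs [hl gl]]]]] /bounded_somewhereE[M M0 four] ca aT T10 T1T apos aneg.
have pi0 := @pi_gt0 R; have T0 : 0 < T := lt_trans T10 T1T.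
have sg : same_sign g by []. have sh : same_sign h by [].
have ap t : 0 <= t <= T1 -> 0 <= a t by move=> ht; exact: (succ0_on_ge0 a 0 T1).
have cN : continuous (fun t => - a t) by exact: continuous_opp.
have an t : T1 <= t <= T -> a t <= 0.
  by move=> ht; rewrite -oppr_ge0; exact: (succ0_on_ge0 (fun t => - a t) T1 T).
have [p hp ap0] := succ0_on_witness _ _ _ apos.
have [a1 [a2 [a10 a12 a2T ha]]] := positive_subinterval a 0 T1 p ca T10 hp ap0.
have [q hq an0] := succ0_on_witness _ _ _ aneg.
have [al [be [T1al albe beT hb]]] := positive_subinterval _ T1 T q cN T1T hq an0.
set a0 := a p / 2 in ha; set b0 := - a q / 2 in hb.
have a00 : 0 < a0 by rewrite divr_gt0.
have b00 : 0 < b0 by rewrite divr_gt0.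
have [ch [dh [ch0 dh0 Hh]]] := liminf_ratio_lb _ hl.
have [cg [dg [cg0 dg0 Hg]]] := liminf_ratio_lb _ gl.
pose c := Num.min ch cg; have c0 : 0 < c by rewrite lt_min ch0 cg0.
have cch : c <= ch by rewrite ge_min lexx.
have ccg : c <= cg by rewrite ge_min lexx orbT.
have [A A0 HA] := periodic_bounded a T T0 ca aT.
have [cpos cneg] := pos_part_continuous a ca.
(* A rotation by (2 k + 4) pi takes angles up to pi / 2 below -(2 k + 2) pi - pi / 2. With lam > N^2
   / a0 the speed K c, where K = sqrt(lam a0), achieves it during [a1, a2]. *)
pose N := (2 * k + 4)%:R * pi / (c * (a2 - a1)).
have D0 : 0 < c * (a2 - a1) by rewrite mulr_gt0 // subr_gt0.
have N0 : 0 < N by rewrite divr_gt0 // mulr_gt0 // ltr0n addnS.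
exists (N ^+ 2 / a0); first by rewrite divr_gt0 // exprn_gt0.
move=> lam; rewrite ltr_pdivrMr // => lamN.
have lam0 : 0 < lam by rewrite -(pmulr_lgt0 _ a00); apply: le_lt_trans lamN; exact: sqr_ge0.
pose K := Num.sqrt (lam * a0).
have K2 : K ^+ 2 = lam * a0 by rewrite sqr_sqrtr // mulr_ge0 // ltW.
have K0 : 0 < K by rewrite sqrtr_gt0 mulr_gt0.
have KN : N <= K.
  by rewrite -(@ler_pXn2r _ 2) ?nnegrE ?ltW // K2.
(* With x = X / K both equations get the angular speed K c near the origin. *)
pose h' (v : R) : R := K * h v; pose g' (v : R) : R := g (v / K).
have lh' : locally_lipschitz h'.
  move=> x0; have [d [L [d0 H]]] := lh x0; exists d, (K * L); split => // y z hy hz.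
  by rewrite /h' -mulrBr normrM gtr0_norm // -mulrA ler_pM2l //; exact: H.
have lg' : locally_lipschitz g'.
  move=> x0; have [d [L [d0 H]]] := lg (x0 / K); exists (K * d), (L / K); split => [|y z hy hz].
    by rewrite mulr_gt0.
  have E (u v : R) : `|u / K - v / K| = `|u - v| / K.
    by rewrite -mulrBl normrM normfV (gtr0_norm K0).
  rewrite /g' -mulrA (mulrC K^-1) -E; apply: H; by rewrite E ltr_pdivrMr // mulrC.
have sg' : same_sign g'.
  split=> [|v v0]; first by rewrite /g' mul0r.
  rewrite /g' -[X in _ * X](divfK (lt0r_neq0 K0)) mulrA mulr_gt0 //.
  by apply: gs; rewrite mulf_neq0 // invr_neq0 // gt_eqF.
have sh' : same_sign h'.
  split=> [|v v0]; first by rewrite /h' h0 mulr0.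
  by rewrite /h' -mulrA mulr_gt0 //; exact: hs.
have four' : bounded_somewhere g' h' ((1 + K) * M).
  have b1 x : x <= M -> x <= (1 + K) * M.
    by move=> xM; apply: le_trans xM _; rewrite ler_peMl // lerDl ltW.
  have b2 x : `|x| <= M -> `|K * x| <= (1 + K) * M.
    by move=> xM; rewrite normrM gtr0_norm // mulrDl mul1r ler_wpDl // ler_pM2l.
  case: four => [H|[H|[H|H]]]; [left|right; left|do 2 right; left|do 3 right] => s ?.
  - exact/b2/H.
  - exact/b2/H.
  - by apply/b1/H; rewrite pmulr_lle0 // invr_gt0.
  - by apply/b1/H; rewrite pmulr_lge0 // invr_gt0.
have M'0 : 0 <= (1 + K) * M by rewrite mulr_ge0 // addr_ge0 // ltW.
pose beta := (1 + lam) * A.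
have bpb t : 0 <= lam * pos_part a t <= beta.
  have [/andP[q1 q2] _] := pos_part_bounds a t; have HAt := HA t.
  rewrite mulr_ge0 ?(ltW lam0) //= /beta mulrDl mul1r ler_wpDl // ler_pM2l //.
  exact: le_trans q2 HAt.
have bmb t : 0 <= neg_part a t <= beta.
  have [_ /andP[q1 q2]] := pos_part_bounds a t; have HAt := HA t.
  rewrite q1 /= /beta mulrDl mul1r ler_wpDr //; first by rewrite mulr_ge0 // ltW.
  exact: le_trans q2 HAt.
pose dl := Num.min dh (K * dg) / 2.
have dl0 : 0 < dl by rewrite divr_gt0 // lt_min dh0 mulr_gt0.
have dlh (v : R) : `|v| <= dl -> `|v| < dh.
  by move=> hv; apply: le_lt_trans hv _; rewrite /dl ltr_pdivrMr // gt_min ltr_pMr // ltr1n.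
have dlg (v : R) : `|v| <= dl -> `|v / K| < dg.
  move=> hv; rewrite normrM normfV (gtr0_norm K0) ltr_pdivrMr // mulrC.
  apply: le_lt_trans hv _; rewrite /dl ltr_pdivrMr // gt_min; apply/orP; right.
  by rewrite ltr_pMr ?mulr_gt0 // ltr1n.
have omh (v : R) : `|v| <= dl -> K * c * v ^+ 2 <= h' v * v.
  move=> hv; rewrite /h' -(mulrA K c) -(mulrA K (h v)) ler_pM2l //.
  by apply: le_trans (Hh v (dlh v hv)); rewrite ler_wpM2r ?sqr_ge0.
have omg (t v : R) : a1 <= t <= a2 -> `|v| <= dl ->
    K * c * v ^+ 2 <= lam * pos_part a t * (g' v * v).
  move=> ht hv; have tT : 0 <= t <= T1.
    by move: ht => /andP[h1 h2]; rewrite (le_trans (ltW a10)) //= (le_trans h2) // ltW.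
  rewrite (proj1 (pos_part_pos a t (ap t tT))).
  have w := Hg _ (dlg v hv); set x := v / K in w.
  have vE : v = K * x by rewrite /x mulrC divfK ?gt_eqF.
  have -> : K * c * v ^+ 2 = K ^+ 2 * (K * (c * x ^+ 2)) by rewrite vE; ring.
  have -> : lam * a t * (g' v * v) = lam * a t * (K * (g x * x)) by rewrite /g' -/x vE; ring.
  apply: ler_pM.
  - exact: sqr_ge0.
  - by apply: mulr_ge0; [exact: ltW|apply: mulr_ge0; [exact: ltW|exact: sqr_ge0]].
  - by rewrite K2 ler_pM2l //; exact: ha.
  by rewrite ler_pM2l //; apply: le_trans w; rewrite ler_wpM2r ?sqr_ge0.
have omk : (2 * k + 4)%:R * pi <= K * c * (a2 - a1).
  by rewrite -mulrA -ler_pdivrMr.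
have aTp t : pos_part a (T + t) = pos_part a t by rewrite /pos_part aT.
have aTn t : neg_part a (T + t) = neg_part a t by rewrite /neg_part aTp aT.
have cbp : continuous (fun t => lam * pos_part a t).
  by apply: continuous_mul => //; exact: cst_continuous.
have bmal t : al <= t <= be -> b0 <= neg_part a t.
  move=> ht; have tT : T1 <= t <= T.
    by move: ht => /andP[h1' h2']; rewrite (le_trans (ltW T1al)) //= (le_trans h2') // ltW.
  by rewrite (proj2 (pos_part_neg a t (an t tT))); exact: hb.
have [mu0 mu00 core] := first_quadrant_core g' h' (fun t => lam * pos_part a t) (neg_part a)
  ((1 + K) * M) beta T T1 al be b0 a1 a2 (K * c) dl k lg' lh' sg' sh' four' M'0 T10 T1T cbp cneg
  (fun t => congr1 (fun z => lam * z) (aTp t)) aTn bpb bmb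
  (fun t ht => proj2 (pos_part_pos a t (ap t ht)))
  (fun t ht => etrans (congr1 (fun z => lam * z) (proj1 (pos_part_neg a t (an t ht)))) (mulr0 lam))
  T1al albe beT b00 bmal
  (ltW a10) (ltW a12) (ltW a2T) dl0 omh omg omk.
exists mu0 => // mu mumu; have [S [S1 S2 S3]] := core mu mumu.
pose sc (z : R * R) : R * R := (z.1 / K, z.2).
have scinj : injective sc.
  by move=> [x y] [x' y'] [/(mulIf (invr_neq0 (lt0r_neq0 K0))) -> ->].
exists (fun j => sc @` S j); split.
- move=> j jk; have [[z Sz] [cS Sq]] := S1 j jk; split; last split.
  + by exists (sc z), z.
  + apply: continuous_compact => //; apply: continuous_subspaceT.
    apply: continuous_pair; last by move=> w; exact: cvg_snd.
    by apply: continuous_mul; [move=> w; exact: cvg_fst|exact: cst_continuous].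
  move=> _ [w /Sq [w1 [w2 w0]] <-]; split; last split => //=.
    by rewrite /= divr_ge0 // ltW.
  apply: contraNneq w0 => [[/eqP e1 e2]]; rewrite (surjective_pairing w) e2.
  by move: e1; rewrite mulf_eq0 invr_eq0 (gt_eqF K0) orbF => /eqP ->.
- move=> j j' jj; apply/seteqP; split => // z [[w Sw <-] [w' Sw' /scinj e]].
  have := S2 j j' jj => /seteqP[H _]; apply: (H w); split => //; by rewrite -e.
move=> xi m m0 xik; have [u [su pu nu Su]] := S3 xi m m0 xik.
exists (fun t => sc (u t)); split.
- move=> t; have [d1 d2] := su t; split; last exact: d2.
  apply: is_derive_eq (is_derive_mul _ _ _ _ _ d1 (is_derive_const K^-1 t)) _.
  by rewrite mulr0 addr0 /h' mulrAC divff ?gt_eqF // mul1r.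
- by move=> t; rewrite pu.
- move=> t; apply: contraNneq (nu t) => [[/eqP e1 e2]]; rewrite (surjective_pairing (u t)) e2.
  by move: e1; rewrite mulf_eq0 invr_eq0 (gt_eqF K0) orbF => /eqP ->.
by move=> i im; exists (u (i%:R * T)) => //; exact: Su.
Qed.

(** * Minimal periods and the third quadrant *)

(** If the coefficients at t and t + q differed, they would differ near t; comparing the second
    equation at both times gives g(x) = 0, so x = 0 near t. Then h(y) = x' = 0 and y = 0 at t,
    impossible away from the origin. *)
Lemma coefficient_period {R : realType} (g h a : R -> R) (lam mu q : R) (u : R -> R * R) :
  continuous a -> cond_C0 g h -> is_solution g h a lam mu u -> (forall t, u t != (0, 0)) ->
  periodic_fun u q -> periodic_fun (a_lm a lam mu) q.
Proof.
move=> ca [h0 [hs [g0 [gs _]]]] S u0 uq t.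
have [cp cn] := pos_part_continuous a ca.
have cb : continuous (a_lm a lam mu).
  by apply: continuous_sub; apply: continuous_mul => //; exact: cst_continuous.
pose w r := a_lm a lam mu (r + q) - a_lm a lam mu r.
have cw : continuous w.
  apply: continuous_sub => //; apply: (continuous_compose (a_lm a lam mu) (fun r => r + q)) => //.
  by apply: continuous_add; [move=> r; exact: cvg_id|exact: cst_continuous].
have wg r : w r * g (u r).1 = 0.
  have [_ d2] := S r; have [_] := S (r + q); rewrite uq (addrC r q) => d2'.
  have := is_derive_translate _ _ _ _ d2'.
  have -> : (fun s => (u (q + s)).2) = (fun s => (u s).2) by apply/funext => s; rewrite addrC uq.
  move=> d3; have := @derive_val _ _ _ _ _ _ _ d2; rewrite (@derive_val _ _ _ _ _ _ _ d3) => /oppr_inj E.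
  by rewrite /w mulrBl (addrC r q) E subrr.
apply/eqP; rewrite -subr_eq0 -/(w t); apply: contraT => wt.
have near_w : \forall r \near t, w r != 0.
  by apply: (cw t [set y | y != 0]); apply: open_nbhs_nbhs; split => //; exact: open_neq.
have near_x : \forall r \near t, 0 = (u r).1.
  apply: filterS near_w => r wr; apply/eqP; rewrite eq_sym; apply: contraT => xr.
  have /eqP := wg r; rewrite mulf_eq0 (negbTE wr) /= => /eqP gx.
  by have := gs _ xr; rewrite gx mul0r ltxx.
have [d1 _] := S t.
have d0 := near_eq_is_derive near_x (is_derive_const 0 t).
have hy : h (u t).2 = 0 by rewrite -(@derive_val _ _ _ _ _ _ _ d1) (@derive_val _ _ _ _ _ _ _ d0).
have x0 : 0 = (u t).1 by exact: nbhs_singleton near_x.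
have y0 : (u t).2 = 0.
  by apply/eqP; apply: contraT => yn; have := hs _ yn; rewrite hy mul0r ltxx.
by have := u0 t; rewrite (surjective_pairing (u t)) -x0 y0 eqxx.
Qed.

Lemma period_multiple {R : realType} (b : R -> R) (T T1 q : R) : 0 < T1 -> T1 < T -> 0 < q ->
  periodic_fun b T -> periodic_fun b q ->
  (forall t : R, 0 <= t <= T1 -> 0 <= b t) -> (forall t : R, T1 <= t <= T -> b t <= 0) ->
  (exists t : R, 0 < b t) -> (exists t : R, b t < 0) ->
  exists2 j : nat, (0 < j)%N & q = j%:R * T.
Proof.
move=> T10 T1T q0 bT bq bpos bneg [tp btp] [tn btn].
have T0 : 0 < T by lra.
(* A period of at most T / 2 would fit into [0, T1] or into [T1, T], where b has constant sign. *)
have half p : 0 < p -> p <= T / 2 -> ~ periodic_fun b p.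
  move=> p0 pT bp.
  have red c t : exists2 r, 0 <= r <= p & b t = b (c + r).
    have [n [i [r [i1 r0 E]]]] := period_decomposition p (t - c) 1 p0 isT.
    exists r => //; case: i i1 E => // _; rewrite mul0r add0r => E.
    have -> : t = n%:~R * p + (c + r) by rewrite -[t](subrK c) E; ring.
    by apply: periodic_int => v; rewrite addrC bp.
  have [T1h|T1h] := leP (T / 2) T1.
    have [r r0 E] := red 0 tn; have := bpos (0 + r) ltac:(lra); lra.
  have [r r0 E] := red T1 tp; have := bneg (T1 + r) ltac:(lra); lra.
have [n [i [r [i1 r0 E]]]] := period_decomposition T q 1 T0 isT.
have {i1}i0 : i = 0%N by case: i i1 E.
move: E; rewrite i0 !mul0r add0r mul1r => E.
have bnT v : b (n%:~R * T + v) = b v by apply: periodic_int => w; rewrite addrC bT.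
(* The remainder [r] of q modulo T is again a period, and so is T - r; unless r is 0 or T, one of
   them is positive and at most T / 2. *)
have br v : b (v + r) = b v.
  by rewrite -[RHS]bq E -(bnT (v + r)); congr b; ring.
have bTr v : b (v + (T - r)) = b v.
  by rewrite -br -[RHS]bT; congr b; ring.
have rcase : r = 0 \/ r = T.
  have [|rn] := eqVneq r 0; first by left.
  have [|rT] := eqVneq r T; first by right.
  exfalso; have r1 : 0 < r by rewrite lt_neqAle eq_sym rn; case/andP: r0.
  have r2 : r < T by rewrite lt_neqAle rT; case/andP: r0.
  have [rh|rh] := leP r (T / 2); first exact: (half r).
  by apply: (half (T - r)) => //; lra.
have [z qE] : exists z : int, q = z%:~R * T.
  by case: rcase E => -> ->; [exists n; rewrite addr0|exists (n + 1); rewrite intrD; ring].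
have z0 : 0 < z by move: q0; rewrite qE pmulr_lgt0 // ltr0z.
exists `|z|%N; first by rewrite absz_gt0 gt_eqF.
by rewrite qE -{1}(gtz0_abs z0) -pmulrn.
Qed.

Lemma realizes_minimal_period {R : realType} (g h a : R -> R) (lam mu T T1 : R) (k m : nat)
    (D : set (R * R)) (S : nat -> set (R * R)) (xi : int -> nat) :
  cond_C0 g h -> continuous a -> (forall t, a (T + t) = a t) -> 0 < lam -> 0 < mu ->
  0 < T1 -> T1 < T -> succ0_on a 0 T1 -> prec0_on a T1 T ->
  realizes g h a lam mu T k D S ->
  (forall n, (1 <= xi n <= 2 * k)%N) -> seq_minimal_period xi m ->
  exists u : R -> R * R, [/\ is_solution g h a lam mu u, minimal_period u (m%:R * T) &
    forall n : int, S (xi n) (u (n%:~R * T))].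
Proof.
move=> C0 ca aT lam0 mu0 T10 T1T apos aneg [S1 S2 S3] xik [m0 [xim xmin]].
have T0 : 0 < T := lt_trans T10 T1T.
have [u [su pu nu Su]] := S3 (fun i => xi i%:Z) m m0 (fun i => xik _).
have xiz (q n : int) : xi (q * m%:Z + n) = xi n.
  have P (i : nat) r : xi (i%:Z * m%:Z + r) = xi r.
    elim: i r => [|i IH] r; first by rewrite mul0r add0r.
    have -> : i.+1%:Z * m%:Z + r = i%:Z * m%:Z + r + m%:Z by rewrite intS; ring.
    by rewrite xim IH.
  case: q => i; first exact: P.
  by rewrite NegzE -[LHS](P i.+1); congr xi; ring.
have itinerary (n : int) : S (xi n) (u (n%:~R * T)).
  have mz : m%:Z != 0 by rewrite eqz_nat -lt0n.
  have iE : `|(n %% m)%Z|%N%:Z = (n %% m)%Z by rewrite gez0_abs // modz_ge0.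
  have im : (`|(n %% m)%Z| < m)%N by rewrite -ltz_nat iE; apply: ltz_pmod; rewrite ltz_nat.
  rewrite (divz_eq n m) xiz intrD intrM mulrDl -mulrA (periodic_int u (m%:R * T)) //.
  by rewrite -iE -pmulrn; exact: Su im.
exists u; split => //; split; first by rewrite mulr_gt0 // ltr0n.
split=> [t|q q0 qm uq]; first by rewrite addrC pu.
have cN : continuous (fun t => - a t) by exact: continuous_opp.
have ap t : 0 <= t <= T1 -> 0 <= a t by move=> ht; exact: (succ0_on_ge0 a 0 T1).
have an t : T1 <= t <= T -> a t <= 0.
  by move=> ht; rewrite -oppr_ge0; exact: (succ0_on_ge0 (fun t => - a t) T1 T).
have ppos t : 0 <= a t -> a_lm a lam mu t = lam * a t.
  by move=> /pos_part_pos[e1 e2]; rewrite /a_lm e1 e2 mulr0 subr0.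
have pneg t : a t <= 0 -> a_lm a lam mu t = mu * a t.
  by move=> /pos_part_neg[e1 e2]; rewrite /a_lm e1 e2 mulr0 sub0r mulrN opprK.
have [j j0 qE] : exists2 j : nat, (0 < j)%N & q = j%:R * T.
  apply: (period_multiple (a_lm a lam mu) T T1 q) => //.
  - by move=> t; rewrite /a_lm /neg_part /pos_part (addrC t T) aT.
  - exact: coefficient_period ca C0 su nu uq.
  - by move=> t /ap at0; rewrite ppos // mulr_ge0 // ltW.
  - by move=> t /an at0; rewrite pneg // pmulr_rle0.
  - have [t _ at0] := succ0_on_witness _ _ _ apos.
    by exists t; rewrite ppos ?mulr_gt0 // ltW.
  have [t _] := succ0_on_witness _ _ _ aneg; rewrite oppr_gt0 => at0.
  by exists t; rewrite pneg ?pmulr_rlt0 // ltW.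
apply: (xmin j j0).
  by move: qm; rewrite qE ltr_pM2r // ltr_nat.
move=> n; apply/eqP; apply: contraT => xne.
(* If xi differed at n and n + j, the point u (n T) = u ((n + j) T) would lie in two disjoint
   sets. *)
have /seteqP[H _] := S2 _ _ xne; apply: False_ind; apply: (H (u (n%:~R * T))); split => //.
by have := itinerary (n + j%:Z); rewrite intrD mulrDl -pmulrn -qE uq.
Qed.

(** The reflection replaces g and h by [rf g] and [rf h]. Boundedness on one half-line becomes
    boundedness on the other, so the fourfold alternative is preserved as a whole, though not each
    of its cases. *)
Lemma third_quadrant_family {R : realType} (g h a : R -> R) (T T1 : R) (k : nat) :
  locally_lipschitz g -> locally_lipschitz h -> cond_C0 g h ->
  (bounded_neg h \/ bounded_pos h \/ bounded_neg g \/ bounded_pos g) ->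
  continuous a -> (forall t, a (T + t) = a t) -> 0 < T1 -> T1 < T ->
  succ0_on a 0 T1 -> prec0_on a T1 T ->
  exists2 Lam : R, 0 < Lam & forall lam, Lam < lam -> exists2 mu0 : R, 0 < mu0 &
    forall mu, mu0 < mu -> exists S, realizes g h a lam mu T k (@third_quadrant_punct R) S.
Proof.
move=> lg lh C0 four ca aT T10 T1T apos aneg.
pose rf (f : R -> R) v := - f (- v).
have lrf f : locally_lipschitz f -> locally_lipschitz (rf f).
  move=> lf x0; have [d [L [d0 H]]] := lf (- x0); exists d, L; split => // y z hy hz.
  have := H (- y) (- z); rewrite /rf -!opprD !normrN; apply => //.
have srf (f : R -> R) : (forall y, y != 0 -> 0 < f y * y) -> forall y, y != 0 -> 0 < rf f y * y.
  by move=> H y y0; rewrite /rf mulNr -mulrN; apply: H; rewrite oppr_eq0.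
have limrf f : liminf_ratio_at0_pos f -> liminf_ratio_at0_pos (rf f).
  move=> [c [d [c0 [d0 H]]]]; exists c, d; split => //; split => // s s0 sd.
  by have := H (- s); rewrite oppr_eq0 normrN invrN mulrN -mulNr; apply.
have brn (f : R -> R) : bounded_neg f -> bounded_pos (rf f).
  by move=> [M H]; exists M => s s0; rewrite normrN; apply: H; rewrite oppr_le0.
have brp (f : R -> R) : bounded_pos f -> bounded_neg (rf f).
  by move=> [M H]; exists M => s s0; rewrite normrN; apply: H; rewrite oppr_ge0.
have C0' : cond_C0 (rf g) (rf h).
  have [h0 [hs [g0 [gs [hl gl]]]]] := C0.
  split; first by rewrite /rf oppr0 h0 oppr0.
  split; first exact: srf.
  split; first by rewrite /rf oppr0 g0 oppr0.
  by split; [exact: srf|split; exact: limrf].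
have four' : bounded_neg (rf h) \/ bounded_pos (rf h) \/ bounded_neg (rf g) \/ bounded_pos (rf g).
  by case: four => [H|[H|[H|H]]]; [right; left; exact: brn|left; exact: brp|do 3 right; exact: brn|
    do 2 right; left; exact: brp].
have [Lam Lam0 H] := first_quadrant_family (rf g) (rf h) a T T1 k (lrf g lg) (lrf h lh) C0' four'
  ca aT T10 T1T apos aneg.
exists Lam => // lam /H[mu0 mu00 {}H]; exists mu0 => // mu /H[S [S1 S2 S3]].
pose op (z : R * R) : R * R := (- z.1, - z.2).
have opK : involutive op by move=> [x y]; rewrite /op /= !opprK.
exists (fun j => op @` S j); split.
- move=> j jk; have [[z Sz] [cS Sq]] := S1 j jk; split; last split.
  + by exists (op z), z.
  + apply: continuous_compact => //; apply: continuous_subspaceT.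
    apply: continuous_pair; apply: continuous_opp => w; [exact: cvg_fst|exact: cvg_snd].
  move=> _ [w /Sq [w1 [w2 w0]] <-]; split; last split => //=; rewrite ?oppr_le0 //.
  apply: contraNneq w0 => [[/eqP e1 /eqP e2]]; rewrite (surjective_pairing w).
  by move: e1 e2; rewrite !oppr_eq0 => /eqP -> /eqP ->.
- move=> j j' jj; apply/seteqP; split => // z [[w Sw <-] [w' Sw' /(can_inj opK) e]].
  have := S2 j j' jj => /seteqP[H' _]; apply: (H' w); split => //; by rewrite -e.
move=> xi m m0 xik; have [u [su pu nu Su]] := S3 xi m m0 xik.
exists (fun t => op (u t)); split.
- move=> t; have [d1 d2] := su t; split.
    by apply: is_derive_eq (is_derive_opp _ _ _ d1) _; rewrite /rf opprK.
  by apply: is_derive_eq (is_derive_opp _ _ _ d2) _; rewrite /rf mulrN opprK.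
- by move=> t; rewrite pu.
- move=> t; apply: contraNneq (nu t) => [[/eqP e1 /eqP e2]]; rewrite (surjective_pairing (u t)).
  by move: e1 e2; rewrite !oppr_eq0 => /eqP -> /eqP ->.
by move=> i im; exists (u (i%:R * T)) => //; exact: Su.
Qed.

Theorem theorem5p2 (R : realType) (g h a : R -> R) (T T1 : R) (m : nat) :
  locally_lipschitz g -> locally_lipschitz h ->
  cond_C0 g h ->
  (bounded_neg h \/ bounded_pos h \/ bounded_neg g \/ bounded_pos g) ->
  0 < T -> continuous a -> periodic_fun a T -> sign_changing a ->
  0 < T1 -> T1 < T -> succ0_on a 0 T1 -> prec0_on a T1 T ->
  (2 <= m)%N ->
  forall k : nat, (0 < k)%N ->
  exists Lam : R, 0 < Lam /\
  forall lam : R, Lam < lam ->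
  exists mu_star : R, 0 < mu_star /\
  forall mu : R, mu_star < mu ->
  exists S1 S2 : nat -> set (R * R),
    (forall j : nat, (1 <= j <= 2 * k)%N ->
       (S1 j !=set0 /\ compact (S1 j) /\ S1 j `<=` (@first_quadrant_punct R)) /\
       (S2 j !=set0 /\ compact (S2 j) /\ S2 j `<=` (@third_quadrant_punct R))) /\
    (forall j j' : nat, (1 <= j <= 2 * k)%N -> (1 <= j' <= 2 * k)%N -> j != j' ->
       S1 j `&` S1 j' = set0 /\ S2 j `&` S2 j' = set0) /\
    forall xi : int -> nat,
      (forall n : int, (1 <= xi n <= 2 * k)%N) ->
      seq_minimal_period xi m ->
      exists u1 u2 : R -> R * R,
        is_solution g h a lam mu u1 /\ is_solution g h a lam mu u2 /\
        minimal_period u1 (m%:R * T) /\ minimal_period u2 (m%:R * T) /\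
        ~ same_class T m u1 u2 /\
        (forall n : int, S1 (xi n) (u1 (n%:~R * T)) /\ S2 (xi n) (u2 (n%:~R * T))).
Proof.
move=> lg lh C0 four T0 ca aT _ T10 T1T apos aneg m2 k _.
have aT' t : a (T + t) = a t by rewrite addrC aT.
have [L1 L10 H1] := first_quadrant_family g h a T T1 k lg lh C0 four ca aT' T10 T1T apos aneg.
have [L2 L20 H2] := third_quadrant_family g h a T T1 k lg lh C0 four ca aT' T10 T1T apos aneg.
exists (Num.max L1 L2); split; first by rewrite lt_max L10.
move=> lam; rewrite gt_max => /andP[lam1 lam2]; have lam0 := lt_trans L10 lam1.
have [M1 M10 {}H1] := H1 lam lam1; have [M2 M20 {}H2] := H2 lam lam2.
exists (Num.max M1 M2); split; first by rewrite lt_max M10.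
move=> mu; rewrite gt_max => /andP[mu1 mu2]; have mu0 := lt_trans M10 mu1.
have [S1 R1] := H1 mu mu1; have [S2 R2] := H2 mu mu2.
have [A1 B1 _] := R1; have [A2 B2 _] := R2.
exists S1, S2; split; first by move=> j jk; split; [exact: A1|exact: A2].
split; first by move=> j j' _ _ jj; split; [exact: B1|exact: B2].
move=> xi xik ximin.
have [u1 [s1 p1 i1]] := realizes_minimal_period g h a lam mu T T1 k m _ S1 xi C0 ca aT' lam0 mu0
  T10 T1T apos aneg R1 xik ximin.
have [u2 [s2 p2 i2]] := realizes_minimal_period g h a lam mu T T1 k m _ S2 xi C0 ca aT' lam0 mu0
  T10 T1T apos aneg R2 xik ximin.
exists u1, u2; do 4! split => //.
split; last by move=> n; split; [exact: i1|exact: i2].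
move=> [i [im E]].
(* A shift by i T would make u1 at 0 equal to u2 at i T; but the closed first and third quadrants
   meet only at the origin. *)
have [_ [_ q1]] := A1 _ (xik 0); have [_ [_ q2]] := A2 _ (xik i%:Z).
have [x1 [y1 n1]] := q1 _ (i1 0); have [x2 [y2 _]] := q2 _ (i2 i%:Z).
move: x2 y2; rewrite E -pmulrn subrr => x2 y2; rewrite mul0r in x1 y1 n1.
move/eqP: n1; apply; rewrite (surjective_pairing (u1 0)).
by congr pair; apply/eqP; rewrite eq_le ?x1 ?x2 ?y1 ?y2.
Qed.
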